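(* Let $(K,\mathrm{val})$ be a nontrivially valued algebraically closed field, let $A,B,C,D\in K$ have values $a,b,c,d$ respectively, and let $\Gamma_{ABCD}=\langle s_1,s_2,s_3\rangle$ act on the skeleton $Sk(a,b,c,d)$ by the tropical action (in which $s_i$ acts by $\mathrm{trop}(s_i)$). (a) If $\min\{a,b,c,d\}<0$, then there is a $\Gamma_{ABCD}$-invariant dense open subset $U\subset Sk(a,b,c,d)$ such that the action of $\Gamma_{ABCD}$ on $U$ is topologically conjugate to the action of the $(\infty,\infty,\infty)$-triangle reflection group on the hyperbolic plane $\mathbb{H}^2$. (b) If $\min\{a,b,c,d\}\geq 0$, then there is a group isomorphism $j\colon\Gamma_{ABCD}\to\ker(\mathrm{PGL}_2(\mathbb{Z})\to\mathrm{PGL}_2(\mathbb{Z}/2\mathbb{Z}))$ such that the action of $\Gamma_{ABCD}$ on $Sk(a,b,c,d)$ is conjugate (via a homeomorphism equivariant with respect to $j$) to the linear action of $j(\Gamma_{ABCD})$ on $\mathbb{R}^2/\{\pm1\}$, the plane modulo antipodes.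
   Context: A valuation is a map $\mathrm{val}\colon K\to\mathbb{R}\cup\{\infty\}$ with $\mathrm{val}(x)=\infty$ iff $x=0$, $\mathrm{val}(xy)=\mathrm{val}(x)+\mathrm{val}(y)$, $\mathrm{val}(x+y)\ge\min\{\mathrm{val}(x),\mathrm{val}(y)\}$; it is nontrivial if $\mathrm{val}(x)\ne0$ for some $x\in K^\times$. Conventions: $\infty+x=\infty$, $\min\{\infty,x\}=x$. The Markov surface is $S_{ABCD}\colon X_1^2+X_2^2+X_3^2+X_1X_2X_3=AX_1+BX_2+CX_3+D$. Its Vieta involutions are $s_1(X_1,X_2,X_3)=(-X_1-X_2X_3+A,X_2,X_3)$, $s_2(X_1,X_2,X_3)=(X_1,-X_2-X_1X_3+B,X_3)$, $s_3(X_1,X_2,X_3)=(X_1,X_2,-X_3-X_1X_2+C)$, and $\Gamma_{ABCD}=\langle s_1,s_2,s_3\rangle$ is the group of automorphisms of $S_{ABCD}$ they generate, which is the free product of the three order-two groups $\langle s_i\rangle$. The skeleton is the set $Sk(a,b,c,d)\subset\mathbb{R}^3$ of points with $$x_1+x_2+x_3=\min\{2x_1,2x_2,2x_3,a+x_1,b+x_2,c+x_3,d\},$$ with the topology induced from $\mathbb{R}^3$ (it is the boundary of the open set where $x_1+x_2+x_3$ is strictly smaller than that minimum). The tropicalized Vieta involutions are $\mathrm{trop}(s_1)(x)=(\min\{2x_2,2x_3,b+x_2,c+x_3,d\}-x_1,x_2,x_3)$, $\mathrm{trop}(s_2)(x)=(x_1,\min\{2x_1,2x_3,a+x_1,c+x_3,d\}-x_2,x_3)$,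 $\mathrm{trop}(s_3)(x)=(x_1,x_2,\min\{2x_1,2x_2,a+x_1,b+x_2,d\}-x_3)$. They are involutions of $\mathbb{R}^3$ preserving $Sk(a,b,c,d)$, so $s_i\mapsto\mathrm{trop}(s_i)$ defines an action of $\Gamma_{ABCD}$ on $Sk(a,b,c,d)$, the tropical action. The $(\infty,\infty,\infty)$-triangle reflection group is the group of isometries of $\mathbb{H}^2$ generated by the reflections in the three sides of an ideal triangle. Actions of groups $G$ on $X$ and $G'$ on $Y$ are topologically conjugate if there are a group isomorphism $\theta\colon G\to G'$ and a homeomorphism $h\colon X\to Y$ with $h(g.x)=\theta(g).h(x)$. *)

(* Defs.v *)
From HB Require Import structures.
From mathcomp Require Import all_boot all_order all_algebra.
From mathcomp Require Import all_classical all_reals all_analysis.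
From mathcomp Require Import ring lra.
Import Order.TTheory GRing.Theory Num.Theory.
Import numFieldNormedType.Exports.
Set Implicit Arguments.
Unset Strict Implicit.
Unset Printing Implicit Defensive.
Local Open Scope classical_set_scope.
Local Open Scope ring_scope.

(* [fwd (f * g) = fwd f \o fwd g]: these groups act on the left. *)
Record sym (T : Type) := Sym {
  fwd :> T -> T;
  bwd : T -> T;
  fwdK : cancel fwd bwd;
  bwdK : cancel bwd fwd }.

HB.instance Definition _ T := gen_eqMixin (sym T).
HB.instance Definition _ T := gen_choiceMixin (sym T).

Lemma symP T (f g : sym T) : fwd f =1 fwd g -> f = g.
Proof.
case: f g => [f f' fK f'K] [g g' gK g'K] /= /funext efg; subst g.
have e : f' = g' by apply/funext => x; rewrite -{1}(g'K x) fK.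
by subst g'; congr Sym; apply: Prop_irrelevance.
Qed.

Section SymGroup.
Variable T : Type.
Implicit Types f g h : sym T.

Definition sym_one : sym T := @Sym T id id (fun=> erefl) (fun=> erefl).

Definition sym_inv f : sym T := Sym (@bwdK T f) (@fwdK T f).

Definition sym_mul f g : sym T :=
  Sym (can_comp (@fwdK T f) (@fwdK T g)) (can_comp (@bwdK T g) (@bwdK T f)).

Fact sym_mulA : associative sym_mul. Proof. by move=> f g h; apply: symP. Qed.
Fact sym_mul1 : left_id sym_one sym_mul. Proof. by move=> f; apply: symP. Qed.
Fact sym_1mul : right_id sym_one sym_mul. Proof. by move=> f; apply: symP. Qed.
Fact sym_mulV : left_inverse sym_one sym_inv sym_mul.
Proof. by move=> f; apply: symP => x /=; rewrite fwdK. Qed.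
Fact sym_Vmul : right_inverse sym_one sym_inv sym_mul.
Proof. by move=> f; apply: symP => x /=; rewrite bwdK. Qed.

HB.instance Definition _ := isGroup.Build (sym T)
  sym_mulA sym_mul1 sym_1mul sym_mulV sym_Vmul.

Definition sym_of_invol (f : T -> T) (fK : involutive f) : sym T := Sym fK fK.

End SymGroup.

Section Generated.
Variables (I : Type) (G : groupType) (s : I -> G).

Definition subgroup (H : set G) : Prop :=
  H 1%g /\ forall x y, H x -> H y -> H (x / y)%g.

Definition generated : Type := set_type (smallest subgroup (range s)).

Fact generated_closed : group_closed (mem (smallest subgroup (range s))).
Proof.
split; first by apply/mem_set => H [[H1 _] _].
move=> x y /set_mem xH /set_mem yH; apply/mem_set => H /= HP.
by case: (HP) => -[_ HF] _; apply: HF; [exact: xH | exact: yH].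
Qed.

HB.instance Definition _ := Choice.on generated.
HB.instance Definition _ := SubChoice.on generated.
HB.instance Definition _ := SubChoice_isSubGroup.Build
  G (mem (smallest subgroup (range s))) generated generated_closed.

Fact generator_subproof i : s i \in smallest subgroup (range s).
Proof. by apply/mem_set => H /= [_]; apply; exists i. Qed.

Definition generator (i : I) : generated := SigSub (generator_subproof i).

End Generated.

Definition is_action (G : groupType) (X : Type) (act : G -> X -> X) : Prop :=
  (forall x, act 1%g x = x) /\ (forall g h x, act (g * h)%g x = act g (act h x)).

Definition invariant_set (G X : Type) (act : G -> X -> X) (U : set X) : Prop :=
  forall g x, U x -> U (act g x).

Definition act_on (G X : Type) (act : G -> X -> X) (U : set X)
    (inv_U : invariant_set act U) (g : G) (x : U) : U :=
  SigSub (mem_set (inv_U g (\val x) (set_mem (valP x)))).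

Definition sym_act (I T : Type) (s : I -> sym T) (g : generated s) (x : T) : T :=
  \val g x.

Definition homeomorphism (X Y : topologicalType) (h : X -> Y) : Prop :=
  continuous h /\ exists k : Y -> X, [/\ continuous k, cancel h k & cancel k h].

Definition topologically_conjugate (G G' : groupType) (X Y : topologicalType)
    (act : G -> X -> X) (act' : G' -> Y -> Y) : Prop :=
  exists (theta : {multiplicative G -> G'}) (h : X -> Y),
    [/\ bijective theta, homeomorphism h &
        forall g x, h (act g x) = act' (theta g) (h x)].

Section Valuation.
Local Open Scope ereal_scope.

Record valuation (R : realType) (K : fieldType) (v : K -> \bar R) : Prop := {
  valuation_neqNy : forall x, v x != -oo;
  valuation_eqy : forall x, v x = +oo <-> x = 0%R;
  valuationM : forall x y, v (x * y)%R = v x + v y;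
  valuationD : forall x y, Order.min (v x) (v y) <= v (x + y)%R }.

Definition nontrivial_valuation (R : realType) (K : fieldType)
    (v : K -> \bar R) : Prop :=
  exists x : K, x != 0%R /\ v x != 0.

Definition emin (R : realType) (s : seq (\bar R)) : \bar R :=
  \big[Order.min/+oo]_(y <- s) y.

End Valuation.

Section Markov.
Variables (K : closedFieldType) (A B C D : K).

(* The surface is identified with its set of K-points. As K is algebraically
   closed and the surface is reduced, an automorphism is determined by the
   bijection it induces on this set. *)
Definition markov_surface : set (K * K * K) :=
  [set x | let: (x1, x2, x3) := x in
    x1 ^+ 2 + x2 ^+ 2 + x3 ^+ 2 + x1 * x2 * x3
    = A * x1 + B * x2 + C * x3 + D].

Definition vieta_map (i : 'I_3) (x : K * K * K) : K * K * K :=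
  let: (x1, x2, x3) := x in
  match val i with
  | 0 => (- x1 - x2 * x3 + A, x2, x3)
  | 1 => (x1, - x2 - x1 * x3 + B, x3)
  | _ => (x1, x2, - x3 - x1 * x2 + C)
  end.

Lemma vieta_surface i x : markov_surface x -> markov_surface (vieta_map i x).
Proof.
case: x => [[x1 x2] x3]; rewrite /markov_surface /vieta_map /= => e.
have {}e : D = x1 ^+ 2 + x2 ^+ 2 + x3 ^+ 2 + x1 * x2 * x3
               - (A * x1 + B * x2 + C * x3) by rewrite e; ring.
by case: (val i) => [|[|n]] /=; rewrite e; ring.
Qed.

Definition vieta_fun (i : 'I_3) (x : markov_surface) : markov_surface :=
  SigSub (mem_set (vieta_surface i (set_mem (valP x)))).

Fact vieta_mapK i : involutive (vieta_map i).
Proof.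
case=> [[x1 x2] x3]; rewrite /vieta_map.
case: (val i) => [|[|n]].
- by congr (_, _, _); ring.
- by congr (_, _, _); ring.
- by congr (_, _); ring.
Qed.

Fact vieta_funK i : involutive (vieta_fun i).
Proof. by move=> x; apply/val_inj/vieta_mapK. Qed.

Definition vieta (i : 'I_3) : sym markov_surface := sym_of_invol (vieta_funK i).

Definition vieta_group : groupType := generated vieta.

End Markov.

Section Skeleton.
Variables (R : realType) (a b c d : \bar R).

Definition skeleton : set (R * R * R) :=
  [set x | let: (x1, x2, x3) := x in
    ((x1 + x2 + x3)%:E
     = emin [:: (2 * x1)%:E; (2 * x2)%:E; (2 * x3)%:E;
                a + x1%:E; b + x2%:E; c + x3%:E; d])%E].

(* The terms [2 * x_j] make each minimum finite when no parameter is -oo, so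
   [fine] loses nothing. *)
Definition trop_vieta (i : 'I_3) (x : R * R * R) : R * R * R :=
  let: (x1, x2, x3) := x in
  match val i with
  | 0 => (fine (emin [:: (2 * x2)%:E; (2 * x3)%:E; b + x2%:E; c + x3%:E; d])%E
            - x1, x2, x3)
  | 1 => (x1, fine (emin [:: (2 * x1)%:E; (2 * x3)%:E; a + x1%:E; c + x3%:E; d])%E
            - x2, x3)
  | _ => (x1, x2, fine (emin [:: (2 * x1)%:E; (2 * x2)%:E; a + x1%:E; b + x2%:E; d])%E
            - x3)
  end.

Definition tropical_action (K : closedFieldType) (A B C D : K)
    (act : vieta_group A B C D -> skeleton -> skeleton) : Prop :=
  is_action act /\
  forall i x, \val (act (generator (vieta A B C D) i) x) = trop_vieta i (\val x).

End Skeleton.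

Section Hyperbolic.
Variable R : realType.
Implicit Types x y u w : R * R * R.

Definition lorentz x y : R :=
  x.1.1 * y.1.1 + x.1.2 * y.1.2 - x.2 * y.2.

(* Hyperboloid model: the hyperbolic distance is arcosh (- lorentz x y), and it
   induces the topology of R^3. *)
Definition hyperbolic_plane : set (R * R * R) :=
  [set x | lorentz x x = -1 /\ 0 < x.2].

(* Points of the circle at infinity: each isotropic line is represented by its
   point at height 1. *)
Definition ideal_point u : Prop := lorentz u u = 0 /\ u.2 = 1.

(* The reflection in the geodesic with ideal endpoints u and w: it fixes the
   Lorentzian plane spanned by u and w and negates its orthogonal line. *)
Definition reflection u w x : R * R * R :=
  2 *: ((lorentz x w / lorentz u w) *: u + (lorentz x u / lorentz u w) *: w) - x.

Lemma ideal_point_lt0 u w : ideal_point u -> ideal_point w -> u <> w ->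
  lorentz u w < 0.
Proof.
case: u w => [[u1 u2] u3] [[w1 w2] w3]; rewrite /ideal_point /lorentz /=.
move=> [hu eu] [hw ew] neq; subst u3 w3.
have d2 : (u1 - w1) ^+ 2 + (u2 - w2) ^+ 2 != 0.
  rewrite paddr_eq0 ?sqr_ge0// !sqrf_eq0 !subr_eq0.
  by apply/negP => /andP[/eqP e1 /eqP e2]; apply: neq; rewrite e1 e2.
have -> : u1 * w1 + u2 * w2 - 1 * 1 =
    2^-1 * ((u1 * u1 + u2 * u2 - 1 * 1) + (w1 * w1 + w2 * w2 - 1 * 1)
            - ((u1 - w1) ^+ 2 + (u2 - w2) ^+ 2)) by field.
rewrite hu hw !add0r mulrN oppr_lt0 mulr_gt0// lt_neqAle eq_sym d2.
by rewrite addr_ge0 ?sqr_ge0.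
Qed.

Lemma lorentzC x y : lorentz x y = lorentz y x.
Proof. by rewrite /lorentz; ring. Qed.

Lemma lorentzDl x y z : lorentz (x + y) z = lorentz x z + lorentz y z.
Proof. by rewrite /lorentz /=; ring. Qed.

Lemma lorentzNl x z : lorentz (- x) z = - lorentz x z.
Proof. by rewrite /lorentz /=; ring. Qed.

Lemma lorentzZl k x z : lorentz (k *: x) z = k * lorentz x z.
Proof.
case: x => [[x1 x2] x3]; rewrite /lorentz.
by rewrite -[_.1.1]/(k * x1) -[(k *: _).1.2]/(k * x2) -[(k *: _).2]/(k * x3) /=; ring.
Qed.

Let lorentzE := (lorentzDl, lorentzNl, lorentzZl).

Lemma lorentz_reflection u w x : ideal_point u -> ideal_point w -> u <> w ->
  (lorentz (reflection u w x) u = lorentz x u) *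
  (lorentz (reflection u w x) w = lorentz x w).
Proof.
move=> hu hw /(ideal_point_lt0 hu hw) /ltr0_neq0; case: hu hw => [hu _] [hw _].
rewrite /reflection !lorentzE (lorentzC w u) hu hw => l0.
by split; field.
Qed.

Lemma reflectionK u w : ideal_point u -> ideal_point w -> u <> w ->
  involutive (reflection u w).
Proof.
move=> hu hw neq x; rewrite {1}/reflection !lorentz_reflection//.
by rewrite /reflection opprB addrC subrK.
Qed.

Lemma reflection_isometry u w x y :
  ideal_point u -> ideal_point w -> u <> w ->
  lorentz (reflection u w x) (reflection u w y) = lorentz x y.
Proof.
move=> hu hw neq; rewrite {1}/reflection !lorentzE.
rewrite ![lorentz _ (reflection _ _ _)]lorentzC !lorentz_reflection//.
rewrite {1}/reflection !lorentzE ![lorentz y _]lorentzC ![lorentz x _]lorentzC.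
by rewrite ![lorentz _ x]lorentzC; ring.
Qed.

Lemma ideal_hyperbolic_lt0 u x : ideal_point u -> hyperbolic_plane x ->
  lorentz x u < 0.
Proof.
case: u x => [[u1 u2] u3] [[x1 x2] x3]; rewrite /hyperbolic_plane /lorentz /=.
move=> [/= hu eu] [hx x0]; subst u3; rewrite /lorentz /= in hu.
rewrite ltNge; apply/negP => h; have := sqr_ge0 (x1 * u2 - x2 * u1); nra.
Qed.

Lemma reflection_hyperbolic u w x :
  ideal_point u -> ideal_point w -> u <> w ->
  hyperbolic_plane x -> hyperbolic_plane (reflection u w x).
Proof.
move=> hu hw neq Hx; split; first by rewrite reflection_isometry//; case: Hx.
have := ideal_hyperbolic_lt0 hu Hx; rewrite -(lorentz_reflection x hu hw neq).
have : lorentz (reflection u w x) (reflection u w x) = -1.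
  by rewrite reflection_isometry//; case: Hx.
move: (reflection u w x) => y {neq Hx hw}.
case: u y hu => [[u1 u2] u3] [[y1 y2] y3].
rewrite /ideal_point /lorentz /= => -[hu eu] hy yu; subst u3.
rewrite ltNge; apply/negP => h; have := sqr_ge0 (y1 * u2 - y2 * u1); nra.
Qed.

Record ideal_triangle := IdealTriangle {
  vertex :> 'I_3 -> R * R * R;
  vertex_ideal : forall i, ideal_point (vertex i);
  vertex_inj : injective vertex }.

Variable T : ideal_triangle.

Lemma vertex_neq i : T (i + 1) <> T (i + 2).
Proof. by move/vertex_inj => /(congr1 val); case: i => [[|[|[|n]]] //=]. Qed.

(* The reflection in the side opposite to vertex i; indices are mod 3. *)
Definition side_fun (i : 'I_3) (x : hyperbolic_plane) : hyperbolic_plane :=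
  SigSub (mem_set (reflection_hyperbolic
    (vertex_ideal T (i + 1)) (vertex_ideal T (i + 2)) (@vertex_neq i)
    (set_mem (valP x)))).

Fact side_funK i : involutive (side_fun i).
Proof.
by move=> x; apply/val_inj/reflectionK; [exact: vertex_ideal..|exact: vertex_neq].
Qed.

Definition side_reflection (i : 'I_3) : sym hyperbolic_plane :=
  sym_of_invol (side_funK i).

Definition triangle_group : groupType := generated side_reflection.

End Hyperbolic.

Section PGL2.
Variable R : comUnitRingType.

Definition GL2 : Type := {M : 'M[R]_2 | M \in unitmx}.

HB.instance Definition _ := Choice.on GL2.
HB.instance Definition _ := SubChoice.on GL2.

Definition GL2_one : GL2 := SigSub (unitmx1 R 2).

Fact GL2_mul_subproof (M N : GL2) : val M *m val N \in unitmx.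
Proof. by rewrite unitmx_mul (valP M) (valP N). Qed.

Definition GL2_mul (M N : GL2) : GL2 := SigSub (GL2_mul_subproof M N).

Fact GL2_inv_subproof (M : GL2) : invmx (val M) \in unitmx.
Proof. by rewrite unitmx_inv (valP M). Qed.

Definition GL2_inv (M : GL2) : GL2 := SigSub (GL2_inv_subproof M).

Fact GL2_mulA : associative GL2_mul.
Proof. by move=> M N P; apply/val_inj/mulmxA. Qed.
Fact GL2_mul1 : left_id GL2_one GL2_mul.
Proof. by move=> M; apply/val_inj/mul1mx. Qed.
Fact GL2_1mul : right_id GL2_one GL2_mul.
Proof. by move=> M; apply/val_inj/mulmx1. Qed.
Fact GL2_mulV : left_inverse GL2_one GL2_inv GL2_mul.
Proof. by move=> M; apply/val_inj/mulVmx/(valP M). Qed.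
Fact GL2_Vmul : right_inverse GL2_one GL2_inv GL2_mul.
Proof. by move=> M; apply/val_inj/mulmxV/(valP M). Qed.

HB.instance Definition _ := isGroup.Build GL2
  GL2_mulA GL2_mul1 GL2_1mul GL2_mulV GL2_Vmul.

Definition proportional (M N : GL2) : bool :=
  `[< exists2 k : R, k \is a GRing.unit & val N = k *: val M >].

Fact proportional_equiv : equiv_class_of proportional.
Proof.
split=> [M|M N|N M P].
- by apply/asboolP; exists 1; rewrite ?unitr1 ?scale1r.
- apply/asboolP/asboolP => -[k uk e]; exists k^-1; rewrite ?unitrV //.
    by rewrite e scalerA mulVr// scale1r.
  by rewrite e scalerA mulVr// scale1r.
- move=> /asboolP[k uk e] /asboolP[l ul f]; apply/asboolP.
  by exists (l * k); rewrite ?unitrM ?ul ?uk// f e scalerA.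
Qed.

Canonical proportional_equiv_rel := EquivRelPack proportional_equiv.

Local Open Scope quotient_scope.

Definition PGL2 : Type := {eq_quot proportional}.

HB.instance Definition _ := Choice.on PGL2.
HB.instance Definition _ := EqQuotient.on PGL2.

Definition PGL2_one : PGL2 := \pi_PGL2 GL2_one.
Definition PGL2_mul (x y : PGL2) : PGL2 := \pi_PGL2 (GL2_mul (repr x) (repr y)).
Definition PGL2_inv (x : PGL2) : PGL2 := \pi_PGL2 (GL2_inv (repr x)).

Lemma PGL2_piP (M N : GL2) :
  \pi_PGL2 M = \pi_PGL2 N <->
  exists2 k : R, k \is a GRing.unit & val N = k *: val M.
Proof. by split => [/eqmodP/asboolP | h]; last exact/eqmodP/asboolP. Qed.

Lemma PGL2_repr (M : GL2) :
  exists2 k : R, k \is a GRing.unit & val (repr (\pi_PGL2 M)) = k *: val M.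
Proof. by apply/PGL2_piP; rewrite reprK. Qed.

Lemma PGL2_piM (M N : GL2) :
  PGL2_mul (\pi_PGL2 M) (\pi_PGL2 N) = \pi_PGL2 (M * N)%g.
Proof.
apply/esym/PGL2_piP; have [k uk eM] := PGL2_repr M; have [l ul eN] := PGL2_repr N.
exists (k * l); first by rewrite unitrM uk.
by rewrite /= eM eN -scalemxAl -scalemxAr scalerA.
Qed.

Lemma PGL2_piV (M : GL2) : PGL2_inv (\pi_PGL2 M) = \pi_PGL2 (M^-1)%g.
Proof.
apply/esym/PGL2_piP; have [k uk eM] := PGL2_repr M.
by exists k^-1; rewrite ?unitrV //= eM invmxZ// unitmxZ// (valP M).
Qed.

Fact PGL2_mulA : associative PGL2_mul.
Proof.
move=> x y z; rewrite -[x]reprK -[y]reprK -[z]reprK.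
move: (repr x) (repr y) (repr z) => M N P.
by rewrite (PGL2_piM N P) (PGL2_piM M N) !PGL2_piM mulgA.
Qed.
Fact PGL2_mul1 : left_id PGL2_one PGL2_mul.
Proof.
move=> x; rewrite -[x]reprK; move: (repr x) => M.
by rewrite [LHS]PGL2_piM mul1g.
Qed.
Fact PGL2_1mul : right_id PGL2_one PGL2_mul.
Proof.
move=> x; rewrite -[x]reprK; move: (repr x) => M.
by rewrite [LHS]PGL2_piM mulg1.
Qed.
Fact PGL2_mulV : left_inverse PGL2_one PGL2_inv PGL2_mul.
Proof.
move=> x; rewrite -[x]reprK; move: (repr x) => M.
by rewrite PGL2_piV PGL2_piM mulVg.
Qed.
Fact PGL2_Vmul : right_inverse PGL2_one PGL2_inv PGL2_mul.
Proof.
move=> x; rewrite -[x]reprK; move: (repr x) => M.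
by rewrite PGL2_piV PGL2_piM mulgV.
Qed.

HB.instance Definition _ := isGroup.Build PGL2
  PGL2_mulA PGL2_mul1 PGL2_1mul PGL2_mulV PGL2_Vmul.

End PGL2.

Section PGL2Map.
Local Open Scope quotient_scope.
Variables (R S : comUnitRingType) (f : {rmorphism R -> S}).

Fact GL2_map_subproof (M : GL2 R) : map_mx f (val M) \in unitmx.
Proof. by rewrite unitmxE det_map_mx rmorph_unit// -unitmxE (valP M). Qed.

Definition GL2_map (M : GL2 R) : GL2 S := SigSub (GL2_map_subproof M).

Definition PGL2_map (x : PGL2 R) : PGL2 S := \pi_(PGL2 S) (GL2_map (repr x)).

Lemma PGL2_map_pi (M : GL2 R) : PGL2_map (\pi_(PGL2 R) M) = \pi_(PGL2 S) (GL2_map M).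
Proof.
apply/esym/PGL2_piP; have [k uk eM] := PGL2_repr M.
by exists (f k); rewrite ?rmorph_unit//= eM map_mxZ.
Qed.

Fact PGL2_mapM : {morph PGL2_map : x y / (x * y)%g}.
Proof.
move=> x y; rewrite -[x]reprK -[y]reprK; move: (repr x) (repr y) => M N.
have -> : (\pi_(PGL2 R) M * \pi_(PGL2 R) N)%g = \pi_(PGL2 R) (M * N)%g := PGL2_piM M N.
rewrite !PGL2_map_pi.
have -> : (\pi_(PGL2 S) (GL2_map M) * \pi_(PGL2 S) (GL2_map N))%g
  = \pi_(PGL2 S) (GL2_map M * GL2_map N)%g := PGL2_piM _ _.
by congr (\pi _); apply/val_inj/map_mxM.
Qed.

Fact PGL2_map1 : PGL2_map 1%g = 1%g.
Proof.
have -> : 1%g = \pi_(PGL2 R) 1%g by [].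
by rewrite PGL2_map_pi; congr (\pi _); apply/val_inj/map_mx1.
Qed.

HB.instance Definition _ :=
  isUMagmaMorphism.Build (PGL2 R) (PGL2 S) PGL2_map (PGL2_map1, PGL2_mapM).

End PGL2Map.

Section Kernel.
Variables (G H : groupType) (f : {multiplicative G -> H}).

Definition kernel : Type := {x : G | f x == 1%g}.

Fact kernel_closed : group_closed (fun x => f x == 1%g).
Proof.
have f1 : f 1%g = 1%g by apply: (@mulgI _ (f 1%g)); rewrite -gmulfM !mulg1.
split; first exact/eqP.
move=> x y /eqP fx /eqP fy; apply/eqP.
have : f (x / y * y)%g = 1%g by rewrite mulgVK.
by rewrite gmulfM fy mulg1 => ->.
Qed.

HB.instance Definition _ := Choice.on kernel.
HB.instance Definition _ := SubChoice.on kernel.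
HB.instance Definition _ := SubChoice_isSubGroup.Build
  G (fun x => f x == 1%g) kernel kernel_closed.

End Kernel.

(* The reduction PGL_2(Z) -> PGL_2(Z/2Z). *)
Definition PGL2_mod2 : {multiplicative PGL2 int -> PGL2 'Z_2} :=
  @PGL2_map int 'Z_2 intr.

Definition PGL2_congruence2 : groupType := kernel PGL2_mod2.

Section PlaneModAntipodes.
Local Open Scope quotient_scope.
Variable R : realType.

Definition antipodal (u w : 'cV[R]_2) : bool := (u == w) || (u == - w).

Fact antipodal_equiv : equiv_class_of antipodal.
Proof.
split=> [u|u w|w u z]; rewrite /antipodal ?eqxx//.
  by rewrite eq_sym [u == - w]eq_sym eqr_oppLR.
by move=> /orP[]/eqP-> /orP[]/eqP->; rewrite ?opprK !eqxx ?orbT.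
Qed.

Canonical antipodal_equiv_rel := EquivRelPack antipodal_equiv.

Definition plane_mod_antipodes : Type := {eq_quot antipodal}.

HB.instance Definition _ := Topological.copy plane_mod_antipodes
  (quotient_topology {eq_quot antipodal}).
HB.instance Definition _ := EqQuotient.on plane_mod_antipodes.

Definition PGL2_act (g : PGL2 int) (x : plane_mod_antipodes) :
    plane_mod_antipodes :=
  \pi_plane_mod_antipodes (map_mx intr (val (repr g)) *m repr x).

(* [PGL2_act] does not depend on the representatives. *)
Lemma PGL2_act_pi (M : GL2 int) (u : 'cV[R]_2) :
  PGL2_act (\pi_(PGL2 int) M) (\pi_plane_mod_antipodes u) =
  \pi_plane_mod_antipodes (map_mx intr (val M) *m u).
Proof.
have [k uk eM] := PGL2_repr M.
have k1 : k = 1 \/ k = -1 by case/orP: uk => /eqP; tauto.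
have eu : repr (\pi_plane_mod_antipodes u) = u \/
          repr (\pi_plane_mod_antipodes u) = - u.
  have : \pi_plane_mod_antipodes (repr (\pi_plane_mod_antipodes u)) =
         \pi_plane_mod_antipodes u by rewrite reprK.
  by move/eqmodP => /orP[]/eqP; tauto.
apply/eqmodP; rewrite /= /antipodal eM map_mxZ -scalemxAl.
by case: k1 eu => -> [] ->;
   rewrite ?rmorph1 ?rmorphN1 ?mulmxN ?scaleN1r ?scale1r ?opprK !eqxx ?orbT.
Qed.

Definition congruence2_act (g : PGL2_congruence2) := PGL2_act (val g).

End PlaneModAntipodes.

(* Main.v *)
From HB Require Import structures.
Require Import Defs.
From mathcomp Require Import all_boot all_order all_algebra.
From mathcomp Require Import all_classical all_reals all_analysis.
From mathcomp Require Import ring lra zify.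
Import Order.TTheory GRing.Theory Num.Theory.
Import numFieldNormedType.Exports.
Set Implicit Arguments.
Unset Strict Implicit.
Unset Printing Implicit Defensive.
Local Open Scope classical_set_scope.
Local Open Scope ring_scope.

(* Write y = - x. In these coordinates the skeleton is the boundary of a convex
   polyhedron on which every trop(s_i) changes only the i-th coordinate; the gap
   G_i = y_i o s_i - y_i vanishes exactly on the mirror of s_i, and G_i < 0 forces
   G_j > 0 for j <> i. Hence { G_i >= 0 for all i, y > 0 } is a strict fundamental
   chamber for the tiled set it generates, by ping-pong. The hyperbolic plane, with
   coordinates the Lorentz products with the three suitably scaled ideal vertices,
   is a system of the same kind, tiled by the ideal triangle. A homeomorphism of
   chambers that respects mirrors extends to an equivariant homeomorphism of the
   tiled sets. Here it is explicit: a piecewise linear push of the tropical chamber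
   onto the part of the polyhedron visible from the origin inside the cone of
   triangle inequalities, followed by central projection.
   The tiled set is dense: two consecutive descending reflections s_i, s_j lower
   y_1 + y_2 + y_3 by at least y_k, so that descent stops either in the chamber or on
   a ray (p, p, 0), and such rays are limits of tiled points.
   If all parameters are nonnegative they do not matter, the skeleton is a cone, and
   (u, v) |-> (|u|, |v|, |u + v|) identifies it with the plane modulo antipodes.
   The group generated by the Vieta involutions is a free product, by ping-pong on
   points of the surface whose coordinates have very negative valuations. *)

(** * Words and free products of involutions *)

(** The drop by [y_k] alone does not end the descent, since [y_k] may become small. The remedy is a
    threshold: once some [y_k] is positive and below it, only the two other reflections are used.
    They leave [y_k] unchanged, so the drops are uniform, and below the threshold the conditions on
    index [k] hold by themselves. The threshold is a quarter of a positive parameter on the tropical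
    side and 1 on the hyperbolic side. The push of the chamber is needed because the mirror of [s_i]
    is [2 y_i = F_i], where [F_i] is the sum of the two values of the [i]-th coordinate, whereas the
    sides of the ideal triangle are [2 y_i = y_1 + y_2 + y_3]. Central projection preserves only the
    second, homogeneous condition. The two differ only on the facets [y_j + y_k = a_i], and there
    the push moves [y_i] alone. Freeness serves twice: the tropical action is well defined because
    the only relations are cancellations, and group isomorphisms are obtained by matching words in
    the generators. *)

Section Words.
Variable I : eqType.

Definition reduced (w : seq I) : bool := sorted (fun i j => i != j) w.

Definition wcons (i : I) (w : seq I) : seq I :=
  if w is j :: w' then if i == j then w' else i :: w else [:: i].

Definition reduce (w : seq I) : seq I := foldr wcons [::] w.

Lemma reduced_reduce w : reduced (reduce w).
Proof.
elim: w => //= i w; rewrite /wcons; case: (reduce w) => [|j w'] //=.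
case: eqP => [_|/eqP ij] /=; last by rewrite /reduced /= ij.
exact: path_sorted.
Qed.

Definition wact (T : Type) (s : I -> T -> T) (w : seq I) (x : T) : T :=
  foldr s x w.

Lemma wact_cat T (s : I -> T -> T) w1 w2 x :
  wact s (w1 ++ w2) x = wact s w1 (wact s w2 x).
Proof. exact: foldr_cat. Qed.

Lemma wact_reduce T (s : I -> T -> T) (sK : forall i, involutive (s i)) w x :
  wact s (reduce w) x = wact s w x.
Proof.
elim: w => //= i w <-; rewrite /wcons; case: (reduce w) => [|j w'] //=.
by case: eqP => [->|] //=; rewrite sK.
Qed.

Lemma wact_revK T (s : I -> T -> T) (sK : forall i, involutive (s i)) w :
  cancel (wact s w) (wact s (rev w)).
Proof. by elim: w => //= i w IH x; rewrite rev_cons -cats1 wact_cat /= sK. Qed.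

Lemma wact_Krev T (s : I -> T -> T) (sK : forall i, involutive (s i)) w :
  cancel (wact s (rev w)) (wact s w).
Proof. by move=> x; rewrite -{1}[w]revK wact_revK. Qed.

Definition wprod (G : groupType) (s : I -> G) (w : seq I) : G :=
  foldr (fun i g => (s i * g)%g) 1%g w.

Lemma wprod_cat (G : groupType) (s : I -> G) w1 w2 :
  wprod s (w1 ++ w2) = (wprod s w1 * wprod s w2)%g.
Proof. by elim: w1 => [|i w IH] /=; rewrite ?mul1g// IH mulgA. Qed.

Lemma wprod_reduce (G : groupType) (s : I -> G) (ss : forall i, (s i * s i = 1)%g) w :
  wprod s (reduce w) = wprod s w.
Proof.
elim: w => //= i w <-; rewrite /wcons; case: (reduce w) => [|j w'] //=.
by case: eqP => [->|] //=; rewrite mulgA ss mul1g.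
Qed.

Lemma wprod_rev (G : groupType) (s : I -> G) (ss : forall i, (s i * s i = 1)%g) w :
  wprod s (rev w) = (wprod s w)^-1%g.
Proof.
have sV i : (s i)^-1%g = s i by apply: (mulgI (s i)); rewrite mulgV ss.
elim: w => [|i w IH]; first by rewrite invg1.
by rewrite rev_cons -cats1 wprod_cat IH /= mulg1 invgM sV.
Qed.

Record free_involutions (G : groupType) (s : I -> G) : Prop := {
  free_sqr : forall i, (s i * s i = 1)%g;
  free_gen : forall g, exists w, g = wprod s w;
  free_reduced : forall w, reduced w -> wprod s w = 1%g -> w = [::] }.

(** The only relations in a free product are the cancellations made by [reduce]: [w1 ++ rev w2]
    cancels to the empty word, and the same cancellations are valid for [t]. *)
Lemma free_wprod_eq (G H : groupType) (s : I -> G) (t : I -> H) (fs : free_involutions s)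
    (tt : forall i, (t i * t i = 1)%g) w1 w2 :
  wprod s w1 = wprod s w2 -> wprod t w1 = wprod t w2.
Proof.
move=> e; have : wprod s (reduce (w1 ++ rev w2)) = 1%g.
  by rewrite (wprod_reduce (free_sqr fs)) wprod_cat e (wprod_rev (free_sqr fs)) mulgV.
move/(free_reduced fs (reduced_reduce _)) => r0.
have : wprod t (reduce (w1 ++ rev w2)) = 1%g by rewrite r0.
rewrite (wprod_reduce tt) wprod_cat (wprod_rev tt) => /(congr1 (fun g => g * wprod t w2)%g).
by rewrite mulgVK mul1g.
Qed.

(** The same argument for maps that are not packed as group elements. It is what makes an action
    prescribed on generators well defined. *)
Lemma free_wact_eq (G : groupType) (s : I -> G) (fs : free_involutions s)
    T (t : I -> T -> T) (tK : forall i, involutive (t i)) w1 w2 :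
  wprod s w1 = wprod s w2 -> wact t w1 =1 wact t w2.
Proof.
move=> e x; have : wprod s (reduce (w1 ++ rev w2)) = 1%g.
  by rewrite (wprod_reduce (free_sqr fs)) wprod_cat e (wprod_rev (free_sqr fs)) mulgV.
move/(free_reduced fs (reduced_reduce _)) => r0.
have : wact t (w1 ++ rev w2) (wact t w2 x) = wact t w2 x.
  by rewrite -(wact_reduce tK) r0.
by rewrite wact_cat wact_revK.
Qed.

Lemma free_iso (G H : groupType) (s : I -> G) (t : I -> H) :
  free_involutions s -> free_involutions t ->
  exists theta : {multiplicative G -> H},
    bijective theta /\ forall w, theta (wprod s w) = wprod t w.
Proof.
move=> fs ft; pose word g := projT1 (cid (free_gen fs g)).
have wordP g : wprod s (word g) = g by rewrite /word; case: cid.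
pose f g := wprod t (word g).
have fE w : f (wprod s w) = wprod t w.
  by apply: (free_wprod_eq fs (free_sqr ft)); rewrite wordP.
have fM : {morph f : x y / (x * y)%g}.
  by move=> x y; rewrite -[x]wordP -[y]wordP -wprod_cat !fE wprod_cat.
pose F := HB.pack_for {multiplicative G -> H} f (isMultiplicative.Build G H f fM).
exists F; split; last exact: fE.
pose word' h := projT1 (cid (free_gen ft h)).
have word'P h : wprod t (word' h) = h by rewrite /word'; case: cid.
exists (fun h => wprod s (word' h)) => [g|h] /=.
  by rewrite -[RHS]wordP; apply: (free_wprod_eq ft (free_sqr fs)); rewrite word'P.
by rewrite fE.
Qed.

Lemma generated_gen (G : groupType) (s : I -> G) (ss : forall i, (s i * s i = 1)%g)
  (g : generated s) : exists w, g = wprod (generator s) w.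
Proof.
have valE w : val (wprod (generator s) w) = wprod s w by elim: w => //= i w <-.
pose H : set G := [set g | exists w, g = wprod s w].
have : H (val g).
  have /set_mem := valP g; apply; split; last by move=> _ [i _ <-]; exists [:: i]; rewrite /= mulg1.
  split; first by exists [::].
  move=> _ _ [w1 ->] [w2 ->]; exists (w1 ++ rev w2).
  by rewrite wprod_cat (wprod_rev ss).
by case=> w e; exists w; apply/val_inj; rewrite e valE.
Qed.

Lemma val_wprod (G : groupType) (s : I -> G) w :
  val (wprod (generator s) w) = wprod s w.
Proof. by elim: w => //= i w <-. Qed.

Lemma fwd_wprod T (s : I -> sym T) w x : fwd (wprod s w) x = wact (fun i => fwd (s i)) w x.
Proof. by elim: w => //= i w <-. Qed.

(** A reduced word sends [Q k] into [Q h], where [h] is its first letter, as soon as [k] differs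
    from its last letter. Among three labels one can choose [k] different from both, and
    disjointness then shows that the word moves a point. The word is assumed to fix only the points
    of the sets [Q i], because the maps will be controlled only on a subset of the ambient space. *)
Lemma pingpong T (s : I -> T -> T) (Q : I -> set T) (i0 : I) :
  (exists i1 i2, [/\ i0 != i1, i1 != i2 & i0 != i2]) ->
  Q i0 !=set0 ->
  (forall i j x, i != j -> Q i x -> Q j (s j x)) ->
  (forall i j x, Q i x -> Q j x -> i = j) ->
  forall w, reduced w -> (forall i x, Q i x -> wact s w x = x) -> w = [::].
Proof.
move=> [i1 [i2 [n01 n12 n02]]] [x0 Q0] sQ disj w rw w1.
have Qn k : Q k !=set0.
  case: (eqVneq i0 k) => [<-|nk]; first by exists x0.
  by exists (s k x0); apply: sQ Q0.
have act k i u x : reduced (rcons u i) -> k != i -> Q k x ->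
    Q (head i (rcons u i)) (wact s (rcons u i) x).
  elim: u => [|j u IH] /=; first by move=> _ ki Qx; apply: sQ Qx.
  move=> ru ki Qx; have ru' : reduced (rcons u i) by apply: path_sorted ru.
  by apply: sQ (IH ru' ki Qx); move: ru; case: (u) => [|? ?] /= /andP[]; rewrite eq_sym.
case/lastP: w rw w1 => // u i rw w1; exfalso.
have [k [ki kh]] : exists k, k != i /\ k != head i (rcons u i).
  move: (head _ _) => h.
  have [/andP[]|] := boolP ((i0 != i) && (i0 != h)); first by exists i0.
  have [/andP[]|] := boolP ((i1 != i) && (i1 != h)); first by exists i1.
  have [/andP[]|] := boolP ((i2 != i) && (i2 != h)); first by exists i2.
  rewrite !negb_and !negbK => /orP[]/eqP e2 /orP[]/eqP e1 /orP[]/eqP e0; subst;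
    by move: n01 n12 n02; rewrite ?eqxx.
have [x Qx] := Qn k; have := act _ _ _ _ rw ki Qx.
by rewrite (w1 _ _ Qx) => /(disj _ _ _ Qx) e; rewrite e eqxx in kh.
Qed.

Lemma free_generated T (s : I -> sym T) (s' := fun i => fwd (s i)) :
  (forall i, involutive (s' i)) ->
  (forall w, reduced w -> wact s' w =1 id -> w = [::]) ->
  free_involutions (generator s).
Proof.
move=> sK free; have ss i : (s i * s i = 1)%g by apply: symP => x; apply: sK.
split.
- by move=> i; apply/val_inj/ss.
- exact: generated_gen.
- move=> w rw /(congr1 val); rewrite val_wprod => e.
  by apply: free => // x; rewrite -fwd_wprod e.
Qed.

End Words.

(** * Mirror systems *)

Lemma third_index (i j : 'I_3) : i != j -> exists k, k != i /\ k != j.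
Proof.
move=> _; case: i j => [[|[|[|i]]] hi] [[|[|[|j]]] hj] //=.
all: by [exists ord_max | exists (@Ordinal 3 1 isT) | exists ord0].
Qed.

Lemma third_index_uniq (k i j l : 'I_3) :
  i != k -> j != k -> j != i -> l != k -> l != i -> l = j.
Proof.
move=> ik jk ji lk li; apply/val_inj; move: ik jk ji lk li.
rewrite -!val_eqE /=; have := ltn_ord l; have := ltn_ord j.
by have := ltn_ord k; have := ltn_ord i; lia.
Qed.

Lemma near_gt0 (R : realType) (E : topologicalType) (f : E -> R) x :
  {for x, continuous f} -> 0 < f x -> \forall z \near x, 0 < f z.
Proof. by move=> cf; apply: (@cvgr_gt R E (nbhs x) (nbhs_filter x) f (f x) cf). Qed.

Section Near.
Variables (E : topologicalType) (x : E).

Lemma nearS (P Q : E -> Prop) : (forall z, P z -> Q z) ->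
  (\forall z \near x, P z) -> \forall z \near x, Q z.
Proof. exact: (@filterS E (nbhs x) (nbhs_filter x)). Qed.

Lemma nearW (P : E -> Prop) : (forall z, P z) -> \forall z \near x, P z.
Proof. by move=> HP; apply: (@nearS setT) filterT => z _. Qed.

Lemma nearI (P Q : E -> Prop) :
  (\forall z \near x, P z) -> (\forall z \near x, Q z) ->
  \forall z \near x, P z /\ Q z.
Proof. exact: (@filterI E (nbhs x) (nbhs_filter x)). Qed.

Lemma near_ord n (P : 'I_n -> E -> Prop) :
  (forall i, \forall z \near x, P i z) -> \forall z \near x, forall i, P i z.
Proof. exact: (@filter_forall E 'I_n P (nbhs x) (nbhs_filter x)). Qed.

End Near.

Section System.
Variables (R : realType) (E : topologicalType).

Definition gap (s : 'I_3 -> E -> E) (y : 'I_3 -> E -> R) (i : 'I_3) (x : E) : R :=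
  y i (s i x) - y i x.

(** The maps live on an ambient space [E], where continuity is a matter of formulas; [coord_inj] and
    the two gap axioms are required on [S] only. [gap_opposite] is the ping-pong condition, and
    [gap_two0] says that two mirrors meet only at a cusp. *)
Record mirror_system (S : set E) (s : 'I_3 -> E -> E) (y : 'I_3 -> E -> R) : Prop := {
  mirror_stable : forall i x, S x -> S (s i x);
  mirrorK : forall i, involutive (s i);
  mirror_continuous : forall i, continuous (s i);
  coordinate_continuous : forall i, continuous (y i);
  coord_mirror : forall i j x, i != j -> y j (s i x) = y j x;
  coord_inj : forall x x', S x -> S x' -> (forall i, y i x = y i x') -> x = x';
  gap_opposite : forall i j x, S x -> i != j -> gap s y j x < 0 -> 0 < gap s y i x;
  gap_two0 : forall i j k x, S x -> i != j -> k != i -> k != j ->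
    gap s y i x = 0 -> gap s y j x = 0 -> y k x = 0 }.

Variables (S : set E) (s : 'I_3 -> E -> E) (y : 'I_3 -> E -> R).

(** Strict positivity of the coordinates removes the cusps, so that by [gap_two0] two distinct
    mirrors do not meet inside the chamber. *)
Definition chamber (x : E) : Prop :=
  S x /\ forall i, 0 <= gap s y i x /\ 0 < y i x.

Definition tiled (x : E) : Prop := S x /\ exists w, chamber (wact s w x).

Hypothesis sys : mirror_system S s y.

Let sK := mirrorK sys.

Lemma wact_stable w x : S x -> S (wact s w x).
Proof. by move=> Sx; elim: w => //= i w; apply: (mirror_stable sys). Qed.

Lemma wact_continuous w : continuous (wact s w).
Proof.
elim: w => [|i w IH] x; first exact: cvg_id.
apply: (@continuous_comp _ _ _ (wact s w) (s i)); first exact: IH.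
exact: (mirror_continuous sys).
Qed.

Lemma gap_continuous i : continuous (gap s y i).
Proof.
move=> x; apply: cvgB; last exact: (coordinate_continuous sys).
by apply: continuous_comp; [exact: (mirror_continuous sys)|exact: (coordinate_continuous sys)].
Qed.

Lemma gap_mirror i x : gap s y i (s i x) = - gap s y i x.
Proof. by rewrite /gap sK opprB. Qed.

Lemma gap0_fixed i x : S x -> gap s y i x = 0 -> s i x = x.
Proof.
move=> Sx /eqP; rewrite subr_eq0 => /eqP e.
apply: (coord_inj sys) => // [|j]; first exact: (mirror_stable sys).
by have [<-//|ij] := eqVneq i j; rewrite (coord_mirror sys).
Qed.

Lemma chamber_gap_gt0 i j x : chamber x -> i != j -> gap s y i x = 0 -> 0 < gap s y j x.
Proof.
move=> [Sx Dx] ij gi; rewrite lt_neqAle (Dx j).1 andbT eq_sym; apply/eqP => gj.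
have [k [ki kj]] := third_index ij.
by have := (Dx k).2; rewrite (gap_two0 sys (i := i) (j := j))// ltxx.
Qed.

(** The letter [i] acts first and makes its own gap negative. By [gap_opposite] the gap of each
    following letter is then positive just before that letter reverses it. *)
Lemma wact_gap_lt0 u i x : S x -> reduced (rcons u i) -> 0 < gap s y i x ->
  gap s y (head i (rcons u i)) (wact s (rcons u i) x) < 0.
Proof.
move=> Sx; elim: u => [|j u IH] /=; first by rewrite gap_mirror oppr_lt0.
move=> ru gi; have ru' : reduced (rcons u i) by apply: path_sorted ru.
rewrite gap_mirror oppr_lt0; apply: (gap_opposite sys) (IH ru' gi).
  exact: wact_stable.
by move: ru; case: (u) => [|? ?] /= /andP[].
Qed.

Lemma chamber_return w x : reduced w -> chamber x -> chamber (wact s w x) ->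
  w = [::] \/ exists i, w = [:: i] /\ gap s y i x = 0.
Proof.
case/lastP: w => [|u i]; [by left|move=> rw Dx Dwx].
have outP v j : reduced (rcons v j) -> 0 < gap s y j x ->
    ~ chamber (wact s (rcons v j) x).
  move=> rv gj [_ /(_ (head j (rcons v j)))[]].
  by rewrite leNgt (wact_gap_lt0 Dx.1 rv gj).
have gi0 : gap s y i x = 0.
  apply/eqP; rewrite eq_le (Dx.2 i).1 andbT leNgt; apply/negP => gi.
  exact: outP rw gi Dwx.
right; exists i; split=> //; case/lastP: u rw Dwx => // u j rw Dwx; exfalso.
have [rj ij] : reduced (rcons u j) /\ i != j.
  move: rw; rewrite /reduced; case: u {Dwx} => [|k u] /=.
    by rewrite andbT eq_sym => ->.
  by rewrite rcons_path last_rcons eq_sym => /andP[].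
apply: (outP u j) => //; first exact: chamber_gap_gt0 gi0.
by move: Dwx; rewrite -cats1 wact_cat /= (gap0_fixed Dx.1 gi0).
Qed.

(** At most one mirror passes through [x]. All other chamber conditions are strict, hence persist
    nearby, also after [s i], which fixes [x]. The sign of the remaining gap decides between [x']
    and [s i x']. *)
Lemma chamber_near x : chamber x -> \forall x' \near x, S x' ->
  chamber x' \/ exists i, gap s y i x = 0 /\ chamber (s i x').
Proof.
move=> Dx; have y0 i : \forall x' \near x, 0 < y i x'.
  by apply: near_gt0 (Dx.2 i).2; apply: (coordinate_continuous sys).
have g0 i : 0 < gap s y i x -> \forall x' \near x, 0 < gap s y i x'.
  by move=> gi; apply: near_gt0 gi; apply: gap_continuous.
have [[i gi]|/forallNP ng] := pselect (exists i, gap s y i x = 0); last first.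
  have g0' i : \forall x' \near x, 0 < gap s y i x'.
    by apply: g0; rewrite lt_neqAle (Dx.2 i).1 andbT eq_sym; apply/eqP/ng.
  apply: nearS (near_ord (fun i => nearI (y0 i) (g0' i))) => z H Sz.
  by left; split=> // i; have [? /ltW] := H i.
have six : s i x = x by apply: gap0_fixed gi; case: Dx.
have cs : s i @ x --> x by rewrite -{2}six; apply: (mirror_continuous sys).
have H j : \forall x' \near x, [/\ 0 < y j x', 0 < y j (s i x') &
    i != j -> 0 < gap s y j x' /\ 0 < gap s y j (s i x')].
  have [<-|ij] := eqVneq i j.
    have A := y0 i; have B := cs _ (y0 i).
    by apply: nearS (nearI A B) => z [? ?]; split=> //; rewrite eqxx.
  have A := y0 j; have B := cs _ (y0 j).
  have C := g0 j (chamber_gap_gt0 Dx ij gi); have C' := cs _ C.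
  by apply: nearS (nearI (nearI A B) (nearI C C')) => z [[? ?] [? ?]].
apply: nearS (near_ord H) => x' Hx' Sx'.
have [gi0|gi0] := leP 0 (gap s y i x'); [left|right; exists i; split=> //].
  split=> // j; have [a b c] := Hx' j; split=> //.
  by have [<-//|/c[/ltW]] := eqVneq i j.
split=> [|j]; first exact: (mirror_stable sys).
have [a b c] := Hx' j; split=> //.
have [<-|/c[_ /ltW]//] := eqVneq i j.
by rewrite gap_mirror oppr_ge0 ltW.
Qed.

Lemma tiled_near x : tiled x -> \forall x' \near x, S x' -> tiled x'.
Proof.
move=> [Sx [w Dw]]; have := wact_continuous (w := w) (chamber_near Dw).
apply: nearS => x' /= H Sx'; split=> //.
have [|D|[i [_ D]]] := H; first exact: wact_stable.
  by exists w.
by exists (i :: w).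
Qed.

Lemma tiled_wact w x : tiled x -> tiled (wact s w x).
Proof.
move=> [Sx [u Du]]; split; first exact: wact_stable.
by exists (u ++ rev w); rewrite wact_cat wact_revK.
Qed.

Lemma mirror_pingpong i0 w : (exists2 x, S x & gap s y i0 x < 0) -> reduced w ->
  (forall x, S x -> wact s w x = x) -> w = [::].
Proof.
move=> [x0 Sx0 g0] rw w1.
have [i1 n01] : exists i1, i0 != i1.
  by case: (eqVneq i0 ord0) => [->|]; [exists ord_max|exists ord0].
have [i2 [n20 n21]] := third_index n01.
apply: (@pingpong _ _ s (fun i x => S x /\ gap s y i x < 0) i0 _ _ _ _ w) => //.
- by exists i1, i2; split=> //; rewrite eq_sym.
- by exists x0.
- move=> i j x ij [Sx gi]; split; first exact: (mirror_stable sys).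
  by rewrite gap_mirror oppr_lt0; apply: (gap_opposite sys) gi; rewrite 1?eq_sym.
- move=> i j x [Sx gi] [_ gj]; apply/eqP/negPn/negP => ij.
  by have := gap_opposite sys Sx ij gj; rewrite ltNge ltW.
- by move=> i x [Sx _]; apply: w1.
Qed.

(** * Descent of the coordinate sum *)

Section Descent.
Variable kappa : R.
Hypothesis kappa_gt0 : 0 < kappa.
Hypothesis coord_ge0 : forall i x, S x -> 0 <= y i x.
Hypothesis drop : forall i j k x, S x -> i != j -> k != i -> k != j ->
  gap s y i x < 0 -> gap s y j (s i x) < 0 -> gap s y i x + gap s y j (s i x) <= - y k x.
(** Once [y k] is below [kappa], two nonnegative gaps imply all the other chamber conditions. A
    descent that keeps [y k] fixed therefore suffices. *)
Hypothesis thin : forall i j k x, S x -> i != j -> k != i -> k != j ->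
  0 < y k x < kappa -> 0 <= gap s y i x -> 0 <= gap s y j x ->
  [/\ 0 <= gap s y k x, 0 < y i x & 0 < y j x].

Let height x := \sum_i y i x.

Let height_ge0 x : S x -> 0 <= height x.
Proof. by move=> Sx; apply: sumr_ge0 => i _; apply: coord_ge0. Qed.

Let height_mirror i x : height (s i x) = height x + gap s y i x.
Proof.
rewrite /height (bigD1 i)//= [in RHS](bigD1 i)//=.
under eq_bigr => j ji do rewrite (coord_mirror sys) 1?eq_sym//.
by rewrite /gap; ring.
Qed.

(** The reflections [i] and [j] do not change [y k], so every descending pair lowers the height by
    at least the same positive amount, and [n] bounds the number of pairs. *)
Lemma descent_pair n i j k x : S x -> i != j -> k != i -> k != j ->
  0 < y k x -> height x <= n%:R * y k x ->
  exists w, [/\ 0 <= gap s y i (wact s w x), 0 <= gap s y j (wact s w x)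
              & y k (wact s w x) = y k x].
Proof.
move=> Sx + + + yk; elim: n i j x Sx yk => [|n IH] i j x Sx yk ij ki kj.
  have hk : y k x <= height x.
    by rewrite /height (bigD1 k)//= lerDl; apply: sumr_ge0 => l _; apply: coord_ge0.
  by rewrite mul0r => h0; have := lt_le_trans yk (le_trans hk h0); rewrite ltxx.
wlog gi : i j ij ki kj / gap s y i x < 0.
  move=> W hx; have [gi|gi] := ltP (gap s y i x) 0; first exact: W.
  have [gj|gj] := ltP (gap s y j x) 0; last by exists [::].
  have ji : j != i by rewrite eq_sym.
  by have [w [? ? ?]] := W j i ji kj ki gj hx; exists w.
move=> hx; have Sx1 : S (s i x) by apply: (mirror_stable sys).
have y1 : y k (s i x) = y k x by rewrite (coord_mirror sys)// eq_sym.
have [g1|g1] := ltP (gap s y j (s i x)) 0; last first.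
  by exists [:: i]; split=> //=; rewrite gap_mirror oppr_ge0 ltW.
have y2 : y k (s j (s i x)) = y k x by rewrite (coord_mirror sys) 1?eq_sym.
have Sx2 : S (s j (s i x)) by apply: (mirror_stable sys).
have [|||||w [a b c]] // := IH i j _ Sx2; rewrite ?y2//.
  have := drop Sx ij ki kj gi g1.
  by rewrite !height_mirror; move: hx; rewrite -natr1 mulrDl mul1r; lra.
by exists (w ++ [:: j; i]); rewrite wact_cat /= c y2.
Qed.

Lemma thin_tiled k x : S x -> 0 < y k x < kappa -> exists w, chamber (wact s w x).
Proof.
move=> Sx yk; have /andP[yk0 _] := yk.
have [i ik] : exists i, i != k.
  by case: (eqVneq ord0 k) => [<-|]; [exists ord_max|exists ord0].
have [j [ji jk]] := third_index ik.
have [n hn] : exists n : nat, height x <= n%:R * y k x.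
  exists (Num.trunc (height x / y k x)).+1.
  by rewrite -ler_pdivrMr// ltW// truncnS_gt.
have [] // := descent_pair Sx (i := i) (j := j) _ _ _ yk0 hn; rewrite 1?eq_sym//.
move=> w [gi gj yw]; exists w; have Sw : S (wact s w x) by apply: wact_stable.
have [] // := thin Sw _ _ _ _ gi gj (k := k); rewrite 1?eq_sym// ?yw// => gk yi yj.
split=> // l; have [->//|lk] := eqVneq l k; first by rewrite yw.
have [->//|li] := eqVneq l i.
by rewrite (third_index_uniq ik jk ji lk li).
Qed.

(** While all coordinates stay at or above [kappa], two descents lower the height by at least
    [kappa]. A coordinate below [kappa] ends the process: either it is 0, or [thin_tiled]
    finishes. *)
Lemma descent x : S x ->
  (exists w, chamber (wact s w x)) \/ exists w k, y k (wact s w x) = 0.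
Proof.
move=> Sx; have [n hn] : exists n : nat, height x < n%:R * kappa.
  exists (Num.trunc (height x / kappa)).+1.
  by rewrite -ltr_pdivrMr// truncnS_gt.
elim: n x Sx hn => [|n IH] x Sx hn.
  by have := height_ge0 Sx; rewrite leNgt; move: hn; rewrite mul0r => ->.
have small z : S z -> (exists k, y k z < kappa) ->
    (exists w, chamber (wact s w z)) \/ exists w k, y k (wact s w z) = 0.
  move=> Sz [k yk]; have := coord_ge0 k Sz; rewrite le_eqVlt => /predU1P[y0|y0].
    by right; exists [::], k.
  by left; apply: (@thin_tiled k) => //; rewrite y0.
have [/small-/(_ Sx)//|/forallNP big] := pselect (exists k, y k x < kappa).
have {}big k : kappa <= y k x by rewrite leNgt; apply/negP/big.
have [[i gi]|/forallNP gx] := pselect (exists i, gap s y i x < 0); last first.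
  left; exists [::]; split=> // i; rewrite leNgt; split; first exact/negP/gx.
  exact: lt_le_trans (big i).
have Sx1 : S (s i x) by apply: (mirror_stable sys).
suff [[w Dw]|[w [k yw]]] : (exists w, chamber (wact s w (s i x))) \/
    exists w k, y k (wact s w (s i x)) = 0.
- by left; exists (rcons w i); rewrite -cats1 wact_cat.
- by right; exists (rcons w i), k; rewrite -cats1 wact_cat.
have [/small-/(_ Sx1)//|/forallNP big1] := pselect (exists k, y k (s i x) < kappa).
have {}big1 k : kappa <= y k (s i x) by rewrite leNgt; apply/negP/big1.
have [[j gj]|/forallNP gx] := pselect (exists j, gap s y j (s i x) < 0); last first.
  left; exists [::]; split=> // j; rewrite leNgt; split; first exact/negP/gx.
  exact: lt_le_trans (big1 j).
have ij : i != j.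
  by apply/eqP => e; move: gj; rewrite -e gap_mirror oppr_lt0 ltNge ltW.
have [k [ki kj]] := third_index ij.
have Sx2 : S (s j (s i x)) by apply: (mirror_stable sys).
have [|[w Dw]|[w [l yw]]] := IH _ Sx2.
- have := drop Sx ij ki kj gi gj; have := big k.
  by rewrite !height_mirror; move: hn; rewrite -natr1 mulrDl mul1r; lra.
- by left; exists (rcons w j); rewrite -cats1 wact_cat.
- by right; exists (rcons w j), l; rewrite -cats1 wact_cat.
Qed.

End Descent.
End System.

(** * Equivariant extension of a map between chambers *)

Section Extension.
Variables (R : realType) (E E' : topologicalType).
Variables (S : set E) (s : 'I_3 -> E -> E) (y : 'I_3 -> E -> R).
Variables (S' : set E') (s' : 'I_3 -> E' -> E') (y' : 'I_3 -> E' -> R).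
Hypotheses (sys : mirror_system S s y) (sys' : mirror_system S' s' y').
Variable phi : E -> E'.

Local Notation D := (chamber S s y).
Local Notation D' := (chamber S' s' y').

Hypothesis phi_chamber : forall x, D x -> D' (phi x).
Hypothesis phi_gap : forall i x, D x -> gap s y i x = 0 -> gap s' y' i (phi x) = 0.
Hypothesis phi_continuous : forall x, D x -> {for x, continuous phi}.

Let sK := mirrorK sys.
Let sK' := mirrorK sys'.

Lemma chamber_coherent w x : D x -> D (wact s w x) ->
  wact s' w (phi x) = phi (wact s w x).
Proof.
move=> Dx; rewrite -(wact_reduce sK) -(wact_reduce sK').
move=> /(chamber_return sys (reduced_reduce _) Dx)[->//|[i [-> gi]] /=].
rewrite (gap0_fixed sys Dx.1 gi); apply: (gap0_fixed sys'); last exact: phi_gap.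
by case: (phi_chamber Dx).
Qed.

(** The word picked by [cid] is immaterial, by [extendE]. Away from the orbit of the chamber,
    [phi x] is a dummy value. *)
Definition extend (x : E) : E' :=
  match pselect (exists w, D (wact s w x)) with
  | left e => let w := projT1 (cid e) in wact s' (rev w) (phi (wact s w x))
  | right _ => phi x
  end.

Lemma extendE w x : D (wact s w x) -> extend x = wact s' (rev w) (phi (wact s w x)).
Proof.
move=> Dw; rewrite /extend; case: pselect => [e|[]]; last by exists w.
case: cid => u Du /=; apply: (can_inj (wact_revK sK' u)).
rewrite (wact_Krev sK') -wact_cat.
have e1 : wact s u x = wact s (u ++ rev w) (wact s w x) by rewrite wact_cat wact_revK.
by rewrite (chamber_coherent Dw) -e1.
Qed.

Lemma extend_chamber x : D x -> extend x = phi x.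
Proof. by move=> Dx; rewrite (@extendE [::]). Qed.

Lemma extend_wact w x : tiled S s y x -> extend (wact s w x) = wact s' w (extend x).
Proof.
move=> [_ [u Du]]; rewrite (extendE Du) (@extendE (u ++ rev w)) ?wact_cat ?wact_revK//.
by rewrite rev_cat revK wact_cat.
Qed.

Lemma extend_tiled x : tiled S s y x -> tiled S' s' y' (extend x).
Proof.
move=> [_ [u Du]]; rewrite (extendE Du); have D'u := phi_chamber Du.
split; first by apply: (wact_stable sys'); case: D'u.
by exists u; rewrite (wact_Krev sK').
Qed.

Let extend_continuous_chamber x : D x -> extend @ within S (nbhs x) --> extend x.
Proof.
move=> Dx N; rewrite (extend_chamber Dx) => Nx; rewrite nbhs_simpl/= /within/=.
have H1 : \forall z \near x, N (phi z) by exact: phi_continuous Dx _ Nx.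
(* Across the wall the extension is [s' i \o phi \o s i]. It agrees with [phi] at [x], because [s i]
   fixes [x] and [s' i] fixes [phi x]; hence the two formulas have the same limit. *)
have H2 i : gap s y i x = 0 -> \forall z \near x, N (s' i (phi (s i z))).
  move=> gi; have six : s i x = x by apply: (gap0_fixed sys) gi; case: Dx.
  have e' : s' i (phi x) = phi x.
    by apply: (gap0_fixed sys'); [case: (phi_chamber Dx)|exact: phi_gap].
  have c1 : {for x, continuous (s' i \o (phi \o s i))}.
    apply: continuous_comp; last exact: (mirror_continuous sys').
    apply: continuous_comp; first exact: (mirror_continuous sys).
    by rewrite six; apply: phi_continuous.
  by apply: c1; rewrite /= six e'.
have H3 : \forall z \near x, forall i, gap s y i x = 0 -> N (s' i (phi (s i z))).
  apply: near_ord => i; have [/H2|ng] := pselect (gap s y i x = 0).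
    by apply: nearS.
  by apply: nearW => z.
apply: nearS (nearI (chamber_near sys Dx) (nearI H1 H3)) => z [Hz [Nz Nsz]] Sz.
change (N (extend z)).
have [Dz|[i [gi Dz]]] := Hz Sz; first by rewrite extend_chamber.
by rewrite (@extendE [:: i])//=; apply: Nsz.
Qed.

Lemma extend_continuous x : tiled S s y x -> extend @ within S (nbhs x) --> extend x.
Proof.
move=> Ux; have [Sx [w Dw]] := Ux.
have e : extend x = wact s' (rev w) (extend (wact s w x)).
  by rewrite (extend_wact w Ux) (wact_revK sK').
move=> N; rewrite e => Nx.
have := wact_continuous sys' Nx => /= /(extend_continuous_chamber Dw).
rewrite !nbhs_simpl/= => /(wact_continuous sys (w := w)).
move=> H1; apply: nearS (nearI (tiled_near sys Ux) H1) => z /= [Uz H] Sz.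
change (N (extend z)); have := H (wact_stable sys w Sz).
by rewrite (extend_wact w (Uz Sz)) (wact_revK sK').
Qed.

End Extension.

Lemma extendK (R : realType) (E E' : topologicalType)
    (S : set E) (s : 'I_3 -> E -> E) (y : 'I_3 -> E -> R)
    (S' : set E') (s' : 'I_3 -> E' -> E') (y' : 'I_3 -> E' -> R)
    (sys : mirror_system S s y) (sys' : mirror_system S' s' y')
    (phi : E -> E') (psi : E' -> E) :
  (forall x, chamber S s y x -> chamber S' s' y' (phi x)) ->
  (forall p, chamber S' s' y' p -> chamber S s y (psi p)) ->
  (forall i x, chamber S s y x -> gap s y i x = 0 -> gap s' y' i (phi x) = 0) ->
  (forall i p, chamber S' s' y' p -> gap s' y' i p = 0 -> gap s y i (psi p) = 0) ->
  (forall x, chamber S s y x -> psi (phi x) = x) ->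
  forall x, tiled S s y x ->
  extend S' s' y' s psi (extend S s y s' phi x) = x.
Proof.
move=> pD qD pg qg qp x [Sx [w Dw]].
rewrite (extendE sys sys' pD pg Dw) (extendE sys' sys qD qg (w := w)).
  by rewrite (wact_Krev (mirrorK sys')) qp// (wact_revK (mirrorK sys)).
by rewrite (wact_Krev (mirrorK sys')); apply: pD.
Qed.

(** * The tropical mirror system *)

Section Triples.
Variable R : realType.

Definition co (i : 'I_3) (x : R * R * R) : R :=
  match val i with 0 => x.1.1 | 1 => x.1.2 | _ => x.2 end.

Lemma co_ext (x x' : R * R * R) : (forall i, co i x = co i x') -> x = x'.
Proof.
case: x x' => [[p q] r] [[p' q'] r'] H.
by have := H ord0; have := H (inord 1); have := H ord_max; rewrite /co /= inordK//= => -> -> ->.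
Qed.

Section Continuity.
Variables (E : topologicalType) (z : E).
Implicit Types f g h : E -> R.

Lemma continuous_addf f g : continuous_at z f -> continuous_at z g ->
  continuous_at z (fun x => f x + g x).
Proof. exact: continuousD. Qed.

Lemma continuous_oppf f : continuous_at z f -> continuous_at z (fun x => - f x).
Proof. exact: continuousN. Qed.

Lemma continuous_mulf f g : continuous_at z f -> continuous_at z g ->
  continuous_at z (fun x => f x * g x).
Proof. exact: continuousM. Qed.

Lemma continuous_invf f : f z != 0 -> continuous_at z f ->
  continuous_at z (fun x => (f x)^-1).
Proof. exact: continuousV. Qed.

Lemma continuous_maxf f g : continuous_at z f -> continuous_at z g ->
  continuous_at z (fun x => Num.max (f x) (g x)).
Proof. exact: continuous_max. Qed.

Lemma continuous_triple f g h : continuous_at z f -> continuous_at z g ->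
  continuous_at z h -> continuous_at z (fun x => (f x, g x, h x)).
Proof. by move=> cf cg ch; exact: (cvg_pair (cvg_pair cf cg) ch). Qed.

End Continuity.

Lemma continuous_co i : continuous (co i).
Proof.
move=> x; have c1 : {for x, continuous (fst : R * R * R -> R * R)} by apply: cvg_fst.
have c2 : {for x, continuous (snd : R * R * R -> R)} by apply: cvg_snd.
rewrite /co; case: i => [[|[|i]]] hi //=.
- by apply: (continuous_comp c1); apply: cvg_fst.
- by apply: (continuous_comp c1); apply: cvg_snd.
Qed.

Lemma continuous_co1 x : {for x, continuous (fun x : R * R * R => x.1.1)}.
Proof. exact: (@continuous_co ord0). Qed.
Lemma continuous_co2 x : {for x, continuous (fun x : R * R * R => x.1.2)}.
Proof. by have := @continuous_co (@Ordinal 3 1 isT) x. Qed.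
Lemma continuous_co3 x : {for x, continuous (fun x : R * R * R => x.2)}.
Proof. exact: (@continuous_co ord_max). Qed.

End Triples.

Ltac cts := repeat lazymatch goal with
  | |- continuous_at _ (fun _ => ?c) => apply: cvg_cst
  | |- continuous_at _ (fun x => (@?f x, @?g x, @?h x)) =>
      apply: (@continuous_triple _ _ _ f g h)
  | |- continuous_at _ (fun x => @?f x + @?g x) => apply: (@continuous_addf _ _ _ f g)
  | |- continuous_at _ (fun x => @?f x * @?g x) => apply: (@continuous_mulf _ _ _ f g)
  | |- continuous_at _ (fun x => - @?f x) => apply: (@continuous_oppf _ _ _ f)
  | |- continuous_at _ (fun x => (@?f x)^-1) => apply: (@continuous_invf _ _ _ f)
  | |- continuous_at _ (fun x => Num.max (@?f x) (@?g x)) =>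
      apply: (@continuous_maxf _ _ _ f g)
  | |- continuous_at _ (fun x => x.1.1) => apply: continuous_co1
  | |- continuous_at _ (fun x => x.1.2) => apply: continuous_co2
  | |- continuous_at _ (fun x => x.2) => apply: continuous_co3
  | |- continuous_at _ (fun x => co _ x) => apply: continuous_co
  | |- continuous_at _ _ => assumption
  end.

Section Tropical.
Variable R : realType.
Implicit Types (x : R * R * R) (a b c d p q r F : R).

Definition farv (b c d q r : R) : R :=
  Num.max (Num.max (Num.max (2 * q) (b + q)) (Num.max (2 * r) (c + r))) d.

(** The maximum [farv] as a list of linear constraints and a disjunction of equalities, the form in
    which linear arithmetic can use it. *)
Definition farspec (F b c d q r : R) : Prop :=
  [/\ 2 * q <= F, b + q <= F, 2 * r <= F, c + r <= F & d <= F] /\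
  (F = 2 * q \/ F = b + q \/ F = 2 * r \/ F = c + r \/ F = d).

Lemma farvP b c d q r : farspec (farv b c d q r) b c d q r.
Proof.
rewrite /farv /farspec !le_max !lexx ?orbT /=; split=> //.
by rewrite /Order.max; do !case: ifP => ?; tauto.
Qed.

Lemma farspecC F b c d q r : farspec F b c d q r -> farspec F c b d r q.
Proof. by rewrite /farspec => -[[? ? ? ? ?] ?]; split; [split|tauto]. Qed.

Lemma farspec_uniq F F' b c d q r : farspec F b c d q r -> farspec F' b c d q r -> F = F'.
Proof.
move=> [[? ? ? ? ?] H] [[? ? ? ? ?] H']; apply/eqP; rewrite eq_le; apply/andP; split.
  by case: H => [->|[->|[->|[->|->]]]].
by case: H' => [->|[->|[->|[->|->]]]].
Qed.

(** This is [p + q + r = max (2 p, 2 q, 2 r, a + p, b + q, c + r, d)] with each comparison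
    simplified. It is the skeleton equation after the change of sign of the coordinates; [a], [b],
    [c], [d] stand for the opposites of the tropical parameters. *)
Definition sk (a b c d p q r : R) : Prop :=
  [/\ p <= q + r, q <= p + r & r <= p + q] /\
  [/\ a <= q + r, b <= p + r, c <= p + q & d <= p + q + r] /\
  (p = q + r \/ q = p + r \/ r = p + q \/ a = q + r \/ b = p + r \/ c = p + q \/ d = p + q + r).

Lemma sk_swap12 a b c d p q r : sk a b c d p q r -> sk b a c d q p r.
Proof.
move=> [[? ? ?] [[? ? ? ?] H]]; split; first by split=> //; rewrite addrC.
by split; [split=> //; rewrite ?(addrC q)|rewrite !(addrC q p); tauto].
Qed.

Lemma sk_swap23 a b c d p q r : sk a b c d p q r -> sk a c b d p r q.
Proof.
move=> [[? ? ?] [[? ? ? ?] H]]; split; first by split=> //; rewrite addrC.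
split; first by split=> //; lra.
by rewrite !(addrC r q) -(addrA p r q) (addrC r q) addrA; tauto.
Qed.

(** Subtracting [p] from the equation turns it into [q + r = max (p, a, F - p)], in which
    [p |-> F - p] is a visible symmetry. *)
Lemma skE F a b c d p q r : 0 <= a -> 0 <= b -> 0 <= c -> 0 <= d ->
  farspec F b c d q r ->
  sk a b c d p q r <-> [/\ p <= q + r, a <= q + r & F - p <= q + r] /\
    (q + r = p \/ q + r = a \/ q + r = F - p).
Proof.
move=> a0 b0 c0 d0 [[h1 h2 h3 h4 h5] H]; split.
  move=> [[k1 k2 k3] [[k4 k5 k6 k7] K]].
  split; first by clear K; split=> //; case: H => [|[|[|[|]]]] ?; lra.
  case: K => [|[|[|[|[|[|]]]]]] K; [left; lra| | |right; left; lra| | |];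
  right; right; case: H => [|[|[|[|]]]] ?; lra.
move=> [[k1 k2 k3] K]; split; first by clear H K; split=> //; lra.
split; first by clear H K; split=> //; lra.
case: K => [|[|]] K; [by left|by right; right; right; left|].
case: H => [|[|[|[|]]]] ?.
- by right; left; lra.
- by do 4!right; left; lra.
- by do 2!right; left; lra.
- by do 5!right; left; lra.
- by do 6!right; lra.
Qed.

Lemma sk_flip F a b c d p q r : 0 <= a -> 0 <= b -> 0 <= c -> 0 <= d ->
  farspec F b c d q r -> sk a b c d p q r -> sk a b c d (F - p) q r.
Proof.
move=> a0 b0 c0 d0 hF /(skE p a0 b0 c0 d0 hF)[[? ? ?] K].
by apply/(skE _ a0 b0 c0 d0 hF); split; [split=> //; lra|rewrite subKr; tauto].
Qed.

Lemma sk_ge0 a b c d p q r : sk a b c d p q r -> [/\ 0 <= p, 0 <= q & 0 <= r].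
Proof. by move=> [[? ? ?] _]; split; lra. Qed.

(** [F' >= 2 * p > F >= 2 * q]. *)
Lemma sk_gap_opposite F F' a b c d p q r : 0 <= a -> 0 <= b -> 0 <= c -> 0 <= d ->
  farspec F b c d q r -> farspec F' a c d p r ->
  F - 2 * p < 0 -> 0 < F' - 2 * q.
Proof. by move=> ? ? ? ? [[? ? ? ? ?] _] [[? ? ? ? ?] _] ?; lra. Qed.

(** From [F >= 2 * q] and [F' >= 2 * p] one gets [p = q], and [F' >= a + p] gives [a <= p]. So the
    maximum [q + r] of [p], [a] and [F - p] is [p]. *)
Lemma sk_two0 F F' a b c d p q r : 0 <= a -> 0 <= b -> 0 <= c -> 0 <= d ->
  farspec F b c d q r -> farspec F' a c d p r -> sk a b c d p q r ->
  F - 2 * p = 0 -> F' - 2 * q = 0 -> r = 0.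
Proof.
move=> a0 b0 c0 d0 hF hF' S g g'; have [r0 _ _] := sk_ge0 S.
have [[? ? ?] K] := (skE p a0 b0 c0 d0 hF).1 S.
have [[? ? ?] K'] := (skE q b0 a0 c0 d0 hF').1 (sk_swap12 S).
case: hF hF' => [[? ? ? ? ?] _] [[? ? ? ? ?] _].
by case: K => [|[|]] ?; case: K' => [|[|]] ?; lra.
Qed.

(** Put [p' = F - p]. The second descent gives [2 * p' <= F' < 2 * q]. After the first flip,
    [p' + r] is [q] or [b], the third option [F' - q] being smaller than [q]. As [F = p + p'] is at
    least [2 * q] and [b + q], in both cases [q + r <= p]. Hence [p' - p < - r]: the first descent
    alone gains more than [r]. *)
Lemma sk_drop F F' a b c d p q r : 0 <= a -> 0 <= b -> 0 <= c -> 0 <= d ->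
  farspec F b c d q r -> farspec F' a c d (F - p) r -> sk a b c d p q r ->
  F - 2 * p < 0 -> F' - 2 * q < 0 -> (F - 2 * p) + (F' - 2 * q) <= - r.
Proof.
move=> a0 b0 c0 d0 hF hF' S g g'; have [p0 q0 r0] := sk_ge0 S.
have S' := sk_flip a0 b0 c0 d0 hF S.
have [[? ? ?] K] := (skE p a0 b0 c0 d0 hF).1 S.
have [[? ? ?] K'] := (skE q b0 a0 c0 d0 hF').1 (sk_swap12 S').
case: hF hF' => [[? ? ? ? ?] _] [[? ? ? ? ?] _].
by case: K => [|[|]] ?; case: K' => [|[|]] ?; lra.
Qed.

(** Every parameter is at most [p + q + r], so [p + q > 3 * r]. As [p] and [q] differ by at most
    [r], both exceed [r]; this is the origin of the factor 4. *)
Lemma sk_thin F'' m a b c d p q r : 0 <= a -> 0 <= b -> 0 <= c -> 0 <= d ->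
  (m = a \/ m = b \/ m = c \/ m = d) ->
  farspec F'' a b d p q -> sk a b c d p q r -> 4 * r < m ->
  [/\ 0 <= F'' - 2 * r, 0 < p & 0 < q].
Proof.
move=> a0 b0 c0 d0 em [[? ? ? ? ?] _] S rm; have [p0 q0 r0] := sk_ge0 S.
case: S => [[? ? ?] [[? ? ? ?] _]].
have : m <= p + q + r by case: em => [|[|[|]]] ->; lra.
by clear em; move=> mS; split; lra.
Qed.

Variables (a : R * R * R) (d : R).
Hypotheses (a0 : forall i, 0 <= co i a) (d0 : 0 <= d).

Definition far (i : 'I_3) x : R :=
  match val i with
  | 0 => farv a.1.2 a.2 d x.1.2 x.2
  | 1 => farv a.1.1 a.2 d x.1.1 x.2
  | _ => farv a.1.1 a.1.2 d x.1.1 x.1.2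
  end.

Definition tropical_mirror (i : 'I_3) x : R * R * R :=
  match val i with
  | 0 => (far i x - x.1.1, x.1.2, x.2)
  | 1 => (x.1.1, far i x - x.1.2, x.2)
  | _ => (x.1.1, x.1.2, far i x - x.2)
  end.

Definition tropical_surface : set (R * R * R) :=
  [set x | sk a.1.1 a.1.2 a.2 d x.1.1 x.1.2 x.2].

Local Notation S := tropical_surface.
Local Notation s := tropical_mirror.

Lemma farP i j k x : i != j -> k != i -> k != j ->
  farspec (far i x) (co j a) (co k a) d (co j x) (co k x).
Proof.
by case: i j k => [[|[|[|i]]] hi] [[|[|[|j]]] hj] [[|[|[|k]]] hk] //= _ _ _;
  rewrite /far /co /=; first [exact: farvP|exact/farspecC/farvP].
Qed.

Lemma surfaceP i j k x : i != j -> k != i -> k != j ->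
  S x <-> sk (co i a) (co j a) (co k a) d (co i x) (co j x) (co k x).
Proof.
rewrite /tropical_surface /co /=.
case: i j k => [[|[|[|i]]] hi] [[|[|[|j]]] hj] [[|[|[|k]]] hk] //= _ _ _;
  split=> H //.
- exact: sk_swap23.
- exact: sk_swap23.
- exact: sk_swap12.
- exact: sk_swap12.
- exact/sk_swap23/sk_swap12.
- exact/sk_swap12/sk_swap23.
- exact/sk_swap12/sk_swap23.
- exact/sk_swap23/sk_swap12.
- exact/sk_swap12/sk_swap23/sk_swap12.
- exact/sk_swap12/sk_swap23/sk_swap12.
Qed.

Lemma co_tropical_mirror i x : co i (s i x) = far i x - co i x.
Proof. by rewrite /co /s; case: i => [[|[|[|i]]] hi]. Qed.

Lemma co_tropical_mirrorN i j x : i != j -> co j (s i x) = co j x.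
Proof. by rewrite /co /s; case: i j => [[|[|[|i]]] hi] [[|[|[|j]]] hj]. Qed.

Lemma tropical_gap i x : gap s (@co R) i x = far i x - 2 * co i x.
Proof. by rewrite /gap co_tropical_mirror; ring. Qed.

Lemma tropical_mirrorK i : involutive (s i).
Proof.
by case=> [[p q] r]; case: i => [[|[|[|i]]] hi] //=; rewrite /s /far /= subKr.
Qed.

Lemma continuous_far i : continuous (far i).
Proof. by move=> x; rewrite /far /farv; case: i => [[|[|i]] hi] /=; cts. Qed.

Lemma tropical_mirror_continuous i : continuous (s i).
Proof.
move=> x; have := @continuous_far i x; rewrite /s.
by case: i => [[|[|i]] hi] /= cf; cts.
Qed.

Lemma other_indices (i : 'I_3) : exists j k, [/\ i != j, k != i & k != j].
Proof.
have [j ij] : exists j, i != j.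
  by case: (eqVneq i ord0) => [->|]; [exists ord_max|exists ord0].
by have [k [ki kj]] := third_index ij; exists j, k.
Qed.

Lemma tropical_system : mirror_system S s (@co R).
Proof.
split.
- move=> i x Sx; have [j [k [ij ki kj]]] := other_indices i.
  apply/(surfaceP _ ij ki kj).
  have ik : i != k by rewrite eq_sym.
  rewrite co_tropical_mirror (co_tropical_mirrorN x ij) (co_tropical_mirrorN x ik).
  by apply: sk_flip => //; [exact: farP|apply/surfaceP].
- exact: tropical_mirrorK.
- exact: tropical_mirror_continuous.
- exact: continuous_co.
- by move=> i j x /co_tropical_mirrorN.
- by move=> x x' _ _; apply: co_ext.
- move=> i j x Sx ij; have [k [ki kj]] := third_index ij.
  have ji : j != i by rewrite eq_sym.
  rewrite !tropical_gap.
  exact: (sk_gap_opposite (a0 j) (a0 i) (a0 k) d0 (farP x ji kj ki) (farP x ij ki kj)).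
- move=> i j k x Sx ij ki kj; rewrite !tropical_gap.
  have ji : j != i by rewrite eq_sym.
  exact: (sk_two0 (a0 i) (a0 j) (a0 k) d0 (farP x ij ki kj) (farP x ji kj ki)
    ((surfaceP x ij ki kj).1 Sx)).
Qed.

Lemma tropical_coord_ge0 i x : S x -> 0 <= co i x.
Proof.
have [j [k [ij ki kj]]] := other_indices i.
by move/(surfaceP x ij ki kj)/sk_ge0 => [].
Qed.

Lemma tropical_drop i j k x : S x -> i != j -> k != i -> k != j ->
  gap s (@co R) i x < 0 -> gap s (@co R) j (s i x) < 0 ->
  gap s (@co R) i x + gap s (@co R) j (s i x) <= - co k x.
Proof.
move=> Sx ij ki kj; rewrite !tropical_gap (co_tropical_mirrorN x ij).
have ji : j != i by rewrite eq_sym.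
have := farP (s i x) ji kj ki.
rewrite co_tropical_mirror (co_tropical_mirrorN (j := k)) 1?eq_sym// => hF'.
exact: (sk_drop (a0 i) (a0 j) (a0 k) d0 (farP x ij ki kj) hF'
    ((surfaceP x ij ki kj).1 Sx)).
Qed.

Lemma tropical_thin m i j k x : (m = d \/ exists i, m = co i a) ->
  S x -> i != j -> k != i -> k != j -> 0 < co k x < m / 4 ->
  [/\ 0 <= gap s (@co R) k x, 0 < co i x & 0 < co j x].
Proof.
move=> em Sx ij ki kj /andP[_ xm]; rewrite tropical_gap.
have ik : i != k by rewrite eq_sym.
have jk : j != k by rewrite eq_sym.
apply: (sk_thin (m := m) (a0 i) (a0 j) (a0 k) d0 _ (farP x ki jk _)
   ((surfaceP x ij ki kj).1 Sx)); rewrite 1?eq_sym//; last by lra.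
case: em => [|[l]]; first by tauto.
have [->|li] := eqVneq l i; first by tauto.
have [->|lk] := eqVneq l k; first by tauto.
by rewrite (third_index_uniq ik jk _ lk li) 1?eq_sym//; tauto.
Qed.

End Tropical.

(** * The tropical chamber *)

Definition total (R : realType) (x : R * R * R) : R := x.1.1 + x.1.2 + x.2.

Lemma totalE (R : realType) i j k (x : R * R * R) : i != j -> k != i -> k != j ->
  total x = co i x + co j x + co k x.
Proof.
by case: i j k => [[|[|[|i]]] hi] [[|[|[|j]]] hj] [[|[|[|k]]] hk] //= _ _ _;
  rewrite /total /co /=; ring.
Qed.

Section Core.
Variables (R : realType) (a : R * R * R) (d : R).
Hypotheses (a0 : forall i, 0 <= co i a) (d0 : 0 <= d).
Implicit Types x z : R * R * R.

Local Notation S := (tropical_surface a d).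
Local Notation s := (tropical_mirror a d).
Local Notation F := (far a d).
Local Notation G := (gap s (@co R)).
Local Notation D := (chamber S s (@co R)).

(* The facets of the polyhedron bounded by the surface other than those of the
   cone of triangle inequalities. *)
Definition tight x : Prop := (exists i, co i a + co i x = total x) \/ d = total x.

Lemma surfaceE x : S x <-> [/\ forall i, 2 * co i x <= total x,
  forall i, co i a + co i x <= total x, d <= total x &
  (exists i, 2 * co i x = total x) \/ tight x].
Proof.
rewrite /tropical_surface /sk /=; split.
  move=> [[h1 h2 h3] [[h4 h5 h6 h7] H]]; split.
  - by case=> [[|[|[|i]]] hi] //; rewrite /co /total /=; lra.
  - by case=> [[|[|[|i]]] hi] //; rewrite /co /total /=; lra.
  - by rewrite /total.
  rewrite /tight /total; case: H => [|[|[|[|[|[|]]]]]] h.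
  - by left; exists ord0; rewrite /co /=; lra.
  - by left; exists (@Ordinal 3 1 isT); rewrite /co /=; lra.
  - by left; exists ord_max; rewrite /co /=; lra.
  - by right; left; exists ord0; rewrite /co /=; lra.
  - by right; left; exists (@Ordinal 3 1 isT); rewrite /co /=; lra.
  - by right; left; exists ord_max; rewrite /co /=; lra.
  - by right; right.
rewrite /tight; case=> H1 H2 H3 H.
have := H1 ord0; have := H1 (@Ordinal 3 1 isT); have := H1 ord_max.
have := H2 ord0; have := H2 (@Ordinal 3 1 isT); have := H2 ord_max.
move: H3; rewrite /co /total /= => h1 h2 h3 h4 h5 h6 h7.
split; first by split; lra.
split; first by split; lra.
case: H => [[[[|[|[|i]]] hi]]|[[[[|[|[|i]]] hi]]|]] //; rewrite /co /total /= => h;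
  [left|right; left|right; right; left|right; right; right; left
  |right; right; right; right; left|right; right; right; right; right; left
  |do 6!right]; lra.
Qed.

Lemma far_ge2 i j x : i != j -> 2 * co j x <= F i x.
Proof. by move=> ij; have [k [ki kj]] := third_index ij; have [[]] := farP a d x ij ki kj. Qed.

Lemma far_gea i j x : i != j -> co j a + co j x <= F i x.
Proof. by move=> ij; have [k [ki kj]] := third_index ij; have [[]] := farP a d x ij ki kj. Qed.

Lemma far_ged i x : d <= F i x.
Proof. by have [j [k [ij ki kj]]] := other_indices i; have [[]] := farP a d x ij ki kj. Qed.

Lemma far_attained i x :
  (exists2 j, i != j & F i x = 2 * co j x \/ F i x = co j a + co j x) \/ F i x = d.
Proof.
have [j [k [ij ki kj]]] := other_indices i; have [_] := farP a d x ij ki kj.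
have ik : i != k by rewrite eq_sym.
case=> [|[|[|[|]]]] h; [left; exists j => //|left; exists j => //|
  left; exists k => //|left; exists k => //|]; tauto.
Qed.

Lemma far_le_total i x : S x -> F i x <= total x.
Proof.
by move=> /surfaceE[h1 h2 h3 _]; case: (far_attained i x) => [[j _ [|]]|] ->.
Qed.

Lemma far_eq i x z : (forall j, i != j -> co j x = co j z) -> F i x = F i z.
Proof.
move=> e; have [j [k [ij ki kj]]] := other_indices i.
have ik : i != k by rewrite eq_sym.
apply: (farspec_uniq (farP a d x ij ki kj)).
by rewrite (e j)// (e k)//; apply: farP.
Qed.

(** All tight terms except [co i a + co i x] occur in [F i], while that one occurs in every other
    [F j]. Hence at most one [F i] can stay below the total. *)
Lemma tight_far i x : S x -> tight x -> F i x < total x ->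
  [/\ co i a + co i x = total x & forall j, i != j -> F j x = total x].
Proof.
move=> Sx tx lt; suff e : co i a + co i x = total x.
  split=> // j ij; apply/eqP; rewrite eq_le far_le_total//= -e far_gea// eq_sym//.
case: tx => [[j e]|e]; last by have := far_ged i x; lra.
have [->//|ij] := eqVneq i j.
by have := far_gea x ij; lra.
Qed.

(** On a facet [2 * co i x = total x] the nonnegative gap forces [F i x = total x], so another term
    attains the total as well. A second doubled coordinate would make the third one vanish, hence
    that term is a tight one. *)
Lemma chamber_tight x : D x -> tight x.
Proof.
move=> [Sx Dx]; have [h1 h2 h3 [[i e]|//]] := (surfaceE x).1 Sx.
have Fi : F i x = total x.
  apply/eqP; rewrite eq_le far_le_total//= -e.
  by have := (Dx i).1; rewrite tropical_gap subr_ge0.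
case: (far_attained i x) => [[j ij [e'|e']]|e']; last by right; rewrite -e'.
- have [k [ki kj]] := third_index ij; have := (Dx k).2.
  by move: e e'; rewrite Fi (totalE x ij ki kj); lra.
- by left; exists j; rewrite -e'.
Qed.

(** On the facet [co i a + co i x = total x], move [co i x] and keep the other two coordinates, so
    that [F i] is constant. The part where the total exceeds [F i] starts at
    [co i x = F i - co i a]. The chamber ends at [co i x = F i / 2], the cone of triangle
    inequalities at [co i x = co i a]. From the common start, the second distance is twice the
    first, so [nudge] doubles the excess [total x - F i x] and [unnudge] halves it. By [tight_far]
    at most one of the three corrections is nonzero on tight points of the surface. *)
Definition nudge x : R * R * R :=
  (x.1.1 + (total x - F ord0 x), x.1.2 + (total x - F (@Ordinal 3 1 isT) x),
   x.2 + (total x - F ord_max x)).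

Definition unnudge z : R * R * R :=
  (z.1.1 - (total z - F ord0 z) / 2, z.1.2 - (total z - F (@Ordinal 3 1 isT) z) / 2,
   z.2 - (total z - F ord_max z) / 2).

Lemma co_nudge i x : co i (nudge x) = co i x + (total x - F i x).
Proof. by rewrite /co /nudge; case: i => [[|[|[|i]]] hi]. Qed.

Lemma co_unnudge i x : co i (unnudge x) = co i x - (total x - F i x) / 2.
Proof. by rewrite /co /unnudge; case: i => [[|[|[|i]]] hi]. Qed.

Definition core z : Prop := [/\ S z, tight z & forall i, 0 < co i z].

Lemma far_dichotomy x : S x -> tight x ->
  (forall i, F i x = total x) \/
  exists2 i, F i x < total x & co i a + co i x = total x /\
    forall j, i != j -> F j x = total x.
Proof.
move=> Sx tx; have [[i lt]|/forallNP H] := pselect (exists i, F i x < total x).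
  by right; exists i => //; have [] := tight_far Sx tx lt.
left=> i; apply/eqP; rewrite eq_le far_le_total//= leNgt; exact/negP/H.
Qed.

Lemma nudge_id x : (forall i, F i x = total x) -> nudge x = x.
Proof. by move=> H; apply: co_ext => i; rewrite co_nudge H subrr addr0. Qed.

Lemma unnudge_id x : (forall i, F i x = total x) -> unnudge x = x.
Proof. by move=> H; apply: co_ext => i; rewrite co_unnudge H subrr mul0r subr0. Qed.

Lemma nudge_spec x : D x -> [/\ core (nudge x), unnudge (nudge x) = x &
  forall i, G i x = 0 -> 2 * co i (nudge x) = total (nudge x)].
Proof.
move=> Dx; have [Sx Dx'] := Dx; have tx := chamber_tight Dx.
have [H|[i lt [e H]]] := far_dichotomy Sx tx.
  rewrite nudge_id// unnudge_id//; split=> // [|i].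
    by split=> // i; apply: (Dx' i).2.
  by rewrite tropical_gap H => /eqP; rewrite subr_eq0 => /eqP.
have [h1 h2 h3 _] := (surfaceE x).1 Sx.
have ci : co i (nudge x) = co i x + (total x - F i x) by rewrite co_nudge.
have cj j : i != j -> co j (nudge x) = co j x by move=> ij; rewrite co_nudge H// subrr addr0.
have tn : total (nudge x) = total x + (total x - F i x).
  have [j [k [ij ki kj]]] := other_indices i.
  by rewrite !(totalE _ ij ki kj) ci !cj// 1?eq_sym// (totalE x ij ki kj); ring.
have gi := (Dx' i).1; rewrite tropical_gap in gi.
have ea : co i a + co i (nudge x) = total (nudge x) by rewrite ci tn; lra.
have Sn : S (nudge x).
  apply/surfaceE; split=> [j|j||]; last by right; left; exists i.
  - have [<-|/cj->] := eqVneq i j; first by rewrite ci tn; lra.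
    by rewrite tn; have := h1 j; lra.
  - have [<-|/cj->] := eqVneq i j; first by rewrite ea.
    by rewrite tn; have := h2 j; lra.
  - by rewrite tn; lra.
have Fi : F i (nudge x) = F i x by apply: far_eq => j /cj.
split.
- split=> // [|j]; first by left; exists i.
  have := (Dx' j).2; have [<-|/cj->//] := eqVneq i j.
  by rewrite ci; lra.
- apply: co_ext => j; rewrite co_unnudge.
  have [<-|ij] := eqVneq i j; first by rewrite Fi ci tn; lra.
  have lt' : F i (nudge x) < total (nudge x) by rewrite Fi tn; lra.
  have [_ ->//] := tight_far Sn (or_introl (ex_intro _ i ea)) lt'.
  by rewrite subrr mul0r subr0 cj.
- move=> j; rewrite tropical_gap; have [<-|ij] := eqVneq i j.
    by rewrite ci tn; lra.
  (* No other mirror passes through such a point: [2 * co j x <= F i x < total x]. *)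
  by rewrite H// => g; have := far_ge2 x ij; lra.
Qed.

Lemma unnudge_spec z : core z -> [/\ D (unnudge z), nudge (unnudge z) = z &
  forall i, 2 * co i z = total z -> G i (unnudge z) = 0].
Proof.
move=> [Sz tz z0]; have [h1 h2 h3 _] := (surfaceE z).1 Sz.
have [H|[i lt [e H]]] := far_dichotomy Sz tz.
  rewrite unnudge_id// nudge_id//; split=> // [|i].
    by split=> // i; rewrite tropical_gap H subr_ge0.
  by rewrite tropical_gap H => ->; rewrite subrr.
have ci : co i (unnudge z) = co i z - (total z - F i z) / 2 by rewrite co_unnudge.
have cj j : i != j -> co j (unnudge z) = co j z.
  by move=> ij; rewrite co_unnudge H// subrr mul0r subr0.
have [j' [k' [ij' ki' kj']]] := other_indices i.
have ik' : i != k' by rewrite eq_sym.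
have tn : total (unnudge z) = total z - (total z - F i z) / 2.
  by rewrite !(totalE _ ij' ki' kj') ci !cj// (totalE z ij' ki' kj'); ring.
have ea : co i a + co i (unnudge z) = total (unnudge z) by rewrite ci tn; lra.
have Sn : S (unnudge z).
  apply/surfaceE; split=> [j|j||]; last by right; left; exists i.
  - have [<-|ij] := eqVneq i j; first by rewrite ci tn; have := h1 i; lra.
    by rewrite tn cj//; have := far_ge2 z ij; lra.
  - have [<-|ij] := eqVneq i j; first by rewrite ea.
    by rewrite tn cj//; have := far_gea z ij; lra.
  - by rewrite tn; have := far_ged i z; lra.
have Fi : F i (unnudge z) = F i z by apply: far_eq => j /cj.
have lt' : F i (unnudge z) < total (unnudge z) by rewrite Fi tn; lra.
have [_ Fj] := tight_far Sn (or_introl (ex_intro _ i ea)) lt'.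
have [k1 _ _ _] := (surfaceE (unnudge z)).1 Sn.
split.
- split=> // j; rewrite tropical_gap; have [<-|ij] := eqVneq i j.
    rewrite Fi ci; have := far_ge2 z ij'; have := far_ge2 z ik'.
    have := h1 i; have := z0 i; have := totalE z ij' ki' kj'.
    by split; lra.
  by rewrite Fj// subr_ge0 (cj j)// -(cj j)//; split; [apply: k1|rewrite cj].
- apply: co_ext => j; rewrite co_nudge.
  have [<-|ij] := eqVneq i j; first by rewrite Fi ci tn; lra.
  by rewrite Fj// subrr addr0 cj.
- move=> j g; rewrite tropical_gap; have [ij|ij] := eqVneq i j.
    by rewrite -ij Fi ci; move: g; rewrite -ij; lra.
  by have := far_ge2 z ij; lra.
Qed.

Lemma total_continuous : continuous (@total R).
Proof. by move=> x; rewrite /total /=; cts. Qed.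

Lemma nudge_continuous : continuous nudge.
Proof.
move=> x; rewrite /nudge /=.
have c i := @continuous_far R a d i x; have ct := total_continuous (x := x).
have c0 := c ord0; have c1 := c (@Ordinal 3 1 isT); have c2 := c ord_max.
by cts.
Qed.

Lemma unnudge_continuous : continuous unnudge.
Proof.
move=> x; rewrite /unnudge /=.
have c i := @continuous_far R a d i x; have ct := total_continuous (x := x).
have c0 := c ord0; have c1 := c (@Ordinal 3 1 isT); have c2 := c ord_max.
by cts.
Qed.

(** * Density of the tiled set *)

Section Dense.
Variable m : R.
Hypotheses (m0 : 0 < m) (am : m = d \/ exists i, m = co i a).

Let kappa0 : 0 < m / 4.
Proof. by rewrite divr_gt0. Qed.

Let sys := tropical_system a0 d0.
Let ge0 i x (Sx : S x) := tropical_coord_ge0 i Sx.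
Let drp i j k x := tropical_drop a0 d0 (i := i) (j := j) (k := k) (x := x).
Let thn i j k x Sx ij ki kj xk (_ : 0 <= G i x) (_ : 0 <= G j x) :=
  tropical_thin a0 d0 (i := i) (j := j) (k := k) (x := x) am Sx ij ki kj xk.

(* Pushes the point (p, p, 0) of a cusp to (p + e, p, e). *)
Definition push (j : 'I_3) x (e : R) : R * R * R :=
  (x.1.1 + (if val j == 0 then 0 else e), x.1.2 + (if val j == 1 then 0 else e),
   x.2 + (if val j == 2 then 0 else e)).

Lemma co_push i j x e : co i (push j x e) = co i x + (if j == i then 0 else e).
Proof. by rewrite /co /push; case: i j => [[|[|[|i]]] hi] [[|[|[|j]]] hj]. Qed.

Lemma push_surface i j k x e : i != j -> k != i -> k != j -> S x -> co k x = 0 ->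
  0 <= e -> S (push j x e).
Proof.
move=> ij ki kj /(surfaceP a d x ij ki kj)[[h1 h2 h3] [[h4 h5 h6 h7] _]] x0 e0.
apply/(surfaceP a d _ ij ki kj); rewrite !co_push eqxx.
rewrite [j == i]eq_sym (negbTE ij) [j == k]eq_sym (negbTE kj) x0 in h1 h2 h3 h4 h5 h6 h7 *.
by split; [split; lra|split; [split; lra|left; lra]].
Qed.

Lemma cusp_limit k x N : S x -> co k x = 0 -> nbhs x N ->
  exists z, [/\ S z, N z & tiled S s (@co R) z].
Proof.
move=> Sx xk Nx; have [i [j [ki jk ji]]] := other_indices k.
have ij : i != j by rewrite eq_sym.
have kj : k != j by rewrite eq_sym.
have cp : continuous_at 0 (push j x).
  have ci : continuous_at (0 : R) (fun e => e) by apply: cvg_id.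
  rewrite /push; case: (val j == 0); case: (val j == 1); case: (val j == 2) => /=;
    by cts.
have p0 : push j x 0 = x.
  by apply: co_ext => l; rewrite co_push; case: ifP; rewrite addr0.
have : \forall e \near (0 : R), N (push j x e).
  by apply: (cp N); rewrite p0.
move=> /nbhs_ballP[r /= r0 Hr].
(* Halving makes both bounds strict: [e < r] keeps the pushed point in [N], and [e < m / 4] puts it
   in the range of [thin_tiled]. *)
pose e := Num.min r (m / 4) / 2.
have e0 : 0 < e by rewrite divr_gt0// lt_min r0 kappa0.
have er : e < r.
  have : Num.min r (m / 4) <= r by rewrite ge_min lexx.
  by rewrite /e; move: (Num.min _ _) r0 => u; lra.
have em : e < m / 4.
  have : Num.min r (m / 4) <= m / 4 by rewrite ge_min lexx orbT.
  by rewrite /e; move: (Num.min _ _) kappa0 => u; lra.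
have Sp : S (push j x e) by apply: (push_surface ij ki kj) => //; apply: ltW.
exists (push j x e); split=> //.
  by apply: Hr; rewrite -ball_normE /= sub0r normrN gtr0_norm.
have ek : 0 < co k (push j x e) < m / 4 by rewrite co_push (negbTE jk) xk add0r e0.
by split=> //; apply: (thin_tiled sys ge0 drp thn Sp ek).
Qed.

Lemma tiled_limit x N : S x -> nbhs x N -> exists z, [/\ S z, N z & tiled S s (@co R) z].
Proof.
move=> Sx Nx.
have [[w Dw]|[w [k yk]]] := descent sys kappa0 ge0 drp thn Sx.
  by exists x; split=> //; [exact: nbhs_singleton|split=> //; exists w].
have sK := mirrorK sys.
have N' : nbhs (wact s w x) (wact s (rev w) @^-1` N).
  by apply: (wact_continuous sys); rewrite /= wact_revK.
have [z [Sz Nz Uz]] := cusp_limit (wact_stable sys w Sx) yk N'.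
exists (wact s (rev w) z); split=> //; first exact: (wact_stable sys).
exact: (tiled_wact sys).
Qed.

End Dense.
End Core.

(** * The Lorentz form in triangle coordinates *)

Section Quadratic.
Variable R : realType.
Implicit Types f z : R * R * R.

(** Expanded, [2 (p q + p r + q r) - p ^ 2 - q ^ 2 - r ^ 2]. It is minus the Lorentz form in the
    coordinates [horo3], see [lorentz_quad], so its level 1 contains the image of the
    hyperboloid. *)
Definition quad f : R := total f ^+ 2 - 2 * (f.1.1 ^+ 2 + f.1.2 ^+ 2 + f.2 ^+ 2).

Lemma quadE i j k f : i != j -> k != i -> k != j ->
  quad f = co k f ^+ 2 - (co i f - co j f) ^+ 2 + 2 * co k f * (co i f + co j f - co k f).
Proof.
case: i j k => [[|[|[|i]]] hi] [[|[|[|j]]] hj] [[|[|[|k]]] hk] //= _ _ _;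
  by rewrite /quad /total /co /=; ring.
Qed.

(** [quad] is the sum of the pairwise products of [p + q - r], [p + r - q] and [q + r - p]. These
    are nonnegative, and any two of them add up to twice a coordinate, so at least two are
    positive. *)
Lemma quad_gt0 f : (forall i, 0 < co i f) -> (forall i, 2 * co i f <= total f) -> 0 < quad f.
Proof.
move=> f0 H; move: f0 H => /[dup] /(_ ord0) + /[dup] /(_ (@Ordinal 3 1 isT)) + /(_ ord_max) +.
move=> + + + /[dup] /(_ ord0) + /[dup] /(_ (@Ordinal 3 1 isT)) + /(_ ord_max) +.
rewrite /quad /co /total /=; case: f => [[p q] r] /= p0 q0 r0 h1 h2 h3.
have e : (p + q + r) ^+ 2 - 2 * (p ^+ 2 + q ^+ 2 + r ^+ 2) =
  (p + q - r) * (p + r - q) + (p + q - r) * (q + r - p) + (p + r - q) * (q + r - p) by ring.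
rewrite e.
have [hp hq hr] : [/\ 0 <= q + r - p, 0 <= p + r - q & 0 <= p + q - r] by split; lra.
have a1 : 0 <= (p + q - r) * (p + r - q) by rewrite mulr_ge0.
have a2 : 0 <= (p + q - r) * (q + r - p) by rewrite mulr_ge0.
have a3 : 0 <= (p + r - q) * (q + r - p) by rewrite mulr_ge0.
have [r1|r1] := ltP 0 (p + q - r).
  have [q1|q1] := ltP 0 (p + r - q).
    by have := mulr_gt0 r1 q1; lra.
  have p1 : 0 < q + r - p by lra.
  by have := mulr_gt0 r1 p1; lra.
have p1 : 0 < q + r - p by lra.
have q1 : 0 < p + r - q by lra.
by have := mulr_gt0 q1 p1; lra.
Qed.

Definition dil (t : R) f : R * R * R := (t * f.1.1, t * f.1.2, t * f.2).

Lemma co_dil i t f : co i (dil t f) = t * co i f.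
Proof. by rewrite /co /dil; case: i => [[|[|[|i]]] hi]. Qed.

Lemma total_dil t f : total (dil t f) = t * total f.
Proof. by rewrite /total /dil /=; ring. Qed.

Lemma quad_dil t f : quad (dil t f) = t ^+ 2 * quad f.
Proof. by rewrite /quad /total /dil /=; ring. Qed.

Lemma dilK t f : t != 0 -> dil t (dil t^-1 f) = f.
Proof. by move=> t0; apply: co_ext => i; rewrite !co_dil mulVKf. Qed.

Lemma dilVK t f : t != 0 -> dil t^-1 (dil t f) = f.
Proof. by move=> t0; apply: co_ext => i; rewrite !co_dil mulKf. Qed.

Lemma quad_continuous : continuous quad.
Proof.
have -> : quad = fun f => (f.1.1 + f.1.2 + f.2) * (f.1.1 + f.1.2 + f.2)
    - 2 * (f.1.1 * f.1.1 + f.1.2 * f.1.2 + f.2 * f.2).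
  by apply/funext => f; rewrite /quad /total !expr2.
by move=> x /=; cts.
Qed.

Definition normalize z : R * R * R := dil (Num.sqrt (quad z))^-1 z.

Lemma quad_normalize z : 0 < quad z -> quad (normalize z) = 1.
Proof.
by move=> q0; rewrite quad_dil exprVn sqr_sqrtr ?ltW// mulVf// gt_eqF.
Qed.

Lemma normalize_continuous z : 0 < quad z -> continuous_at z normalize.
Proof.
move=> q0; have c : continuous_at z (fun x => Num.sqrt (quad x)).
  by apply: (continuous_comp (quad_continuous (x := z))); apply: sqrt_continuous.
rewrite /normalize /dil; cts => //; by rewrite gt_eqF// sqrtr_gt0.
Qed.

End Quadratic.

(** * Central projection onto the polyhedron *)

Section Dilation.
Variables (R : realType) (a : R * R * R) (d : R).
Hypotheses (a0 : forall i, 0 <= co i a) (d0 : 0 <= d).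
Implicit Types f z : R * R * R.

(* The ray through f exits the polyhedron at radius t. *)
Definition exit_radius f (t : R) : Prop :=
  [/\ forall i, co i a <= t * (total f - co i f), d <= t * total f &
   (exists i, co i a = t * (total f - co i f)) \/ d = t * total f].

Definition radius f : R :=
  Num.max (Num.max (a.1.1 / (total f - f.1.1)) (a.1.2 / (total f - f.1.2)))
    (Num.max (a.2 / (total f - f.2)) (d / total f)).

Lemma gt0_total f : (forall i, 0 < co i f) -> 0 < total f /\ forall i, 0 < total f - co i f.
Proof.
move=> f0; suff H i : 0 < total f - co i f.
  by split=> //; have := H ord0; have := f0 ord0; lra.
have [j [k [ij ki kj]]] := other_indices i.
by rewrite (totalE f ij ki kj); have := f0 j; have := f0 k; lra.
Qed.

Lemma radiusP f : (forall i, 0 < co i f) -> exit_radius f (radius f).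
Proof.
move=> /gt0_total[t0 H]; have h0 := H ord0; have h1 := H (@Ordinal 3 1 isT).
have h2 := H ord_max; rewrite /co /= in h0 h1 h2; split.
- case=> [[|[|[|i]]] hi] //; rewrite /co /= -ler_pdivrMr// /radius !le_max lexx ?orbT//.
- by rewrite -ler_pdivrMr// /radius !le_max lexx ?orbT.
have : [\/ radius f = a.1.1 / (total f - f.1.1), radius f = a.1.2 / (total f - f.1.2),
    radius f = a.2 / (total f - f.2) | radius f = d / total f].
  have mo (x y : R) : Num.max x y = x \/ Num.max x y = y.
    by rewrite /Order.max; case: ifP => _; [right|left].
  rewrite /radius; set A := _ / _; set B := _ / _; set C := _ / _; set E := _ / _.
  have [->|->] := mo (Num.max A B) (Num.max C E).
    by have [->|->] := mo A B; [constructor 1|constructor 2].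
  by have [->|->] := mo C E; [constructor 3|constructor 4].
case=> ->; [left; exists ord0|left; exists (@Ordinal 3 1 isT)|left; exists ord_max|right];
  by rewrite /co /= divfK// gt_eqF.
Qed.

Lemma exit_radius_uniq f t t' : (forall i, 0 < co i f) ->
  exit_radius f t -> exit_radius f t' -> t = t'.
Proof.
move=> /gt0_total[f0 fi].
suff le u u' : exit_radius f u -> exit_radius f u' -> u <= u'.
  by move=> H H'; apply/eqP; rewrite eq_le !le.
move=> [_ _ H] [h1 h2 _]; case: H => [[i e]|e].
  by rewrite -(ler_pM2r (fi i)) -e.
by rewrite -(ler_pM2r f0) -e.
Qed.

Lemma exit_core f t : (forall i, 0 < co i f) -> (forall i, 2 * co i f <= total f) ->
  0 < t -> exit_radius f t -> core a d (dil t f).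
Proof.
move=> f0 fi t0 [h1 h2 H].
have T : tight a d (dil t f).
  case: H => [[i e]|e]; [left; exists i|right]; rewrite total_dil// co_dil e; ring.
split=> // [|i]; last by rewrite co_dil mulr_gt0.
apply/surfaceE; split=> // [i|i||]; rewrite ?total_dil ?co_dil//.
- by have := fi i; rewrite -(ler_pM2l t0) mulrCA.
- by have := h1 i; lra.
- by right.
Qed.

Lemma core_exit f t : 0 < t -> core a d (dil t f) -> exit_radius f t.
Proof.
move=> t0 [/(surfaceE a d)[_ h2 h3 _] T _]; split.
- by move=> i; have := h2 i; rewrite total_dil co_dil; lra.
- by rewrite -total_dil.
- case: T => [[i e]|e]; [left; exists i|right].
    by move: e; rewrite total_dil co_dil; lra.
  by rewrite e total_dil.
Qed.

Lemma radius_continuous f : (forall i, 0 < co i f) -> continuous_at f radius.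
Proof.
move=> /gt0_total[t0 H]; have h0 := H ord0; have h1 := H (@Ordinal 3 1 isT).
have h2 := H ord_max; rewrite /co /= in h0 h1 h2.
have ct := total_continuous (x := f); rewrite /radius; cts => //=; by rewrite gt_eqF.
Qed.

Variable m : R.
Hypotheses (m0 : 0 < m) (am : m = d \/ exists i, m = co i a).

(** A positive parameter enters here: if all parameters vanished, the exit radius would be 0 and the
    projection would collapse to the origin. *)
Lemma exit_radius_gt0 f t : (forall i, 0 < co i f) -> exit_radius f t -> 0 < t.
Proof.
move=> /gt0_total[t0 H] [h1 h2 _]; case: am m0 => [->|[i ->]] h.
  by rewrite -(pmulr_lgt0 _ t0); apply: lt_le_trans h2.
by rewrite -(pmulr_lgt0 _ (H i)); apply: lt_le_trans (h1 i).
Qed.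

End Dilation.

(** * The hyperbolic mirror system *)

Section Hyperboloid.
Variables (R : realType) (T : ideal_triangle R).
Implicit Types (p q u : R * R * R).

Let G i j := lorentz (T i) (T j).

Lemma vertex_lorentz_lt0 i j : i != j -> G i j < 0.
Proof.
move=> ij; apply: ideal_point_lt0; [exact: vertex_ideal..|].
by move/vertex_inj/eqP; apply/negP.
Qed.

Lemma vertex_lorentz0 i : G i i = 0.
Proof. by case: (vertex_ideal T i). Qed.

(** With [g = - G], multiplying two of the equations [k i * k j * g i j = 2] and dividing by the
    third gives [k i ^+ 2 = 2 * g j l / (g i j * g i l)]. *)
Lemma normalized_vertices : exists k : 'I_3 -> R, (forall i, 0 < k i) /\
  forall i j, i != j -> k i * k j * G i j = -2.
Proof.
pose g i j := - G i j; have gC i j : g i j = g j i by rewrite /g /G lorentzC.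
have g0 i j : i != j -> 0 < g i j by rewrite oppr_gt0; apply: vertex_lorentz_lt0.
pose k i := Num.sqrt (2 * g (i + 1) (i + 2) / (g i (i + 1) * g i (i + 2))).
have nx (i : 'I_3) : [/\ i != i + 1, i != i + 2 & i + 1 != i + 2].
  by case: i => [[|[|[|i]]] hi].
have arg0 i : 0 < 2 * g (i + 1) (i + 2) / (g i (i + 1) * g i (i + 2)).
  by have [? ? ?] := nx i; rewrite divr_gt0 ?mulr_gt0 ?g0.
exists k; split=> [i|i j ij]; first by rewrite sqrtr_gt0.
suff H l : k l * k (l + 1) * G l (l + 1) = -2.
  have : j = i + 1 \/ i = j + 1.
    by move: ij; case: i j => [[|[|[|i]]] hi] [[|[|[|j]]] hj] //= _;
      try (left; apply/val_inj; reflexivity); right; apply/val_inj.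
  by case=> ->; rewrite ?H// [k _ * _]mulrC /G lorentzC -/(G _ _) H.
have e1 : l + 1 + 1 = l + 2 by rewrite -addrA; congr (_ + _); apply/val_inj.
have e2 : l + 1 + 2 = l by rewrite -addrA -[RHS]addr0; congr (_ + _); apply/val_inj.
have [n1 n2 n3] := nx l; have h1 := g0 _ _ n1; have h2 := g0 _ _ n2; have h3 := g0 _ _ n3.
rewrite /k -sqrtrM ?(ltW (arg0 l))// e1 e2 (gC (l + 2) l) (gC (l + 1) l).
rewrite -[G l (l + 1)]opprK -/(g l (l + 1)).
set x := g l (l + 1) in h1 *; set y := g l (l + 2) in h2 *; set z := g (l + 1) (l + 2) in h3 *.
have -> : 2 * z / (x * y) * (2 * y / (z * x)) = (2 / x) ^+ 2 by field; rewrite !gt_eqF.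
by rewrite sqrtr_sqr ger0_norm ?divr_ge0 ?(ltW h1)//; field; rewrite gt_eqF.
Qed.

Lemma lorentz_nondegenerate q : (forall i, lorentz q (T i) = 0) -> q = 0.
Proof.
have n01 : (ord0 : 'I_3) != @Ordinal 3 1 isT by [].
have n02 : (ord0 : 'I_3) != ord_max by [].
have n12 : @Ordinal 3 1 isT != ord_max by [].
have := vertex_lorentz_lt0 n01; have := vertex_lorentz_lt0 n02.
have := vertex_lorentz_lt0 n12.
have := vertex_ideal T ord0; have := vertex_ideal T (@Ordinal 3 1 isT).
have := vertex_ideal T ord_max.
move=> v2 v1 v0 g12 g02 g01 H.
have := H ord0; have := H (@Ordinal 3 1 isT); have := H ord_max.
move: v0 v1 v2 g12 g02 g01; rewrite /G /ideal_point /lorentz.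
case: (T ord0) (T (@Ordinal 3 1 isT)) (T ord_max) q {H} =>
  [[x0 y0] z0] [[x1 y1] z1] [[x2 y2] z2] [[p q] r] /=.
move=> [e0 ez0] [e1 ez1] [e2 ez2]; subst z0 z1 z2; rewrite !mulr1 in e0 e1 e2 *.
move=> g12 g02 g01 h2 h1 h0.
(* The determinant of the three vertices at height 1. Its square is minus their Gram determinant,
   which for isotropic vectors is twice the product of the three negative Lorentz products. *)
pose D := (x1 - x0) * (y2 - y0) - (x2 - x0) * (y1 - y0).
have D0 : D != 0.
  rewrite -sqrf_eq0.
  have -> : D ^+ 2 = - (2 * (x0 * x1 + y0 * y1 - 1) * (x0 * x2 + y0 * y2 - 1)
      * (x1 * x2 + y1 * y2 - 1)
    + (x0 * x0 + y0 * y0 - 1) * (x1 * x1 + y1 * y1 - 1) * (x2 * x2 + y2 * y2 - 1)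
    - (x0 * x0 + y0 * y0 - 1) * (x1 * x2 + y1 * y2 - 1) ^+ 2
    - (x1 * x1 + y1 * y1 - 1) * (x0 * x2 + y0 * y2 - 1) ^+ 2
    - (x2 * x2 + y2 * y2 - 1) * (x0 * x1 + y0 * y1 - 1) ^+ 2) by rewrite /D; ring.
  by rewrite e0 e1 e2 !mul0r !subr0 addr0 oppr_eq0 !mulf_neq0 ?pnatr_eq0 ?ltr0_neq0.
have p0 : p * D = 0.
  have -> : p * D = (y2 - y0) * ((p * x1 + q * y1 - r) - (p * x0 + q * y0 - r))
    - (y1 - y0) * ((p * x2 + q * y2 - r) - (p * x0 + q * y0 - r)) by rewrite /D; ring.
  by rewrite h0 h1 h2 subrr !mulr0 subr0.
have q0 : q * D = 0.
  have -> : q * D = (x1 - x0) * ((p * x2 + q * y2 - r) - (p * x0 + q * y0 - r))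
    - (x2 - x0) * ((p * x1 + q * y1 - r) - (p * x0 + q * y0 - r)) by rewrite /D; ring.
  by rewrite h0 h1 h2 subrr !mulr0 subr0.
move/eqP: p0; rewrite mulf_eq0 (negbTE D0) orbF => /eqP p0.
move/eqP: q0; rewrite mulf_eq0 (negbTE D0) orbF => /eqP q0.
by move: h0; rewrite p0 q0 !mul0r !add0r => /eqP; rewrite oppr_eq0 => /eqP ->.
Qed.

Variable k : 'I_3 -> R.
Hypotheses (k0 : forall i, 0 < k i) (kG : forall i j, i != j -> k i * k j * G i j = -2).

(** On the hyperbolic plane this is, up to scale, the exponential of the signed distance to a
    horocycle centred at vertex [i]. *)
Definition horo (i : 'I_3) p : R := - (k i * lorentz p (T i)) / 2.

Definition horo3 p : R * R * R := (horo ord0 p, horo (@Ordinal 3 1 isT) p, horo ord_max p).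

Lemma co_horo3 i p : co i (horo3 p) = horo i p.
Proof.
rewrite /co /horo3; case: i => [[|[|[|i]]] hi] //=; congr horo; exact/val_inj.
Qed.

(** [horo i] kills [T i] and equals 1 on the other vectors [k j *: T j]. A combination with
    coefficients [c] thus has [i]-th coordinate the sum of the other two [c j], which is solved by
    [c i = total f / 2 - co i f]. *)
Definition of_horo (f : R * R * R) : R * R * R :=
  ((total f / 2 - f.1.1) * k ord0) *: T ord0 +
  ((total f / 2 - f.1.2) * k (@Ordinal 3 1 isT)) *: T (@Ordinal 3 1 isT) +
  ((total f / 2 - f.2) * k ord_max) *: T ord_max.

Lemma horo_of_horo i f : horo i (of_horo f) = co i f.
Proof.
have aux b c x y z g h : x * y * g = -2 -> x * z * h = -2 ->
    - (x * (b * y * g + c * z * h)) / 2 = b + c :> R.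
  move=> e1 e2; have -> : x * (b * y * g + c * z * h) = b * (x * y * g) + c * (x * z * h).
    by ring.
  by rewrite e1 e2; field.
have gC a b : G a b = G b a by rewrite /G lorentzC.
rewrite /horo /of_horo !lorentzDl !lorentzZl -!/(G _ _) /co.
case: i => [[|[|[|i]]] hi] //=.
- rewrite (_ : Ordinal hi = ord0); last exact/val_inj.
  by rewrite vertex_lorentz0 mulr0 add0r !(gC _ ord0) aux ?kG// /total; field.
- rewrite (_ : Ordinal hi = @Ordinal 3 1 isT); last exact/val_inj.
  by rewrite vertex_lorentz0 mulr0 addr0 (gC ord0) (gC ord_max) aux ?kG// /total; field.
- rewrite (_ : Ordinal hi = ord_max); last exact/val_inj.
  by rewrite vertex_lorentz0 mulr0 addr0 !(gC _ ord_max) aux ?kG// /total; field.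
Qed.

Lemma horo3_of_horo f : horo3 (of_horo f) = f.
Proof. by apply: co_ext => i; rewrite co_horo3 horo_of_horo. Qed.

Lemma of_horoK p : of_horo (horo3 p) = p.
Proof.
apply/eqP; rewrite -subr_eq0; apply/eqP/lorentz_nondegenerate => i.
have e := horo_of_horo i (horo3 p); rewrite co_horo3 /horo in e.
rewrite lorentzDl lorentzNl; apply/eqP; rewrite subr_eq0; apply/eqP.
by apply: (mulfI (lt0r_neq0 (k0 i))); lra.
Qed.

Lemma lorentz_quad p : lorentz p p = - quad (horo3 p).
Proof.
rewrite -{1}[p]of_horoK {1}/of_horo !lorentzDl !lorentzZl !(lorentzC _ p).
have e i : k i * lorentz p (T i) = - (2 * horo i p) by rewrite /horo; field.
by rewrite -!mulrA !e /quad /total /horo3 /=; field.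
Qed.

Local Notation s := (fun (i : 'I_3) => reflection (T (i + 1)) (T (i + 2))).
Local Notation H := (@hyperbolic_plane R).

Lemma next_indices (i : 'I_3) : [/\ i != i + 1, i + 2 != i & i + 2 != i + 1].
Proof. by case: i => [[|[|[|i]]] hi]. Qed.

Lemma vertexN (i j : 'I_3) : i != j -> T i <> T j.
Proof. by move=> ij /vertex_inj/eqP; apply/negP. Qed.

Lemma horo_reflection i j l p : i != j -> l != i -> l != j ->
  [/\ horo i (reflection (T j) (T l) p) = 2 * (horo j p + horo l p) - horo i p,
      horo j (reflection (T j) (T l) p) = horo j p &
      horo l (reflection (T j) (T l) p) = horo l p].
Proof.
move=> ij li lj; have jl : j != l by rewrite eq_sym.
have [e1 e2] := lorentz_reflection p (vertex_ideal T j) (vertex_ideal T l) (vertexN jl).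
split; rewrite /horo ?e1 ?e2// /reflection !(lorentzDl, lorentzZl, lorentzNl) -!/(G _ _).
have g0 := ltr0_neq0 (vertex_lorentz_lt0 jl).
have gji : k i * G j i = k l * G j l.
  apply: (mulfI (lt0r_neq0 (k0 j))); rewrite !mulrA (kG jl).
  by rewrite kG// eq_sym.
have gli : k i * G l i = k j * G j l.
  apply: (mulfI (lt0r_neq0 (k0 l))); rewrite !mulrA [k l * k j]mulrC (kG jl).
  by rewrite kG// eq_sym.
have -> : k i * (2 * (lorentz p (T l) / G j l * G j i + lorentz p (T j) / G j l * G l i)
    - lorentz p (T i)) = 2 * (lorentz p (T l) / G j l * (k i * G j i)
    + lorentz p (T j) / G j l * (k i * G l i)) - k i * lorentz p (T i) by ring.
by rewrite gji gli; field.
Qed.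

Lemma horo_mirror i p : horo i (s i p) = 2 * total (horo3 p) - 3 * horo i p.
Proof.
have [n1 n2 n3] := next_indices i; have [-> _ _] := horo_reflection p n1 n2 n3.
by rewrite (totalE _ n1 n2 n3) !co_horo3; ring.
Qed.

Lemma horo_mirrorN i j p : i != j -> horo j (s i p) = horo j p.
Proof.
move=> ij; have [n1 n2 n3] := next_indices i.
have [_ e1 e2] := horo_reflection p n1 n2 n3.
have [->//|j1] := eqVneq j (i + 1).
have ji : j != i by rewrite eq_sym.
by rewrite (third_index_uniq n1 n3 n2 j1 ji).
Qed.

Lemma hyper_gap i p : gap s horo i p = 2 * (total (horo3 p) - 2 * horo i p).
Proof. by rewrite /gap horo_mirror; ring. Qed.

Lemma horo_gt0 i p : H p -> 0 < horo i p.
Proof.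
move=> Hp; have := ideal_hyperbolic_lt0 (vertex_ideal T i) Hp => h.
by rewrite /horo divr_gt0// oppr_gt0 pmulr_rlt0.
Qed.

Lemma continuous_lorentz u : continuous (fun p => lorentz p u).
Proof. by move=> x; rewrite /lorentz /=; cts. Qed.

Lemma continuous_horo i : continuous (horo i).
Proof.
move=> x; rewrite /horo; have c := continuous_lorentz (u := T i) (x := x); cts.
Qed.

Lemma continuous_horo3 : continuous horo3.
Proof.
by move=> x; rewrite /horo3; apply: continuous_triple; apply: continuous_horo.
Qed.

Lemma continuous_of_horo : continuous of_horo.
Proof.
have -> : of_horo = fun f =>
  let c0 := (total f / 2 - f.1.1) * k ord0 in
  let c1 := (total f / 2 - f.1.2) * k (@Ordinal 3 1 isT) in
  let c2 := (total f / 2 - f.2) * k ord_max in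
  (c0 * (T ord0).1.1 + c1 * (T (@Ordinal 3 1 isT)).1.1 + c2 * (T ord_max).1.1,
   c0 * (T ord0).1.2 + c1 * (T (@Ordinal 3 1 isT)).1.2 + c2 * (T ord_max).1.2,
   c0 * (T ord0).2 + c1 * (T (@Ordinal 3 1 isT)).2 + c2 * (T ord_max).2).
  by apply/funext => f.
by move=> x /=; rewrite /total; cts.
Qed.

Lemma continuous_reflection u w : continuous (reflection u w).
Proof.
have -> : reflection u w = fun x =>
  let c0 := lorentz x w / lorentz u w in let c1 := lorentz x u / lorentz u w in
  (2 * (c0 * u.1.1 + c1 * w.1.1) - x.1.1, 2 * (c0 * u.1.2 + c1 * w.1.2) - x.1.2,
   2 * (c0 * u.2 + c1 * w.2) - x.2).
  by apply/funext => -[[? ?] ?].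
by move=> x /=; rewrite /lorentz; cts.
Qed.

Lemma horo_inj p q : (forall i, horo i p = horo i q) -> p = q.
Proof.
move=> e; rewrite -[p]of_horoK -[q]of_horoK; congr of_horo.
by apply: co_ext => i; rewrite !co_horo3.
Qed.

Lemma hyperbolic_system : mirror_system H s horo.
Proof.
have tot i j l p : i != j -> l != i -> l != j ->
  total (horo3 p) = horo i p + horo j p + horo l p.
  by move=> *; rewrite -!co_horo3; apply: totalE.
split.
- move=> i p; apply: reflection_hyperbolic; [exact: vertex_ideal..|exact: vertex_neq].
- by move=> i; apply: reflectionK; [exact: vertex_ideal..|exact: vertex_neq].
- by move=> i; apply: continuous_reflection.
- exact: continuous_horo.
- by move=> i j p ij; apply: horo_mirrorN.
- by move=> p q _ _; apply: horo_inj.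
- move=> i j p Hp ij; have [l [li lj]] := third_index ij.
  rewrite !hyper_gap !(tot i j l)//; have := horo_gt0 l Hp; lra.
- move=> i j l p Hp ij li lj; rewrite !hyper_gap !(tot i j l)//; lra.
Qed.

(** Descent cannot end on a vanishing coordinate, since [horo] is positive on the hyperbolic plane;
    so every orbit meets the ideal triangle. *)
Lemma hyperbolic_tiled p : H p -> tiled H s horo p.
Proof.
have tot i j l q : i != j -> l != i -> l != j ->
  total (horo3 q) = horo i q + horo j q + horo l q.
  by move=> *; rewrite -!co_horo3; apply: totalE.
move=> Hp; split=> //.
have ge0 i q : H q -> 0 <= horo i q by move=> Hq; rewrite ltW// horo_gt0.
have drp i j l q : H q -> i != j -> l != i -> l != j ->
    gap s horo i q < 0 -> gap s horo j (s i q) < 0 ->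
    gap s horo i q + gap s horo j (s i q) <= - horo l q.
  move=> Hq ij li lj; have := horo_gt0 l Hq.
  rewrite !hyper_gap !(tot i j l)// (horo_mirrorN q ij) (@horo_mirrorN i l) 1?eq_sym//.
  by rewrite horo_mirror (tot i j l)//; lra.
(* The threshold 1 comes from [quad = 1]: by [quadE], [z ^+ 2 < 1] forces [2 * z * (x + y - z) > 0],
   and [x + y - z] has the sign of the gap. *)
have thn i j l q : H q -> i != j -> l != i -> l != j -> 0 < horo l q < 1 ->
    0 <= gap s horo i q -> 0 <= gap s horo j q ->
    [/\ 0 <= gap s horo l q, 0 < horo i q & 0 < horo j q].
  move=> Hq ij li lj /andP[l0 l1]; rewrite !hyper_gap !(tot i j l)// => gi gj.
  split; [|exact: horo_gt0..].
  have : quad (horo3 q) = 1 by case: Hq => [+ _]; rewrite lorentz_quad => /oppr_inj.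
  rewrite (quadE _ ij li lj) !co_horo3.
  move: (horo i q) (horo j q) (horo l q) l0 l1 {gi gj} => x y z z0 z1 e.
  have : 0 < 2 * z * (x + y - z).
    have : z ^+ 2 < 1 by rewrite expr_lt1// ltW.
    by have := sqr_ge0 (x - y); lra.
  by rewrite pmulr_rgt0 ?mulr_gt0//; lra.
have [//|[w [l e]]] := descent hyperbolic_system ltr01 ge0 drp thn Hp.
have := horo_gt0 l (wact_stable hyperbolic_system w Hp).
by rewrite e ltxx.
Qed.

End Hyperboloid.

(** * The conjugation of chambers *)

Section Conjugation.
Variables (R : realType) (a : R * R * R) (d m : R).
Hypotheses (a0 : forall i, 0 <= co i a) (d0 : 0 <= d).
Hypotheses (m0 : 0 < m) (am : m = d \/ exists i, m = co i a).
Variables (T : ideal_triangle R) (k : 'I_3 -> R).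
Hypotheses (k0 : forall i, 0 < k i).
Hypothesis (kG : forall i j, i != j -> k i * k j * lorentz (T i) (T j) = -2).

Local Notation S := (tropical_surface a d).
Local Notation s := (tropical_mirror a d).
Local Notation H := (@hyperbolic_plane R).
Local Notation s' := (fun (i : 'I_3) => reflection (T (i + 1)) (T (i + 2))).
Local Notation y' := (horo T k).
Local Notation D := (chamber S s (@co R)).
Local Notation D' := (chamber H s' y').

(** [nudge] takes the mirrors to the homogeneous conditions [2 * co i = total]. They survive
    normalization and are the sides of the ideal triangle by [hyper_gap]. *)
Definition to_hyper x := of_horo T k (normalize (nudge a d x)).
Definition of_hyper p := unnudge a d (dil (radius a d (horo3 T k p)) (horo3 T k p)).

Lemma of_horo_hyperbolic f : (forall i, 0 < co i f) -> (forall i, 2 * co i f <= total f) ->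
  quad f = 1 -> H (of_horo T k f).
Proof.
move=> f0 fi qf; split; first by rewrite (lorentz_quad k0 kG) (horo3_of_horo kG) qf.
have Tz i : (T i).2 = 1 by case: (vertex_ideal T i).
have -> : (of_horo T k f).2 = (total f / 2 - f.1.1) * k ord0 * (T ord0).2 +
    (total f / 2 - f.1.2) * k (@Ordinal 3 1 isT) * (T (@Ordinal 3 1 isT)).2 +
    (total f / 2 - f.2) * k ord_max * (T ord_max).2 by [].
rewrite !Tz !mulr1.
have c0 i (c : R) : 0 <= c -> 0 <= c * k i by move=> ?; rewrite mulr_ge0// ltW.
have := fi ord0; have := fi (@Ordinal 3 1 isT); have := fi ord_max.
have := f0 ord0; have := f0 (@Ordinal 3 1 isT); have := f0 ord_max.
rewrite /co /total /=; case: f {f0 fi qf} => [[p q] r] /= r0 q0 p0 h2 h1 h0.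
have e0 : 0 <= (p + q + r) / 2 - p by lra.
have e1 : 0 <= (p + q + r) / 2 - q by lra.
have e2 : 0 <= (p + q + r) / 2 - r by lra.
(* The first two coefficients add up to [r > 0], so one of them is positive. This selects the upper
   sheet. *)
have [e|e] := ltP 0 ((p + q + r) / 2 - p).
  by rewrite -addrA ltr_wpDr ?addr_ge0 ?c0// mulr_gt0.
by rewrite addrAC ltr_wpDr ?c0// ltr_wpDl ?c0// mulr_gt0//; lra.
Qed.

Lemma core_normalize z : core a d z ->
  [/\ forall i, 0 < co i (normalize z), forall i, 2 * co i (normalize z) <= total (normalize z),
   quad (normalize z) = 1, 0 < Num.sqrt (quad z) &
   forall i, 2 * co i z = total z -> 2 * co i (normalize z) = total (normalize z)].
Proof.
move=> [/(surfaceE a d)[h1 _ _ _] _ z0]; have q0 := quad_gt0 z0 h1.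
have r0 : 0 < Num.sqrt (quad z) by rewrite sqrtr_gt0.
have ri : 0 < (Num.sqrt (quad z))^-1 by rewrite invr_gt0.
split=> // [i|i||i e].
- by rewrite co_dil mulr_gt0.
- by rewrite co_dil total_dil mulrCA ler_pM2l.
- exact: quad_normalize.
- by rewrite co_dil total_dil mulrCA e.
Qed.

Lemma to_hyper_chamber x : D x -> D' (to_hyper x).
Proof.
move=> /(nudge_spec)[/core_normalize[f0 fi qf _ _] _ _].
split=> [|i]; first exact: of_horo_hyperbolic.
rewrite (hyper_gap k0 kG) (horo3_of_horo kG) (horo_of_horo kG).
by split=> //; have := fi i; lra.
Qed.

Lemma to_hyper_gap i x : D x -> gap s (@co R) i x = 0 -> gap s' y' i (to_hyper x) = 0.
Proof.
move=> /(nudge_spec)[/core_normalize[_ _ _ _ fg] _ g] /g/fg e.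
by rewrite (hyper_gap k0 kG) (horo3_of_horo kG) (horo_of_horo kG) e subrr mulr0.
Qed.

Lemma hyper_core p : D' p -> let f := horo3 T k p in
  [/\ core a d (dil (radius a d f) f), 0 < radius a d f, quad f = 1 &
   forall i, gap s' y' i p = 0 -> 2 * co i f = total f].
Proof.
move=> [Hp Dp] f; have f0 i : 0 < co i f by rewrite co_horo3; apply: (Dp i).2.
have fi i : 2 * co i f <= total f.
  by have := (Dp i).1; rewrite (hyper_gap k0 kG) co_horo3 -/f; lra.
have ef := radiusP a d f0; have r0 := exit_radius_gt0 m0 am f0 ef.
split=> // [||i]; first exact: exit_core.
  by case: Hp => + _; rewrite (lorentz_quad k0 kG) => /oppr_inj.
by rewrite (hyper_gap k0 kG) co_horo3 -/f; lra.
Qed.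

Lemma of_hyper_chamber p : D' p -> D (of_hyper p).
Proof. by move=> /hyper_core[/(unnudge_spec)[]]. Qed.

Lemma of_hyper_gap i p : D' p -> gap s' y' i p = 0 -> gap s (@co R) i (of_hyper p) = 0.
Proof.
move=> /hyper_core[/(unnudge_spec)[_ _ g] _ _ g'] /g' e.
by apply: g; rewrite co_dil total_dil mulrCA e.
Qed.

Lemma of_to_hyper x : D x -> of_hyper (to_hyper x) = x.
Proof.
move=> /(nudge_spec)[cz uz _]; have [f0 fi qf r0 _] := core_normalize cz.
rewrite /of_hyper (horo3_of_horo kG).
have e : dil (Num.sqrt (quad (nudge a d x))) (normalize (nudge a d x)) = nudge a d x.
  by rewrite /normalize dilK// gt_eqF.
rewrite -(exit_radius_uniq f0 _ (radiusP a d f0) (t := Num.sqrt (quad (nudge a d x)))).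
  by rewrite e.
by apply: core_exit => //; rewrite e.
Qed.

Lemma to_of_hyper p : D' p -> to_hyper (of_hyper p) = p.
Proof.
move=> /hyper_core[/(unnudge_spec)[_ nu _] r0 q1 _].
rewrite /to_hyper nu /normalize quad_dil q1 mulr1 sqrtr_sqr gtr0_norm//.
by rewrite dilVK ?gt_eqF// (of_horoK k0 kG).
Qed.

Lemma to_hyper_continuous x : D x -> {for x, continuous to_hyper}.
Proof.
move=> Dx; have [[/(surfaceE a d)[h1 _ _ _] _ z0] _ _] := nudge_spec Dx.
have q0 := quad_gt0 z0 h1.
have c1 := nudge_continuous (a := a) (d := d) (x := x).
have c2 := normalize_continuous q0.
have c3 := continuous_of_horo (T := T) (k := k) (x := normalize (nudge a d x)).
exact: (continuous_comp (continuous_comp c1 c2) c3).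
Qed.

Lemma of_hyper_continuous p : D' p -> {for p, continuous of_hyper}.
Proof.
move=> [Hp Dp]; have f0 i : 0 < co i (horo3 T k p) by rewrite co_horo3; apply: (Dp i).2.
pose g (f : R * R * R) := dil (radius a d f) f.
have c1 := continuous_horo3 (T := T) (k := k) (x := p).
have c2 : continuous_at (horo3 T k p) g.
  have c := radius_continuous (a := a) (d := d) f0.
  by rewrite /g /dil; cts.
have c3 := unnudge_continuous (a := a) (d := d) (x := g (horo3 T k p)).
exact: (continuous_comp (continuous_comp c1 c2) c3).
Qed.

Lemma tropical_hyperbolic : exists (h k : R * R * R -> R * R * R),
  [/\ forall x, tiled S s (@co R) x ->
        [/\ H (h x), k (h x) = x, (forall i, h (s i x) = s' i (h x)) &
         h @ within S (nbhs x) --> h x] &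
      forall p, H p ->
        [/\ tiled S s (@co R) (k p), h (k p) = p & k @ within H (nbhs p) --> k p]].
Proof.
have sys := tropical_system a0 d0; have sys' := hyperbolic_system k0 kG.
exists (extend S s (@co R) s' to_hyper), (extend H s' y' s of_hyper).
split=> [x Ux|p Hp].
  split.
  - by have [] := extend_tiled sys sys' to_hyper_chamber to_hyper_gap Ux.
  - exact: (extendK sys sys' to_hyper_chamber of_hyper_chamber to_hyper_gap
      of_hyper_gap of_to_hyper).
  - by move=> i; have := extend_wact sys sys' to_hyper_chamber to_hyper_gap [:: i] Ux.
  - exact: (extend_continuous sys sys' to_hyper_chamber to_hyper_gap to_hyper_continuous).
have Up := hyperbolic_tiled k0 kG Hp.
split.
- exact: (extend_tiled sys' sys of_hyper_chamber of_hyper_gap Up).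
- exact: (extendK sys' sys of_hyper_chamber to_hyper_chamber of_hyper_gap
      to_hyper_gap to_of_hyper).
- exact: (extend_continuous sys' sys of_hyper_chamber of_hyper_gap of_hyper_continuous).
Qed.

End Conjugation.

(** * The skeleton *)

Section Skeleton.
Variable R : realType.
Implicit Types (a b c d : \bar R) (u t : R) (x : R * R * R).

Lemma emin_mem (s : seq (\bar R)) : emin s = +oo%E \/ emin s \in s.
Proof.
rewrite /emin; elim: s => [|e s IH]; first by left; rewrite big_nil.
rewrite big_cons /Order.min; case: ifP => _; first by right; rewrite mem_head.
by case: IH => IH; [left|right; rewrite in_cons IH orbT].
Qed.

Lemma emin_fin (s : seq (\bar R)) u :
  u%:E = emin s <-> all (fun e => (u%:E <= e)%E) s /\ u%:E \in s.
Proof.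
split=> [e|[/allP h us]]; last first.
  apply/eqP; rewrite eq_le [X in _ && X]ge_bigmin_seq// andbT.
  by case: (emin_mem s) => [->|/h//]; rewrite leey.
split; last by case: (emin_mem s) => [E|]; [move: e; rewrite E|rewrite -e].
by apply/allP => f fs; rewrite e /emin ge_bigmin_seq.
Qed.

(* On the skeleton all coordinates are nonpositive, so a parameter >= 0 (possibly
   +oo) never matters and can be replaced by 0. *)
Definition trunc a : R := if a is r%:E then Num.max 0 (- r) else 0.

Lemma trunc_ge0 a : 0 <= trunc a.
Proof. by rewrite /trunc; case: a => [r| |]; rewrite ?le_max lexx. Qed.

Lemma truncP a : a != -oo%E -> (exists2 r, a = r%:E & trunc a = - r /\ r <= 0) \/
  trunc a = 0 /\ (0 <= a)%E.
Proof.
case: a => [r _| |//]; last by right; rewrite leey.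
have [r0|r0] := leP r 0; [left; exists r => //|right]; rewrite /trunc /Order.max.
  by split=> //; case: ifP => // /negbT; rewrite -leNgt oppr_le0 => r0'; lra.
by rewrite lee_fin ltW//; case: ifP => // ; lra.
Qed.

Section Term.
Variables (a : \bar R) (ay : a != -oo%E) (t u : R).

(** For [a >= 0] both inequalities hold, because [u <= 2 * t <= t]. *)
Lemma term_le : t <= 0 -> u <= 2 * t -> (u%:E <= a + t%:E)%E = (trunc a - t <= - u).
Proof.
move=> t0 ut; case: (truncP ay) => [[r -> [-> r0]]|[-> a0]].
  by rewrite -EFinD lee_fin; apply/idP/idP => ?; lra.
have -> : (u%:E <= a + t%:E)%E = true.
  by apply: (@le_trans _ _ t%:E); [rewrite lee_fin; lra|rewrite leeDr].
by apply/esym; lra.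
Qed.

Lemma term_eq : t <= 0 -> u <= 2 * t -> u%:E = (a + t%:E)%E -> trunc a - t = - u.
Proof.
move=> t0 ut; case: (truncP ay) => [[r -> [-> r0]]|[-> a0] e].
  by rewrite -EFinD => -[]; lra.
have : (t%:E <= u%:E)%E by rewrite e leeDr.
by rewrite lee_fin; lra.
Qed.

(** When a parameter [a >= 0] is truncated to 0, the equality can hold although [a + t] differs from
    [u]. Then [u = t], and [u <= 2 * t] with [t <= 0] forces both to be 0, so the doubled term takes
    over. *)
Lemma eq_term : t <= 0 -> u <= 2 * t -> trunc a - t = - u ->
  u%:E = (a + t%:E)%E \/ u = 2 * t.
Proof.
move=> t0 ut; case: (truncP ay) => [[r -> [-> r0]]|[-> a0]] e; [left|right; lra].
by rewrite -EFinD; congr EFin; lra.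
Qed.

Lemma const_le : u <= 0 -> (u%:E <= a)%E = (trunc a <= - u).
Proof.
move=> u0; case: (truncP ay) => [[r -> [-> r0]]|[-> a0]].
  by rewrite lee_fin lerN2.
have -> : (u%:E <= a)%E = true by apply: le_trans a0; rewrite lee_fin.
by apply/esym; lra.
Qed.

Lemma const_eq : u <= 0 -> u%:E = a -> trunc a = - u.
Proof.
move=> u0; case: (truncP ay) => [[r -> [-> r0]] [->]//|[-> a0] e].
by move: a0; rewrite -e lee_fin; lra.
Qed.

Lemma eq_const : u <= 0 -> trunc a = - u -> u%:E = a \/ u = 0.
Proof.
move=> u0; case: (truncP ay) => [[r -> [-> r0]] e|[-> a0] e]; [left|right; lra].
by congr EFin; lra.
Qed.

End Term.

Lemma sk_total (a b c d p q r : R) : sk a b c d p q r <->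
  [/\ 2 * p <= p + q + r, 2 * q <= p + q + r & 2 * r <= p + q + r] /\
  [/\ a + p <= p + q + r, b + q <= p + q + r, c + r <= p + q + r & d <= p + q + r] /\
  (2 * p = p + q + r \/ 2 * q = p + q + r \/ 2 * r = p + q + r \/ a + p = p + q + r \/
   b + q = p + q + r \/ c + r = p + q + r \/ d = p + q + r).
Proof.
have e1 : 2 * p = p + q + r <-> p = q + r by split; lra.
have e2 : 2 * q = p + q + r <-> q = p + r by split; lra.
have e3 : 2 * r = p + q + r <-> r = p + q by split; lra.
have e4 : a + p = p + q + r <-> a = q + r by split; lra.
have e5 : b + q = p + q + r <-> b = p + r by split; lra.
have e6 : c + r = p + q + r <-> c = p + q by split; lra.
rewrite e1 e2 e3 e4 e5 e6 /sk {e1 e2 e3 e4 e5 e6}; split=> -[[? ? ?] [[? ? ? ?] H]].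
  by split; [clear H; split; lra|split; [clear H; split; lra|]].
by split; [clear H; split; lra|split; [clear H; split; lra|]].
Qed.

Definition negt x : R * R * R := (- x.1.1, - x.1.2, - x.2).

Lemma negtK : involutive negt.
Proof. by case=> [[p q] r]; rewrite /negt /= !opprK. Qed.

Lemma negt_continuous : continuous negt.
Proof. by move=> x; rewrite /negt /=; cts. Qed.

Variables (a b c d : \bar R).
Hypotheses (ay : a != -oo%E) (yb : b != -oo%E) (cy : c != -oo%E) (dy : d != -oo%E).

Local Notation ta := (trunc a, trunc b, trunc c).
Local Notation S := (tropical_surface ta (trunc d)).

Lemma skeleton_surface x : skeleton a b c d x <-> S (negt x).
Proof.
case: x => [[x1 x2] x3]; rewrite /skeleton /tropical_surface /negt /= sk_total emin_fin.
rewrite /= !inE andbT !lee_fin; split.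
  move=> [/and4P[h1 h2 h3 /and4P[h4 h5 h6 h7]] K].
  have [? ? ?] : [/\ x1 <= 0, x2 <= 0 & x3 <= 0] by split; lra.
  rewrite term_le // in h4; rewrite term_le // in h5; rewrite term_le // in h6.
  rewrite const_le // in h7; last by lra.
  split; first by split; lra.
  split; first by split; lra.
  case/or4P: K => [/eqP[]e|/eqP[]e|/eqP[]e|/or4P[]/eqP e].
  - by left; lra.
  - by right; left; lra.
  - by do 2!right; left; lra.
  - by do 3!right; left; rewrite (term_eq ay _ _ e)//; lra.
  - by do 4!right; left; rewrite (term_eq yb _ _ e)//; lra.
  - by do 5!right; left; rewrite (term_eq cy _ _ e)//; lra.
  - by do 6!right; rewrite (const_eq dy _ e); lra.
move=> [[h1 h2 h3] [[h4 h5 h6 h7] K]].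
have [x10 x20 x30] : [/\ x1 <= 0, x2 <= 0 & x3 <= 0] by clear K; split; lra.
have [u1 u2 u3] : [/\ x1 + x2 + x3 <= 2 * x1, x1 + x2 + x3 <= 2 * x2
  & x1 + x2 + x3 <= 2 * x3] by clear K; split; lra.
have u0 : x1 + x2 + x3 <= 0 by clear K; lra.
split.
  rewrite !term_le // const_le//.
  by clear K; apply/and4P; split; try lra; apply/and4P; split; lra.
case: K => [|[|[|[|[|[|]]]]]] e.
- by apply/or4P/Or41/eqP; congr EFin; lra.
- by apply/or4P/Or42/eqP; congr EFin; lra.
- by apply/or4P/Or43/eqP; congr EFin; lra.
- have E : trunc a - x1 = - (x1 + x2 + x3) by lra.
  by have [->|->] := eq_term ay x10 u1 E; rewrite ?eqxx ?orbT.
- have E : trunc b - x2 = - (x1 + x2 + x3) by lra.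
  by have [->|->] := eq_term yb x20 u2 E; rewrite ?eqxx ?orbT.
- have E : trunc c - x3 = - (x1 + x2 + x3) by lra.
  by have [->|->] := eq_term cy x30 u3 E; rewrite ?eqxx ?orbT.
- have E : trunc d = - (x1 + x2 + x3) by lra.
  (* In the remaining case three nonpositive coordinates have sum 0, so all vanish and the first
     doubled term attains the minimum. *)
  have [->|e0] := eq_const dy u0 E; first by rewrite eqxx !orbT.
  by apply/or4P/Or41/eqP; congr EFin; lra.
Qed.

Lemma emin5 e f g (q r F : R) : e != -oo%E -> f != -oo%E -> g != -oo%E ->
  q <= 0 -> r <= 0 -> farspec F (trunc e) (trunc f) (trunc g) (- q) (- r) ->
  fine (emin [:: (2 * q)%:E; (2 * r)%:E; e + q%:E; f + r%:E; g])%E = - F.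
Proof.
move=> ye yf yg q0 r0 [[h1 h2 h3 h4 h5] K].
suff <- : (- F)%:E = emin [:: (2 * q)%:E; (2 * r)%:E; e + q%:E; f + r%:E; g]%E by [].
have [Fq Fr] : - F <= 2 * q /\ - F <= 2 * r by clear K; split; lra.
have F0 : - F <= 0 by clear K; lra.
apply/emin_fin; rewrite /= !inE andbT !lee_fin !term_le// const_le// !opprK; split.
  by clear K; apply/and5P; split; lra.
case: K => [|[|[|[|]]]] K.
- by apply/or4P/Or41/eqP; congr EFin; lra.
- have E : trunc e - q = - - F by lra.
  by have [->|->] := eq_term ye q0 Fq E; rewrite ?eqxx ?orbT.
- by apply/or4P/Or42/eqP; congr EFin; lra.
- have E : trunc f - r = - - F by lra.
  by have [->|->] := eq_term yf r0 Fr E; rewrite ?eqxx ?orbT.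
- have E : trunc g = - - F by lra.
  have [->|e0] := eq_const yg F0 E; first by rewrite eqxx !orbT.
  by apply/or4P/Or41/eqP; congr EFin; lra.
Qed.

Lemma trop_vieta_mirror i x : skeleton a b c d x ->
  trop_vieta a b c d i x = negt (tropical_mirror ta (trunc d) i (negt x)).
Proof.
case: x => [[x1 x2] x3] /skeleton_surface[[h1 h2 h3] _].
rewrite /negt /= in h1 h2 h3.
have [? ? ?] : [/\ x1 <= 0, x2 <= 0 & x3 <= 0] by split; lra.
rewrite /trop_vieta /tropical_mirror /far /negt.
case: i => [[|[|i]] hi] /=; rewrite !opprK.
- by rewrite (emin5 _ _ _ _ _ (farvP _ _ _ _ _))//; congr (_, _, _); ring.
- by rewrite (emin5 _ _ _ _ _ (farvP _ _ _ _ _))//; congr (_, _, _); ring.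
- by rewrite (emin5 _ _ _ _ _ (farvP _ _ _ _ _))//; congr (_, _); ring.
Qed.

Lemma emin_lt0_trunc : (emin [:: a; b; c; d] < 0)%E ->
  exists2 m, 0 < m & m = trunc d \/ exists i, m = co i ta.
Proof.
case: (emin_mem [:: a; b; c; d]) => [->//|].
have pos e : e != -oo%E -> (e < 0)%E -> 0 < trunc e.
  move=> ye; case: (truncP ye) => [[r -> [-> _]]|[_]]; first by rewrite lte_fin oppr_gt0.
  by rewrite leNgt => /negbTE ->.
rewrite !inE => /or4P[]/eqP->.
- by move/pos=> /(_ ay) ?; exists (trunc a) => //; right; exists ord0.
- by move/pos=> /(_ yb) ?; exists (trunc b) => //; right; exists (@Ordinal 3 1 isT).
- by move/pos=> /(_ cy) ?; exists (trunc c) => //; right; exists ord_max.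
- by move/pos=> /(_ dy) ?; exists (trunc d) => //; left.
Qed.

Lemma emin_ge0_trunc : (0 <= emin [:: a; b; c; d])%E -> ta = (0, 0, 0) /\ trunc d = 0.
Proof.
move=> h; have tz e : e != -oo%E -> e \in [:: a; b; c; d] -> trunc e = 0.
  move=> ye es; have e0 : (0 <= e)%E.
    by apply: le_trans h _; rewrite /emin ge_bigmin_seq.
  case: (truncP ye) => [[r er [-> r0]]|[//]]; move: e0; rewrite er lee_fin; lra.
by rewrite !tz// !inE eqxx ?orbT.
Qed.

End Skeleton.

(** * The Vieta group is a free product *)

Section VietaFree.
Variables (R : realType) (K : closedFieldType) (v : K -> \bar R).
Hypotheses (hv : valuation v) (hnt : nontrivial_valuation v).
Implicit Types x y z t : K.

Let vM := valuationM hv.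

Lemma valuation_fin x : x != 0 -> exists r : R, v x = r%:E.
Proof.
move=> x0; case: (v x) (valuation_neqNy hv x) (valuation_eqy hv x) => [r|_ [h _]|//].
  by exists r.
by move: x0; rewrite h ?eqxx.
Qed.

Lemma valuation1 : v 1 = 0%E.
Proof.
have [r e] := valuation_fin (oner_neq0 K).
have := vM 1 1; rewrite mulr1 e -EFinD => -[]; move/eqP.
by rewrite -subr_eq0 opprD addrA subrr sub0r oppr_eq0 => /eqP ->.
Qed.

Lemma valuationN x : v (- x) = v x.
Proof.
have n1 : (-1 : K) != 0 by rewrite oppr_eq0 oner_neq0.
have [r e] := valuation_fin n1.
have := vM (-1) (-1); rewrite mulrNN mulr1 valuation1 e -EFinD => -[r0].
by rewrite -mulN1r vM e (_ : r = 0) ?add0e//; lra.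
Qed.

Lemma valuation_ltD x y : (v x < v y)%E -> v (x + y) = v x.
Proof.
move=> xy; apply/eqP; rewrite eq_le; apply/andP; split; last first.
  by have := valuationD hv x y; rewrite minEle (ltW xy).
have := valuationD hv (x + y) (- y); rewrite addrK valuationN ge_min => /orP[//|].
by rewrite leNgt xy.
Qed.

Lemma valuation_leD x y e : (e <= v x)%E -> (e <= v y)%E -> (e <= v (x + y))%E.
Proof. by move=> ex ey; apply: le_trans (valuationD hv x y); rewrite le_min ex. Qed.

Lemma valuationX x n (r : R) : v x = r%:E -> v (x ^+ n) = (n%:R * r)%:E.
Proof.
move=> e; elim: n => [|n IH]; first by rewrite expr0 valuation1 mul0r.
by rewrite exprS vM e IH -EFinD -natr1; congr EFin; ring.
Qed.

Lemma exists_valuation_lt (c : R) : exists t, exists2 r, v t = r%:E & r < c.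
Proof.
have [x [x0 vx]] := hnt.
suff [y [r [e r0]]] : exists y, exists r, v y = r%:E /\ r < 0.
  pose n := (Num.trunc (`|c| / - r)).+1.
  exists (y ^+ n), (n%:R * r); first exact: valuationX.
  have : `|c| < n%:R * - r by rewrite -ltr_pdivrMr ?oppr_gt0// truncnS_gt.
  have : - c <= `|c| by rewrite -normrN ler_norm.
  by lra.
have [r e] := valuation_fin x0; have [r' e'] : exists r, v x^-1 = r%:E.
  by apply: valuation_fin; rewrite invr_eq0.
have := vM x x^-1; rewrite divff// valuation1 e e' -EFinD => -[rr].
have : r != 0 by apply/eqP => r0; move: vx; rewrite e r0 eqxx.
move=> rn; have [r0|r0|r0] := ltgtP r 0; last by rewrite r0 eqxx in rn.
  by exists x, r.
by exists x^-1, r'; split=> //; lra.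
Qed.

Variables A B C D : K.

Let bound : exists c : R, c < 0 /\ forall w, w \in [:: A; B; C; D] -> ((3 * c)%:E <= v w)%E.
Proof.
elim: [:: A; B; C; D] => [|w s [c [c0 IH]]]; first by exists (-1); split=> //; lra.
have [r wr] : exists r : R, (r%:E <= v w)%E.
  by case: (v w) (valuation_neqNy hv w) => [r _| |//]; [exists r|exists 0; rewrite leey].
exists (Num.min c (r / 3)).
have [h1 h2] : Num.min c (r / 3) <= c /\ Num.min c (r / 3) <= r / 3.
  by rewrite !ge_min !lexx orbT.
split; first exact: le_lt_trans c0.
move=> w'; rewrite in_cons => /predU1P[->|/IH]; last first.
  by apply: le_trans; rewrite lee_fin; lra.
by apply: le_trans wr; rewrite lee_fin; lra.
Qed.

Let c := projT1 (cid bound).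
Let c0 : c < 0. Proof. by rewrite /c; case: cid => ? []. Qed.
Let cw w : w \in [:: A; B; C; D] -> ((3 * c)%:E <= v w)%E.
Proof. by rewrite /c; case: cid => ? [? H]; apply: H. Qed.

(** The [i]-th valuation is that of the product of the other two coordinates. For [j != i], [s_j]
    replaces the [j]-th valuation by the sum of the other two. Substituting the relation of
    [dominant i], this is a sum of three values below [c], which is why the parameters are bounded
    by [3 * c]. *)
Definition dominant (i : 'I_3) : set (markov_surface A B C D) :=
  [set X | exists p q r : R,
    [/\ v (val X).1.1 = p%:E, v (val X).1.2 = q%:E & v (val X).2 = r%:E] /\
    [/\ p < c, q < c, r < c &
      match val i with 0 => p = q + r | 1 => q = p + r | _ => r = p + q end]].

Let step x y z w p q r : w \in [:: A; B; C; D] ->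
  v x = p%:E -> v y = q%:E -> v z = r%:E -> q + r < p -> q + r < 3 * c ->
  v (- x - y * z + w) = (q + r)%:E.
Proof.
move=> hw vx vy vz h1 h2; have vyz : v (- (y * z)) = (q + r)%:E.
  by rewrite valuationN vM vy vz.
rewrite addrAC addrC valuation_ltD// vyz.
apply: lt_le_trans (valuation_leD (e := (Num.min p (3 * c))%:E) _ _).
- by rewrite lte_fin lt_min h1.
- by rewrite valuationN vx lee_fin ge_min lexx.
- by apply: le_trans (cw hw); rewrite lee_fin ge_min lexx orbT.
Qed.

Let dominant_step i j X : i != j -> dominant i X -> dominant j (vieta_fun j X).
Proof.
have cc := c0; move=> + [p [q [r [[vx vy vz] [pc qc rc e]]]]]; case: X vx vy vz => -[[x y] z] /= HX.
move=> vx vy vz; case: i j e => [[|[|[|i]]] hi] [[|[|[|j]]] hj] //= e _;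
  rewrite /dominant /=;
  first [ exists (q + r), q, r; split; [split=> //; apply: (step (p := p))
            |split=> //; lra] => //; rewrite ?inE ?eqxx ?orbT//; lra
        | exists p, (p + r), r; split; [split=> //; apply: (step (p := q))
            |split=> //; lra] => //; rewrite ?inE ?eqxx ?orbT//; lra
        | exists p, q, (p + q); split; [split=> //; apply: (step (p := r))
            |split=> //; lra] => //; rewrite ?inE ?eqxx ?orbT//; lra ].
Qed.

Let dominant_disjoint i j X : dominant i X -> dominant j X -> i = j.
Proof.
have cc := c0; move=> [p [q [r [[v1 v2 v3] [? ? ? e]]]]] [p' [q' [r' [[w1 w2 w3] [? ? ? e']]]]].
move: w1 w2 w3; rewrite v1 v2 v3 => -[ep] [eq] [er].
subst p' q' r'; apply/val_inj; move: i j e e'.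
by move=> [[|[|[|i]]] hi] [[|[|[|j]]] hj] //= e e'; exfalso; lra.
Qed.

(** For two coordinates equal to [t], the third is a root of a quadratic. Its roots have a sum of
    valuation [2 * u] and a product of valuation at least [2 * u], with [u < 0]. As on a Newton
    polygon, one root has valuation exactly [2 * u]. *)
Let dominant_nonempty : dominant ord_max !=set0.
Proof.
have cc := c0; have [t [u vt uc]] := exists_valuation_lt (3 * c).
have [z hz] : exists z : K,
    z ^+ 2 + (t ^+ 2 - C) * z + (2 * t ^+ 2 - (A + B) * t - D) = 0.
  have [z e] := solve_monicpoly
    (fun i : nat => if i == 0%N then - (2 * t ^+ 2 - (A + B) * t - D) else C - t ^+ 2)
    (isT : 0 < 2)%N.
  by exists z; rewrite e big_ord_recl big_ord1 /=; ring.
pose z' := C - t ^+ 2 - z.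
have hz' : z' ^+ 2 + (t ^+ 2 - C) * z' + (2 * t ^+ 2 - (A + B) * t - D) = 0.
  by rewrite -hz /z'; ring.
have vt2 : v (t ^+ 2) = (2 * u)%:E by rewrite (valuationX 2 vt).
have inA w : w \in [:: A; B; C; D] -> (u%:E < v w)%E.
  by move/cw; apply: lt_le_trans; rewrite lte_fin.
have hA : (u%:E < v A)%E by apply: inA; rewrite inE eqxx.
have hB : (u%:E < v B)%E by apply: inA; rewrite !inE eqxx ?orbT.
have hC : (u%:E < v C)%E by apply: inA; rewrite !inE eqxx ?orbT.
have hD : (u%:E < v D)%E by apply: inA; rewrite !inE eqxx ?orbT.
have vs : v (C - t ^+ 2) = (2 * u)%:E.
  rewrite addrC valuation_ltD valuationN vt2//.
  by apply: lt_trans hC; rewrite lte_fin; lra.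
suff [x [hx vx]] : exists x : K, x ^+ 2 + (t ^+ 2 - C) * x + (2 * t ^+ 2 - (A + B) * t - D) = 0
    /\ v x = (2 * u)%:E.
  have HX : markov_surface A B C D (t, t, x).
    apply/eqP; rewrite -subr_eq0; apply/eqP; rewrite -hx; ring.
  exists (SigSub (mem_set HX)), u, u, (2 * u); rewrite /= vt vx; split=> //.
  by split; lra.
have [lt|lt|eq] := ltgtP (v z) (2 * u)%:E.
- have vz' : v z' = v z.
    by rewrite /z' addrC valuation_ltD valuationN ?vs.
  (* Writing [t ^+ 2] twice avoids the valuation of 2, on which nothing is known. *)
  have zz : z * z' = t ^+ 2 + t ^+ 2 - (A + B) * t - D by rewrite /z' -[RHS]subr0 -[in RHS]hz; ring.
  have z0 : z != 0.
    by apply/eqP => e; move: lt; rewrite e (valuation_eqy hv 0).2// ltNge leey.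
  have [r er] := valuation_fin z0; exfalso.
  have : ((2 * u)%:E <= v (z * z'))%E.
    rewrite zz; apply: valuation_leD; last first.
      by rewrite valuationN; apply: le_trans (ltW hD); rewrite lee_fin; lra.
    apply: valuation_leD; first by apply: valuation_leD; rewrite vt2.
    rewrite valuationN vM vt (_ : 2 * u = u + u); last by lra.
    by rewrite EFinD leeD2r// valuation_leD// ltW.
  by rewrite vM vz' er -EFinD lee_fin; move: lt; rewrite er lte_fin; lra.
- exists z'; split=> //; rewrite /z' valuation_ltD vs// valuationN//.
- by exists z.
Qed.

Lemma vieta_free : free_involutions (generator (vieta A B C D)).
Proof.
apply: free_generated; first exact: vieta_funK.
move=> w rw w1.
apply: (pingpong _ dominant_nonempty dominant_step dominant_disjoint rw).
  by exists ord0, (@Ordinal 3 1 isT).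
by move=> i X _; apply: w1.
Qed.

End VietaFree.

(** * The congruence subgroup *)

Section Matrix22.
Variable A : comUnitRingType.

Definition mat22 (a b c d : A) : 'M[A]_2 :=
  \matrix_(i, j) (if i == 0 then if j == 0 then a else b else if j == 0 then c else d).

Lemma ord2P (i : 'I_2) : i = 0 \/ i = 1.
Proof. by case: i => [[|[|i]] hi] //; [left|right]; apply/val_inj. Qed.

Lemma mat22E (M : 'M[A]_2) : M = mat22 (M 0 0) (M 0 1) (M 1 0) (M 1 1).
Proof.
by apply/matrixP => i j; rewrite mxE; case: (ord2P i) => ->; case: (ord2P j) => ->.
Qed.

Lemma mul_mat22 a b c d a' b' c' d' :
  mat22 a b c d *m mat22 a' b' c' d' =
  mat22 (a * a' + b * c') (a * b' + b * d') (c * a' + d * c') (c * b' + d * d').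
Proof.
apply/matrixP => i j; rewrite !mxE !big_ord_recl big_ord0 addr0 !mxE /=.
by case: (ord2P i) => ->; case: (ord2P j) => ->.
Qed.

Lemma scale_mat22 k a b c d : k *: mat22 a b c d = mat22 (k * a) (k * b) (k * c) (k * d).
Proof.
apply/matrixP => i j; rewrite !mxE.
by case: (ord2P i) => ->; case: (ord2P j) => ->.
Qed.

Lemma mat22_1 : mat22 1 0 0 1 = 1%:M.
Proof.
apply/matrixP => i j; rewrite !mxE.
by case: (ord2P i) => ->; case: (ord2P j) => ->.
Qed.

Lemma det_mat22 a b c d : \det (mat22 a b c d) = a * d - b * c.
Proof.
rewrite (expand_det_row _ 0) !big_ord_recl big_ord0 addr0 /cofactor !det_mx11 !mxE /=.
by rewrite expr0 expr1 mul1r mulN1r mulrN.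
Qed.

End Matrix22.

Lemma map_mat22 (A B : comUnitRingType) (f : {rmorphism A -> B}) a b c d :
  map_mx f (mat22 a b c d) = mat22 (f a) (f b) (f c) (f d).
Proof.
by apply/matrixP => i j; rewrite !mxE; case: ifP => _; case: ifP => _.
Qed.

Section CongruenceSubgroup.

(* s_i in the parametrization (|u|, |v|, |u + v|) of the cone. *)
Definition refl22 (i : 'I_3) : 'M[int]_2 :=
  match val i with
  | 0 => mat22 (-1) (-2) 0 1
  | 1 => mat22 1 0 (-2) (-1)
  | _ => mat22 1 0 0 (-1)
  end.

Lemma refl22K i : refl22 i *m refl22 i = 1%:M.
Proof.
by rewrite -mat22_1 /refl22; case: i => [[|[|i]] hi] /=; rewrite mul_mat22.
Qed.

Lemma refl22_unit i : refl22 i \in unitmx.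
Proof. by have [] := mulmx1_unit (refl22K i). Qed.

Definition refl_GL2 i : GL2 int := SigSub (refl22_unit i).

Local Open Scope quotient_scope.

Fact refl_mod2 i : PGL2_mod2 (\pi_(PGL2 int) (refl_GL2 i)) == 1%g.
Proof.
apply/eqP; rewrite [LHS]PGL2_map_pi; apply/PGL2_piP; exists 1; first exact: unitr1.
rewrite scale1r /= -mat22_1 /refl22; case: i => [[|[|i]] hi] /=; rewrite map_mat22;
  by congr mat22; apply/val_inj.
Qed.

Definition congruence_refl (i : 'I_3) : PGL2_congruence2 :=
  exist (fun x => PGL2_mod2 x == 1%g) _ (refl_mod2 i).

Definition mxword (w : seq 'I_3) : 'M[int]_2 :=
  foldr (fun i M => refl22 i *m M) 1%:M w.

Fact mxword_unit w : mxword w \in unitmx.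
Proof.
elim: w => [|i w IH] /=; first exact: unitmx1.
by rewrite unitmx_mul refl22_unit IH.
Qed.

Lemma val_wprod_congruence w :
  val (wprod congruence_refl w) = \pi_(PGL2 int) (SigSub (mxword_unit w) : GL2 int).
Proof.
elim: w => [|i w IH] /=.
  have -> : (SigSub (mxword_unit [::]) : GL2 int) = 1%g by apply/val_inj.
  by [].
transitivity (\pi_(PGL2 int) (refl_GL2 i) * val (wprod congruence_refl w))%g => //.
rewrite IH [LHS]PGL2_piM; congr (\pi _); exact/val_inj.
Qed.

Definition odd_diagonal (M : 'M[int]_2) : Prop :=
  exists a b c d, M = mat22 (2 * a + 1) (2 * b) (2 * c) (2 * d + 1).

Definition word_up_to_sign (M : 'M[int]_2) : Prop :=
  exists w (e : int), (e = 1 \/ e = -1) /\ M = e *: mxword w.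

Lemma word_up_to_sign_refl i M : word_up_to_sign (refl22 i *m M) -> word_up_to_sign M.
Proof.
move=> [w [e [He eM]]]; exists (i :: w), e; split=> //=.
by rewrite scalemxAr -eM mulmxA refl22K mul1mx.
Qed.

Lemma unit_int (x : int) : x \is a GRing.unit -> x = 1 \/ x = -1.
Proof. by case/orP => /eqP; tauto. Qed.

(** Multiplication by [refl22 ord0], preceded if necessary by a change of sign of the second row,
    replaces [b] by [b + d] or [b - d] up to sign. Since [d] is 1 or -1, one of these is closer to
    0. *)
Lemma unitmx_triangular (n : nat) (a b d e : int) : (`|b| <= n)%N ->
  (e = 1 \/ e = -1) -> (d = 1 \/ d = -1) -> word_up_to_sign (mat22 e (2 * b) 0 d).
Proof.
elim: n b d e => [|n IH] b d e bn He Hd.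
  have -> : b = 0 by lia.
  have [->|->] : d = e \/ d = - e by lia.
    by exists [::], e; split=> //; rewrite /= -mat22_1 scale_mat22 !mulr0 !mulr1.
  exists [:: ord_max], e; split=> //=.
  by rewrite mulmx1 /refl22 /= scale_mat22 !mulr0 mulr1 mulrN1.
have [b0|b0] := eqVneq b 0; first by apply: IH => //; lia.
have [h|h] : (absz (b + d)%R < absz b)%N \/ (absz (b - d)%R < absz b)%N by lia.
  apply: (@word_up_to_sign_refl ord0).
  rewrite /refl22 /= mul_mat22 (_ : mat22 _ _ _ _ = mat22 (- e) (2 * (- b - d)) 0 d).
    by apply: IH; lia.
  by congr mat22; ring.
apply: (@word_up_to_sign_refl ord_max); apply: (@word_up_to_sign_refl ord0).
rewrite /refl22 /= !mul_mat22 (_ : mat22 _ _ _ _ = mat22 (- e) (2 * (- b + d)) 0 (- d)).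
  by apply: IH; lia.
by congr mat22; ring.
Qed.

(** Euclid's algorithm on the first column, with steps of twice the other entry. One entry is odd
    and the other even, so their absolute values differ and the larger one can be strictly reduced
    until [c = 0]. *)
Lemma congruence_words (n : nat) (a b c d : int) : (absz (2 * a + 1)%R + absz (2 * c)%R <= n)%N ->
  let D := (2 * a + 1) * (2 * d + 1) - (2 * b) * (2 * c) in (D = 1 \/ D = -1) ->
  word_up_to_sign (mat22 (2 * a + 1) (2 * b) (2 * c) (2 * d + 1)).
Proof.
elim: n a b c d => [|n IH] a b c d hn D HD; first by lia.
have [c0|c0] := eqVneq c 0.
  rewrite c0 mulr0; move: HD; rewrite /D c0 !mulr0 subr0 => HD.
  have [Ha Hd] : (2 * a + 1 = 1 \/ 2 * a + 1 = -1) /\ (2 * d + 1 = 1 \/ 2 * d + 1 = -1).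
    have : (2 * a + 1) * (2 * d + 1) \is a GRing.unit.
      by case: HD => ->; rewrite ?unitrN1 ?unitr1.
    by rewrite unitrM => /andP[/unit_int ? /unit_int].
  exact: (@unitmx_triangular `|b|).
have [h|[h|[h|h]]] : (absz ((2 * a + 1) + 2 * (2 * c))%R < absz (2 * a + 1)%R)%N \/
   (absz ((2 * a + 1) - 2 * (2 * c))%R < absz (2 * a + 1)%R)%N \/
   (absz (2 * c + 2 * (2 * a + 1))%R < absz (2 * c)%R)%N \/
   (absz (2 * c - 2 * (2 * a + 1))%R < absz (2 * c)%R)%N by lia.
- apply: (@word_up_to_sign_refl ord0); rewrite /refl22 /= mul_mat22.
  rewrite (_ : mat22 _ _ _ _ = mat22 (2 * (- a - 1 - 2 * c) + 1) (2 * (- b - 2 * d - 1))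
    (2 * c) (2 * d + 1)); last by congr mat22; ring.
  by apply: IH; [lia|move: HD; rewrite /D; lia].
- apply: (@word_up_to_sign_refl ord_max); apply: (@word_up_to_sign_refl ord0).
  rewrite /refl22 /= !mul_mat22.
  rewrite (_ : mat22 _ _ _ _ = mat22 (2 * (- a - 1 + 2 * c) + 1) (2 * (- b + 2 * d + 1))
    (2 * (- c)) (2 * (- d - 1) + 1)); last by congr mat22; ring.
  by apply: IH; [lia|move: HD; rewrite /D; lia].
- apply: (@word_up_to_sign_refl (@Ordinal 3 1 isT)); rewrite /refl22 /= mul_mat22.
  rewrite (_ : mat22 _ _ _ _ = mat22 (2 * a + 1) (2 * b)
    (2 * (- c - 2 * a - 1)) (2 * (- d - 1 - 2 * b) + 1)); last by congr mat22; ring.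
  by apply: IH; [lia|move: HD; rewrite /D; lia].
- apply: (@word_up_to_sign_refl ord_max).
  apply: (@word_up_to_sign_refl (@Ordinal 3 1 isT)); rewrite /refl22 /= !mul_mat22.
  rewrite (_ : mat22 _ _ _ _ = mat22 (2 * a + 1) (2 * b)
    (2 * (c - 2 * a - 1)) (2 * (d - 2 * b) + 1)); last by congr mat22; ring.
  by apply: IH; [lia|move: HD; rewrite /D; lia].
Qed.

Lemma intr_Z2 (z : int) : (z%:~R = 0 :> 'Z_2 -> exists c, z = 2 * c) /\
  (z%:~R = 1 :> 'Z_2 -> exists c, z = 2 * c + 1).
Proof.
have [c [e|e]] : exists c, z = 2 * c \/ z = 2 * c + 1.
  by exists (z %/ 2)%Z; have := divz_eq z 2; have := modz_ge0 z (isT : 2 != 0 :> int);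
    have := ltz_pmod z (isT : 0 < 2 :> int); lia.
all: have r : (2 * c)%:~R = 0 :> 'Z_2 by rewrite intrM (_ : 2%:~R = 0) ?mul0r//; apply/val_inj.
  by split=> [_|]; [exists c|rewrite e r].
by split=> [|_]; [rewrite e intrD r|exists c].
Qed.

Lemma kernel_odd_diagonal (g : PGL2_congruence2) : odd_diagonal (val (repr (val g))).
Proof.
have /eqP := valP g; rewrite -{1}[val g]reprK [LHS]PGL2_map_pi => /PGL2_piP[k uk e].
(* The only unit of Z/2Z is 1, so the matrix itself, and not only its class, reduces to the
   identity. *)
have k1 : k = 1.
  by case: (ord2P k) uk => [->|->//]; rewrite unitr0.
move: e; rewrite k1 scale1r /= => /esym e.
have ent i j : ((val (repr (val g))) i j)%:~R = (i == j)%:R :> 'Z_2.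
  by have := congr1 (fun M : 'M['Z_2]_2 => M i j) e; rewrite !mxE.
have [a ea] := (intr_Z2 _).2 (ent 0 0); have [b eb] := (intr_Z2 _).1 (ent 0 1).
have [c ec] := (intr_Z2 _).1 (ent 1 0); have [d ed] := (intr_Z2 _).2 (ent 1 1).
by exists a, b, c, d; rewrite [LHS]mat22E ea eb ec ed.
Qed.

Lemma congruence_gen (g : PGL2_congruence2) : exists w, g = wprod congruence_refl w.
Proof.
have [a [b [c [d e]]]] := kernel_odd_diagonal g.
have := valP (repr (val g)); rewrite unitmxE e det_mat22 => u.
have HD : let D := (2 * a + 1) * (2 * d + 1) - (2 * b) * (2 * c) in D = 1 \/ D = -1.
  exact: unit_int u.
have [w [k [k1 ew]]] := congruence_words (leqnn _) HD.
exists w; apply/val_inj; rewrite val_wprod_congruence -[LHS]reprK.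
apply/esym/PGL2_piP; exists k; first by case: k1 => ->.
by rewrite e ew.
Qed.

Lemma congruence_sqr i : (congruence_refl i * congruence_refl i = 1)%g.
Proof.
apply/val_inj; transitivity (\pi_(PGL2 int) (refl_GL2 i * refl_GL2 i)%g).
  exact: PGL2_piM.
have -> : (refl_GL2 i * refl_GL2 i)%g = 1%g by apply/val_inj; exact: refl22K.
by [].
Qed.

End CongruenceSubgroup.

(** * The plane modulo antipodes *)

Section Cone.
Variable R : realType.
Implicit Types (w : 'cV[R]_2) (y : R * R * R).

Local Notation S := (tropical_surface (0, 0, 0) (0 : R)).
Local Notation s := (tropical_mirror (0, 0, 0) (0 : R)).

Definition fold w : R * R * R := (`|w 0 0|, `|w 1 0|, `|w 0 0 + w 1 0|).

Definition vec (u v : R) : 'cV[R]_2 := u *: delta_mx 0 0 + v *: delta_mx 1 0.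

(** [y.2 = y.1.1 + y.1.2] means that the two entries have equal signs. The chosen vector may jump to
    its antipode; only its class depends continuously on [y]. *)
Definition unfold y : 'cV[R]_2 :=
  if y.2 == y.1.1 + y.1.2 then vec y.1.1 y.1.2 else vec y.1.1 (- y.1.2).

Lemma vecE u v : (vec u v 0 0 = u) * (vec u v 1 0 = v).
Proof. by rewrite /vec !mxE /= !mulr1 !mulr0 addr0 add0r. Qed.

Lemma vec_eta w : w = vec (w 0 0) (w 1 0).
Proof.
apply/matrixP => i j; rewrite (ord1 j).
by case: (ord2P i) => ->; rewrite vecE.
Qed.

Lemma fold_vec u v : fold (vec u v) = (`|u|, `|v|, `|u + v|).
Proof. by rewrite /fold !vecE. Qed.

Lemma foldN w : fold (- w) = fold w.
Proof. by rewrite /fold !mxE !normrN -opprD normrN. Qed.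

Lemma surface0P y : S y <-> [/\ 0 <= y.1.1, 0 <= y.1.2, 0 <= y.2 &
  [\/ y.1.1 = y.1.2 + y.2, y.1.2 = y.1.1 + y.2 | y.2 = y.1.1 + y.1.2]].
Proof.
case: y => [[p q] r]; rewrite /tropical_surface /sk /=; split.
  move=> [[h1 h2 h3] [[h4 h5 h6 h7] H]].
  split; [clear H; lra..|].
  by case: H => [|[|[|[|[|[|]]]]]] e; [constructor 1|constructor 2|constructor 3
    |constructor 1|constructor 2|constructor 3|constructor 1]; lra.
move=> [p0 q0 r0 [] e].
- by split; [split; lra|split; [split; lra|left]].
- by split; [split; lra|split; [split; lra|right; left]].
- by split; [split; lra|split; [split; lra|right; right; left]].
Qed.

Lemma fold_surface w : S (fold w).
Proof.
apply/surface0P; rewrite /fold /=; move: (w 0 0) (w 1 0) => u v; split=> //.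
case: (ger0P u) => hu; case: (ger0P v) => hv; case: (ger0P (u + v)) => huv;
  first [by constructor 1; lra|by constructor 2; lra|by constructor 3; lra].
Qed.

Lemma unfoldK y : S y -> fold (unfold y) = y.
Proof.
move=> /surface0P; case: y => [[p q] r]; rewrite /unfold /= => -[p0 q0 r0 H].
case: eqP => e; rewrite fold_vec ?normrN (ger0_norm p0) (ger0_norm q0).
  by rewrite e ger0_norm// addr_ge0.
case: H => [H|H|//]; congr (_, _, _); subst.
  by rewrite addrAC subrr add0r ger0_norm.
by rewrite opprD addrA subrr add0r normrN ger0_norm.
Qed.

Lemma fold_inj w w' : fold w = fold w' -> w = w' \/ w = - w'.
Proof.
rewrite (vec_eta w) (vec_eta w'); move: (w 0 0) (w 1 0) (w' 0 0) (w' 1 0) => u v u' v'.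
rewrite !fold_vec => -[e1 e2 e3].
have Nvec : - vec u' v' = vec (- u') (- v') by rewrite /vec opprD !scaleNr.
suff [[-> ->]|[-> ->]] : (u = u' /\ v = v') \/ (u = - u' /\ v = - v').
- by left.
- by right; rewrite Nvec.
have sgn (x y : R) : `|x| = `|y| -> x = y \/ x = - y.
  by move/eqP; rewrite eqr_norm2 => /orP[]/eqP; tauto.
case: (sgn _ _ e1) (sgn _ _ e2) (sgn _ _ e3) => -> [] -> [] e;
  by first [left; split; lra|right; split; lra].
Qed.

(** [max (2 |x|, 2 |y|) = |x + y| + |x - y|]: the tropical involution exchanges [|x + y|] and
    [|x - y|], hence is linear on the plane. *)
Lemma farspec_norm (x y : R) : farspec (`|x + y| + `|x - y|) 0 0 0 `|x| `|y|.
Proof.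
rewrite /farspec !add0r.
have N0 := normr_ge0 x; have N1 := normr_ge0 y; have N2 := normr_ge0 (x + y).
have N3 := normr_ge0 (x - y).
have h1 : 2 * `|x| <= `|x + y| + `|x - y|.
  have := ler_normD (x + y) (x - y); rewrite (_ : x + y + (x - y) = 2 * x); last by ring.
  by rewrite normrM ger0_norm.
have h2 : 2 * `|y| <= `|x + y| + `|x - y|.
  have := ler_normB (x + y) (x - y); rewrite (_ : x + y - (x - y) = 2 * y); last by ring.
  by rewrite normrM ger0_norm.
split; first by split; lra.
clear N0 N1 N2 N3; have [xy|xy] := lerP `|y| `|x|; [left|right; right; left].
  apply/eqP; rewrite eq_le h1 andbT; move: xy {h1 h2}.
  by case: (ger0P x) => hx; case: (ger0P y) => hy xy; case: (ger0P (x + y)) => hxy;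
    case: (ger0P (x - y)) => hxy'; lra.
apply/eqP; rewrite eq_le h2 andbT; move: xy {h1 h2}.
by case: (ger0P x) => hx; case: (ger0P y) => hy xy; case: (ger0P (x + y)) => hxy;
  case: (ger0P (x - y)) => hxy'; lra.
Qed.

Lemma map_refl22_vec i u v : map_mx intr (refl22 i) *m vec u v =
  match val i with
  | 0 => vec (- u - 2 * v) v | 1 => vec u (- 2 * u - v) | _ => vec u (- v) end.
Proof.
have E (A B C D : int) : map_mx intr (mat22 A B C D) *m vec u v =
    vec (A%:~R * u + B%:~R * v) (C%:~R * u + D%:~R * v).
  apply/matrixP => k l; rewrite (ord1 l) /vec !mxE !big_ord_recl big_ord0 !mxE /=.
  by case: (ord2P k) => -> /=; ring.
by rewrite /refl22; case: i => [[|[|i]] hi] /=; rewrite E; congr vec; ring.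
Qed.

Lemma fold_refl i w : fold (map_mx intr (refl22 i) *m w) = s i (fold w).
Proof.
rewrite (vec_eta w) map_refl22_vec; move: (w 0 0) (w 1 0) => u v.
rewrite fold_vec /tropical_mirror /far.
case: i => [[|[|i]] hi] /=; rewrite fold_vec.
- have F := farspecC (farspec_norm (u + v) v).
  rewrite (farspec_uniq (farvP _ _ _ _ _) F).
  congr (_, _, _); first by rewrite addrK addrK -normrN; congr `|_|; ring.
  by rewrite -normrN; congr `|_|; ring.
- have F := farspecC (farspec_norm (u + v) u).
  rewrite (farspec_uniq (farvP _ _ _ _ _) F).
  rewrite (_ : u + v - u = v) ?addrK; last by ring.
  congr (_, _, _); first by rewrite -normrN; congr `|_|; ring.
  by rewrite -normrN; congr `|_|; ring.
- have F := farspec_norm u v.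
  by rewrite (farspec_uniq (farvP _ _ _ _ _) F) normrN [`|u + v| + _]addrC addrK.
Qed.

Lemma fold_mxword l w : fold (map_mx intr (mxword l) *m w) = wact s l (fold w).
Proof.
elim: l => [|i l IH] /=; first by rewrite map_mx1 mul1mx.
by rewrite map_mxM -mulmxA fold_refl IH.
Qed.

Lemma fold_continuous : continuous fold.
Proof.
move=> w; rewrite /fold.
have c0 : continuous_at w (fun z : 'cV[R]_2 => z 0 0) 
    by apply: coord_continuous.
have c1 : continuous_at w (fun z : 'cV[R]_2 => z 1 0) 
    by apply: coord_continuous.
have n f : continuous_at w f -> continuous_at w (fun z : 'cV[R]_2 => `|f z| : R).
  by move=> cf; apply: (continuous_comp cf); apply: norm_continuous.
by apply: continuous_triple; apply: n => //; apply: continuous_addf.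
Qed.

Lemma vec_continuous (f g : R * R * R -> R) y : continuous_at y f -> continuous_at y g ->
  continuous_at y (fun z => vec (f z) (g z)).
Proof.
move=> cf cg; rewrite /vec.
have c1 : continuous_at y (fun z => f z *: delta_mx 0 0 : 'cV[R]_2) := continuousZr_tmp cf.
have c2 : continuous_at y (fun z => g z *: delta_mx 1 0 : 'cV[R]_2) := continuousZr_tmp cg.
exact: continuousD c1 c2.
Qed.

Local Open Scope quotient_scope.

Definition unfold_pi y : plane_mod_antipodes R := \pi_(plane_mod_antipodes R) (unfold y).

Lemma pi_antipodal w : \pi_(plane_mod_antipodes R) (- w) = \pi_(plane_mod_antipodes R) w.
Proof. by apply/eqmodP; rewrite /= /antipodal eqxx orbT. Qed.

Lemma unfold_pi_fold w : unfold_pi (fold w) = \pi_(plane_mod_antipodes R) w.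
Proof.
rewrite /unfold_pi.
by case: (fold_inj (unfoldK (fold_surface w))) => ->; rewrite ?pi_antipodal.
Qed.

(** Where the two cases of [unfold] overlap, one of the first two coordinates is 0, so the two
    vectors are equal or antipodal. *)
Lemma unfold_pi_inr y : S y -> y.2 != y.1.1 + y.1.2 \/ y.1.1 = y.1.2 + y.2 \/
  y.1.2 = y.1.1 + y.2 -> unfold_pi y = \pi_(plane_mod_antipodes R) (vec y.1.1 (- y.1.2)).
Proof.
move=> /surface0P; case: y => [[p q] r]; rewrite /unfold_pi /unfold /= => -[p0 q0 r0 _].
case: eqP => // e [//|H].
have [q00|p00] : q = 0 \/ p = 0 by case: H => ?; [left|right]; lra.
  by rewrite q00 oppr0.
rewrite p00 -pi_antipodal; congr (\pi _).
by rewrite /vec !scale0r !add0r scaleNr.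
Qed.

Lemma pi_vec_continuous (f g : R * R * R -> R) y : continuous_at y f -> continuous_at y g ->
  continuous_at y (fun z => \pi_(plane_mod_antipodes R) (vec (f z) (g z))).
Proof.
move=> cf cg; apply: (continuous_comp (vec_continuous cf cg)).
exact: (@pi_continuous _ {eq_quot (@antipodal R)}).
Qed.

(** The cone is the union of two closed pieces, each with a continuous formula. A piece that
    contains [y] has the right limit there, and one that does not is absent near [y]. *)
Lemma unfold_pi_continuous y : S y -> unfold_pi @ within S (nbhs y) --> unfold_pi y.
Proof.
move=> Sy N Ny; rewrite nbhs_simpl/= /within/=.
have c1 : continuous_at y (fun z => \pi_(plane_mod_antipodes R) (vec z.1.1 z.1.2)).
  by apply: pi_vec_continuous; cts.
have c2 : continuous_at y (fun z => \pi_(plane_mod_antipodes R) (vec z.1.1 (- z.1.2))).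
  by apply: pi_vec_continuous; cts.
have neq (f g : R * R * R -> R) : continuous_at y f -> continuous_at y g -> f y != g y ->
    \forall z \near y, f z != g z.
  move=> cf cg fg.
  have c : continuous_at y (fun z => `|f z - g z| : R).
    have cs : continuous_at y (fun z => f z - g z) by cts.
    by apply: (continuous_comp cs); apply: norm_continuous.
  have := near_gt0 c; rewrite normr_gt0 subr_eq0 => /(_ fg).
  by apply: nearS => z; rewrite normr_gt0 subr_eq0.
have H1 : \forall z \near y, z.2 = z.1.1 + z.1.2 ->
    N (\pi_(plane_mod_antipodes R) (vec z.1.1 z.1.2)).
  have [e|e] := eqVneq y.2 (y.1.1 + y.1.2).
    apply: nearS (c1 N _) => //=.
    by move: Ny; rewrite /unfold_pi /unfold e eqxx.
  have cf : continuous_at y (fun z => z.2 : R) by cts.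
  have cg : continuous_at y (fun z => z.1.1 + z.1.2 : R) by cts.
  by apply: nearS (neq _ _ cf cg e) => z /eqP.
have H2 : \forall z \near y, z.1.1 = z.1.2 + z.2 \/ z.1.2 = z.1.1 + z.2 ->
    N (\pi_(plane_mod_antipodes R) (vec z.1.1 (- z.1.2))).
  have [H|H] := pselect (y.1.1 = y.1.2 + y.2 \/ y.1.2 = y.1.1 + y.2).
    apply: nearS (c2 N _) => //=.
    by move: Ny; rewrite unfold_pi_inr//; right.
  have cf : continuous_at y (fun z => z.1.1 : R) by cts.
  have cg : continuous_at y (fun z => z.1.2 + z.2 : R) by cts.
  have cf' : continuous_at y (fun z => z.1.2 : R) by cts.
  have cg' : continuous_at y (fun z => z.1.1 + z.2 : R) by cts.
  have e : y.1.1 != y.1.2 + y.2 by apply/eqP => e; apply: H; left.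
  have e' : y.1.2 != y.1.1 + y.2 by apply/eqP => e'; apply: H; right.
  by apply: nearS (nearI (neq _ _ cf cg e) (neq _ _ cf' cg' e')) => z [/eqP ? /eqP ?] [].
apply: nearS (nearI H1 H2) => z [h1 h2] Sz; change (N (unfold_pi z)).
have [e|e] := eqVneq z.2 (z.1.1 + z.1.2).
  by rewrite /unfold_pi /unfold e eqxx; apply: h1.
rewrite unfold_pi_inr//; last by left.
by apply: h2; move/surface0P: Sz e => [_ _ _ [->|->|->]]; rewrite ?eqxx//; [left|right].
Qed.

Lemma unfold_pi_mxword l y (M : GL2 int) : val M = mxword l -> S y ->
  unfold_pi (wact s l y) = PGL2_act (\pi_(PGL2 int) M) (unfold_pi y).
Proof.
move=> eM Sy; rewrite -{1}(unfoldK Sy) -fold_mxword unfold_pi_fold.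
by rewrite PGL2_act_pi eM.
Qed.

(** A word with trivial class has matrix 1 or -1, which [fold] does not see. It therefore fixes the
    whole cone, where ping-pong applies. *)
Lemma congruence_free : free_involutions congruence_refl.
Proof.
split; [exact: congruence_sqr|exact: congruence_gen|].
move=> w rw e.
have a0 (i : 'I_3) : 0 <= co i ((0, 0, 0) : R * R * R).
  by rewrite /co; case: i => [[|[|i]] hi].
apply: (mirror_pingpong (tropical_system a0 (lexx 0)) (i0 := ord0)) rw _.
  exists (2, 1, 1); first by apply/surface0P; split=> //=; constructor 1; lra.
  rewrite tropical_gap /far /co /= (_ : farv 0 0 0 1 1 = 2); first by lra.
  by apply: (farspec_uniq (farvP _ _ _ _ _)); split; [split; lra|left; lra].
move=> y Sy; have := congr1 val e; rewrite val_wprod_congruence.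
move=> /esym/PGL2_piP[k uk /= ek].
have k1 : k = 1 \/ k = -1 by apply: unit_int.
rewrite -{1}(unfoldK Sy) -fold_mxword ek map_mxZ map_mx1.
by case: k1 => ->; rewrite ?rmorph1 ?rmorphN1 ?scaleN1r ?scale1r ?mulNmx mul1mx ?foldN unfoldK.
Qed.

End Cone.

(** * Tropical actions *)

Section SetType.
Variables (X : topologicalType).

Lemma set_val_continuous (A : set X) : continuous (\val : A -> X).
Proof. exact: (@initial_continuous A X set_val). Qed.

Lemma continuous_set_type (Y : topologicalType) (A : set X) (f : Y -> A) :
  continuous (\val \o f) -> continuous f.
Proof. exact: (@continuous_comp_initial A Y X set_val f). Qed.

(** The bridge from continuity relative to a subset of R^3 to continuity on the corresponding
    subtype. *)
Lemma within_comp_continuous (Y Z : topologicalType) (A : set X) (f : X -> Z) (g : Y -> X) y :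
  (forall z, A (g z)) -> continuous_at y g ->
  f @ within A (nbhs (g y)) --> f (g y) -> continuous_at y (f \o g).
Proof.
move=> Ag cg cf N /cf; rewrite nbhs_simpl/= /within/= => H.
by apply: nearS (cg _ H) => z /= Hz; apply: Hz.
Qed.

End SetType.

Section TriangleGroup.
Variables (R : realType) (T : ideal_triangle R).

Lemma triangle_free : free_involutions (generator (side_reflection T)).
Proof.
have [k [k0 kG]] := normalized_vertices T.
have sys := hyperbolic_system k0 kG.
apply: free_generated; first exact: side_funK.
move=> w rw w1; apply: (mirror_pingpong sys (i0 := ord0)) rw _; last first.
  move=> p Hp; have vE u (q : @hyperbolic_plane R) :
    \val (wact (fun i => fwd (side_reflection T i)) u q) =
    wact (fun i => reflection (T (i + 1)) (T (i + 2))) u (\val q).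
    by elim: u => //= i u <-.
  by have := vE w (SigSub (mem_set Hp)); rewrite w1 /= => <-.
(* The centre of the ideal triangle. Its gaps are positive, so its mirror image has a negative gap,
   as ping-pong requires. *)
pose f : R * R * R := (1, 1, 1).
have f1 i : co i f = 1 by rewrite /co; case: i => [[|[|i]] hi].
have ft : total f = 3 by rewrite /total /=; lra.
have q0 : 0 < quad f by apply: quad_gt0 => i; rewrite f1 ?ft; lra.
have r0 : 0 < (Num.sqrt (quad f))^-1 by rewrite invr_gt0 sqrtr_gt0.
have Hp : hyperbolic_plane (of_horo T k (normalize f)).
  apply: (of_horo_hyperbolic k0 kG) => [i|i|]; rewrite ?quad_normalize//.
    by rewrite co_dil f1 mulr1.
  by rewrite co_dil total_dil f1 ft; lra.
exists (reflection (T (ord0 + 1)) (T (ord0 + 2)) (of_horo T k (normalize f))).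
  exact: (mirror_stable sys ord0).
have -> := gap_mirror sys ord0 (of_horo T k (normalize f)).
rewrite (hyper_gap k0 kG) (horo3_of_horo kG) (horo_of_horo kG) co_dil total_dil f1 ft; lra.
Qed.

End TriangleGroup.

Section Main.
Variables (R : realType) (K : closedFieldType) (v : K -> \bar R).
Hypotheses (hv : valuation v) (hnt : nontrivial_valuation v).
Variables (A B C D : K) (a b c d : \bar R).
Hypotheses (ay : a != -oo%E) (yb : b != -oo%E) (cy : c != -oo%E) (dy : d != -oo%E).

Local Notation ta := (trunc a, trunc b, trunc c).
Local Notation td := (trunc d).
Local Notation S := (tropical_surface ta td).
Local Notation s := (tropical_mirror ta td).
Local Notation G := (vieta_group A B C D).
Local Notation gen := (generator (vieta A B C D)).
Local Notation Sk := (skeleton a b c d).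

Let fV : free_involutions gen := vieta_free hv hnt A B C D.

Let a0 (i : 'I_3) : 0 <= co i ta.
Proof. by rewrite /co; case: i => [[|[|i]] hi]; apply: trunc_ge0. Qed.

Let d0 : 0 <= td := trunc_ge0 d.

Let sys := tropical_system a0 d0.

Let SkS x : Sk x <-> S (negt x) := skeleton_surface ay yb cy dy x.

Let wact_skeleton w x : Sk x -> Sk (negt (wact s w (negt x))).
Proof. by move=> /SkS Sx; apply/SkS; rewrite negtK; apply: (wact_stable sys). Qed.

Let Sk_val (x : Sk) : S (negt (\val x)).
Proof. exact: (SkS _).1 (set_mem (valP x)). Qed.

(** Each group element acts through a chosen word; freeness makes the result independent of the
    choice, hence multiplicative. *)
Lemma tropical_action_exists : exists act : G -> Sk -> Sk, tropical_action act.
Proof.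
pose word g := projT1 (cid (free_gen fV g)).
have wordP g : wprod gen (word g) = g by rewrite /word; case: cid.
pose act (g : G) (x : Sk) : Sk :=
  SigSub (mem_set (wact_skeleton (word g) (set_mem (valP x)))).
have wE w1 w2 : wprod gen w1 = wprod gen w2 -> wact s w1 =1 wact s w2.
  by apply: (free_wact_eq fV); apply: (mirrorK sys).
exists act; split; [split=> [x|g h x]|move=> i x]; try apply/val_inj; rewrite /act /=.
- by rewrite (wE _ [::]) ?wordP//= negtK.
- by rewrite negtK -wact_cat (wE _ (word g ++ word h)) ?wordP ?wprod_cat ?wordP.
- rewrite (wE _ [:: i]) ?wordP/= ?mulg1//.
  by rewrite (trop_vieta_mirror ay yb cy dy i (set_mem (valP x))).
Qed.

Variable act : G -> Sk -> Sk.
Hypothesis Hact : tropical_action act.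

Let val_act w x : negt (\val (act (wprod gen w) x)) = wact s w (negt (\val x)).
Proof.
have [[act1 actM] actg] := Hact.
elim: w => [|i w IH] /=; first by rewrite act1.
by rewrite actM actg (trop_vieta_mirror ay yb cy dy i (set_mem (valP _))) negtK IH.
Qed.

Let negt_val_continuous : continuous (fun x : Sk => negt (\val x)).
Proof.
by move=> x; apply: continuous_comp; [exact: set_val_continuous|exact: negt_continuous].
Qed.

(** * Negative minimum: conjugation with the triangle group *)

Section Hyperbolic.
Hypothesis neg : (emin [:: a; b; c; d] < 0)%E.

Definition tiled_part : set Sk := [set x | tiled S s (@co R) (negt (\val x))].

Lemma tiled_part_invariant : invariant_set act tiled_part.
Proof.
move=> g x Ux; have [w ->] := free_gen fV g.
by rewrite /tiled_part /= val_act; apply: (tiled_wact sys).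
Qed.

Lemma tiled_part_open : open tiled_part.
Proof.
rewrite openE => x Ux; rewrite /interior /=.
apply: nearS (negt_val_continuous (tiled_near sys Ux)) => z /= Hz.
exact: Hz (Sk_val z).
Qed.

Lemma tiled_part_dense : dense tiled_part.
Proof.
have [m m0 am] := emin_lt0_trunc ay yb cy dy neg.
move=> O [x Ox] oO; have : nbhs x O by apply: open_nbhs_nbhs.
case=> _ [[N oN <-] /= Nx NO].
have N' : nbhs (negt (\val x)) (@negt R @^-1` N).
  apply: negt_continuous; rewrite negtK; apply: open_nbhs_nbhs; split=> //.
have [z [Sz Nz Uz]] := tiled_limit a0 d0 m0 am (Sk_val x) N'.
have Skz : Sk (negt z) by apply/SkS; rewrite negtK.
exists (SigSub (mem_set Skz)); split; first exact: NO.
by rewrite /tiled_part /= negtK.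
Qed.

Lemma tiled_part_conjugate (T : ideal_triangle R) :
  topologically_conjugate (act_on tiled_part_invariant)
    (sym_act (s := side_reflection T)).
Proof.
have [m m0 am] := emin_lt0_trunc ay yb cy dy neg.
have [theta [theta_bij thetaE]] := free_iso fV (triangle_free T).
have [k [k0 kG]] := normalized_vertices T.
have [h [k' [hP kP]]] := tropical_hyperbolic a0 d0 m0 am k0 kG.
pose Y (u : tiled_part) := negt (\val (\val u)).
have UY u : tiled S s (@co R) (Y u) by have /set_mem := valP u.
have Hh u : hyperbolic_plane (h (Y u)) by case: (hP _ (UY u)).
have Kp (p : @hyperbolic_plane R) : Sk (negt (k' (\val p))).
  apply/SkS; rewrite negtK; have /set_mem Hp := valP p.
  by have [[]] := kP _ Hp.
have Kp' (p : @hyperbolic_plane R) : tiled_part (SigSub (mem_set (Kp p))).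
  by rewrite /tiled_part /= negtK; have /set_mem Hp := valP p; have [] := kP _ Hp.
exists theta, (fun u => SigSub (mem_set (Hh u)) : @hyperbolic_plane R); split=> //.
- split.
    apply: continuous_set_type => u.
    apply: (@within_comp_continuous _ _ _ S h Y).
    + by move=> z; case: (UY z).
    + apply: (@continuous_comp _ _ _ (\val : tiled_part -> Sk)
        (fun x : Sk => negt (\val x))); first exact: set_val_continuous.
      exact: negt_val_continuous.
    + by case: (hP _ (UY u)).
  exists (fun p => SigSub (mem_set (Kp' p)) : tiled_part); split.
  + do 2!apply: continuous_set_type; move=> p.
    have ck : continuous_at p (k' \o (\val : @hyperbolic_plane R -> R * R * R)).
      apply: (@within_comp_continuous _ _ _ (@hyperbolic_plane R) k').
      * by move=> z; apply: set_mem (valP z).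
      * exact: set_val_continuous.
      * by have /set_mem Hp := valP p; have [] := kP _ Hp.
    exact: (continuous_comp ck (@negt_continuous R _)).
  + move=> u; do 2!apply: val_inj; rewrite /=.
    by have [_ -> _ _] := hP _ (UY u); rewrite /Y negtK.
  + move=> p; apply: val_inj; rewrite /= /Y /= negtK.
    by have /set_mem Hp := valP p; have [] := kP _ Hp.
- move=> g u; have [w ->] := free_gen fV g; apply: val_inj.
  rewrite thetaE /sym_act val_wprod fwd_wprod /= /Y /= val_act.
  have hw l y : tiled S s (@co R) y ->
      h (wact s l y) = wact (fun i => reflection (T (i + 1)) (T (i + 2))) l (h y).
    elim: l => //= i l IH Uy; rewrite -IH//.
    by have [_ _ -> _] := hP _ (tiled_wact sys l Uy).
  rewrite hw; last exact: UY.
  by elim: w => //= i w <-.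
Qed.

End Hyperbolic.

(** * Nonnegative minimum: conjugation with the linear action *)

Section Euclidean.
Local Open Scope quotient_scope.
Hypothesis pos : (0 <= emin [:: a; b; c; d])%E.

Lemma skeleton_conjugate : topologically_conjugate act (@congruence2_act R).
Proof.
have [ea ed] := emin_ge0_trunc ay yb cy dy pos.
have [theta [theta_bij thetaE]] := free_iso fV (congruence_free R).
have Sv (x : Sk) : tropical_surface (0, 0, 0) 0 (negt (\val x)).
  by rewrite -ea -ed; apply: Sk_val.
have Kp (p : plane_mod_antipodes R) : Sk (negt (fold (repr p))).
  by apply/SkS; rewrite negtK ea ed; apply: fold_surface.
exists theta, (fun x : Sk => unfold_pi (negt (\val x))); split=> //.
- split.
    move=> x; apply: (@within_comp_continuous _ _ _ (tropical_surface (0, 0, 0) 0)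
      (@unfold_pi R) (fun x : Sk => negt (\val x))) => //.
    exact: unfold_pi_continuous.
  exists (fun p => SigSub (mem_set (Kp p)) : Sk); split.
  + apply: continuous_set_type.
    apply: (@repr_comp_continuous _ {eq_quot (@antipodal R)} _ (@negt R \o @fold R)).
      move=> w; apply: continuous_comp; first exact: fold_continuous.
      exact: negt_continuous.
    move=> w w' /eqP/eqmodP/orP[]/eqP-> //=.
    by rewrite foldN.
  + move=> x; apply: val_inj => /=.
    have e : \pi_(plane_mod_antipodes R) (repr (unfold_pi (negt (\val x)))) =
        \pi_(plane_mod_antipodes R) (unfold (negt (\val x))) by rewrite reprK.
    have : fold (repr (unfold_pi (negt (\val x)))) = fold (unfold (negt (\val x))).
      by move/eqmodP: e => /orP[]/eqP->; rewrite ?foldN.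
    by move=> ->; rewrite unfoldK// negtK.
  + by move=> p; rewrite /= negtK unfold_pi_fold reprK.
- move=> g x; have [w ->] := free_gen fV g.
  rewrite val_act thetaE ea ed /congruence2_act val_wprod_congruence.
  exact: unfold_pi_mxword.
Qed.

End Euclidean.
End Main.

Theorem theorem1 (R : realType) (K : closedFieldType) (v : K -> \bar R)
    (hv : valuation v) (hnt : nontrivial_valuation v)
    (A B C D : K) (a b c d : \bar R)
    (ha : v A = a) (hb : v B = b) (hc : v C = c) (hd : v D = d) :
  (exists act : vieta_group A B C D -> skeleton a b c d -> skeleton a b c d,
     tropical_action act) /\
  forall act : vieta_group A B C D -> skeleton a b c d -> skeleton a b c d,
    tropical_action act ->
    ((emin [:: a; b; c; d] < 0)%E ->
       exists (U : set (skeleton a b c d)) (inv_U : invariant_set act U),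
         [/\ open U, dense U &
             forall T : ideal_triangle R,
               topologically_conjugate (act_on inv_U)
                 (sym_act (s := side_reflection T))])
    /\
    ((0 <= emin [:: a; b; c; d])%E ->
       topologically_conjugate act (@congruence2_act R)).
Proof.
have ay : a != -oo%E by rewrite -ha valuation_neqNy.
have yb : b != -oo%E by rewrite -hb valuation_neqNy.
have cy : c != -oo%E by rewrite -hc valuation_neqNy.
have dy : d != -oo%E by rewrite -hd valuation_neqNy.
split; first exact: tropical_action_exists hv hnt _ _ _ _ _ _ _ _ ay yb cy dy.
move=> act Hact; split=> [neg|pos]; last exact: (skeleton_conjugate hv hnt ay yb cy dy Hact).
exists (tiled_part (a := a) (b := b) (c := c) (d := d)).
exists (tiled_part_invariant hv hnt ay yb cy dy Hact); split.
- exact: tiled_part_open.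
- exact: tiled_part_dense.
- exact: tiled_part_conjugate.
Qed.
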